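(* Let $H_n^-=\sum_{k=1}^n\frac{(-1)^{k-1}}{k}$ and let $v(s)=\sum_{n\ge1}\frac{(-1)^{n-1}}{n^s}H_n^-$ (for $\operatorname{Re}s>0$, and its meromorphic continuation to $\mathbb{C}$). For $s\in\mathbb{C}\setminus\{1,2,3,\dots\}$ define $$G(s)=\frac{\Gamma(1-s)}{2\pi i}\int_L\frac{z^{s-1}e^z}{1+e^z}\log\Big(\frac{e^z-1}{z}\Big)\,dz,$$ where $L$ is the Hankel contour consisting of the lower side ($\arg z=-\pi$) of the ray $(-\infty,-\epsilon)$ traced from left to right, the circle $\{\epsilon e^{i\theta}:-\pi\le\theta\le\pi\}$ traced counterclockwise, and the upper side ($\arg z=\pi$) of the ray $(-\infty,-\epsilon)$ traced from right to left (for small $\epsilon>0$), and $z^{s-1}$ uses the corresponding argument. Then for every complex $s$ at which both sides are defined, $$G(s)=v(s)-\zeta(s+1)-\psi(s)\eta(s)-\eta'(s),$$ where $\psi=\Gamma'/\Gamma$ is the digamma function.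
   Context: $\zeta$ is the Riemann zeta function; $\eta(s)=\sum_{n\ge1}(-1)^{n-1}n^{-s}$ for $\operatorname{Re}s>0$, extended to an entire function via $\eta(s)=(1-2^{1-s})\zeta(s)$. The logarithm $\log((e^z-1)/z)$ is the branch that is holomorphic near $0$ and real on the negative real axis. *)

(* Defs.v *)
From Stdlib Require Import Reals ZArith ClassicalEpsilon.
From Coquelicot Require Import Coquelicot.

Open Scope R_scope.
Open Scope C_scope.

Definition cexp (z : C) : C :=
  (exp (Re z) * cos (Im z), exp (Re z) * sin (Im z))%R.

(* [cpow_polar r t w] is z^w for z = r e^{it} with arg z = t, where r > 0 and
   t may be any real number; [cpow r w] is the case arg z = 0. *)
Definition cpow_polar (r t : R) (w : C) : C := cexp (w * (ln r, t)).

Definition cpow (r : R) (w : C) : C := cpow_polar r 0 w.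

Definition polar (r t : R) : C := (r * cos t, r * sin t)%R.

Definition holomorphic_at (f : C -> C) (z : C) : Prop :=
  locally (T := C_UniformSpace) z
    (fun w => ex_derive (K := C_AbsRing) (V := C_NormedModule) f w).

Definition pole_at (f : C -> C) (p : C) : Prop :=
  exists (m : nat) (h : C -> C),
    (0 < m)%nat /\ holomorphic_at h p /\ h p <> 0 /\
    locally' (T := C_UniformSpace) p (fun z => f z = h z / (z - p) ^ m).

(* A meromorphic function is represented by a total function that takes the
   correct value at its removable singularities; its values at poles are
   irrelevant. *)
Definition meromorphic (f : C -> C) : Prop :=
  forall z : C, holomorphic_at f z \/ pole_at f z.

(* The index is shifted: term [n] is a_{n+1} (n+1)^{-s}, so that the sums below
   are sums over n >= 1. *)
Definition dirichlet_term (a : nat -> R) (s : C) (n : nat) : C :=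
  a (S n) * cpow (INR (S n)) (- s).

Definition continues_dirichlet (a : nat -> R) (sigma : R) (F : C -> C) : Prop :=
  meromorphic F /\
  forall s : C, sigma < Re s ->
    is_series (K := C_AbsRing) (V := C_NormedModule) (dirichlet_term a s) (F s).

(* The meromorphic continuation to C of sum_{n >= 1} a_n n^{-s}, Re s > sigma.
   If there is one, it is unique up to its values at poles. *)
Definition dirichlet_continuation (a : nat -> R) (sigma : R) : C -> C :=
  epsilon (inhabits (fun _ : C => RtoC 0)) (continues_dirichlet a sigma).

Definition alt_sign (n : nat) : R := ((-1) ^ pred n)%R.

Definition zeta : C -> C := dirichlet_continuation (fun _ => 1%R) 1.

Definition H_minus (n : nat) : R :=
  sum_n_m (fun k => alt_sign k / INR k)%R 1 n.

Definition v : C -> C :=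
  dirichlet_continuation (fun n => alt_sign n * H_minus n)%R 0.

Definition CSeries (u : nat -> C) : C :=
  (Series (fun n => Re (u n)), Series (fun n => Im (u n))).

Definition eta (s : C) : C :=
  if Rlt_dec 0 (Re s)
  then CSeries (dirichlet_term alt_sign s)
  else (1 - cpow 2 (1 - s)) * zeta s.

Definition Gamma_integral (s : C) : C :=
  RInt_gen (V := C_R_CompleteNormedModule)
    (fun t : R => cpow t (s - 1) * exp (- t)) (at_right 0) (Rbar_locally p_infty).

Fixpoint rising (s : C) (n : nat) : C :=
  match n with
  | O => 1
  | S m => rising s m * (s + INR m)
  end.

(* Euler's integral for Re s > 0, extended by
   Gamma(s) = Gamma(s + n) / (s (s + 1) ... (s + n - 1)),
   with n the least natural number such that Re s + n > 0. *)
Definition Gamma (s : C) : C :=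
  let n := Z.to_nat (up (- Re s)) in Gamma_integral (s + INR n) / rising s n.

Definition digamma (s : C) : C := C_derive Gamma s / Gamma s.

(* [is_log_branch l]: l(z) is the branch of log((e^z - 1)/z) that is
   holomorphic near 0 and real on the negative real axis. *)
Definition is_log_branch (l : C -> C) : Prop :=
  holomorphic_at l 0 /\
  locally' (T := C_UniformSpace) (RtoC 0)
    (fun z => cexp (l z) = (cexp z - 1) / z) /\
  forall x : R, x < 0 ->
    Im (l x) = 0%R /\ cexp (l x) = (cexp x - 1) / x.

(* [is_hankel_integral s f eps I]: the integral of z^{s-1} f(z) along the Hankel
   contour of radius eps converges to I.  The three pieces are the lower side of
   the ray (z = x, arg z = -pi), the circle (z = eps e^{it}, dz = i z dt), and
   the upper side of the ray (z = x, arg z = pi). *)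
Definition is_hankel_integral (s : C) (f : C -> C) (eps : R) (I : C) : Prop :=
  exists I1 I2 I3 : C,
    is_RInt_gen (V := C_R_NormedModule)
      (fun x : R => cpow_polar (- x) (- PI) (s - 1) * f x)
      (Rbar_locally m_infty) (at_point (- eps)%R) I1 /\
    is_RInt (V := C_R_NormedModule)
      (fun t : R => cpow_polar eps t (s - 1) * f (polar eps t)
                    * (Ci * polar eps t))
      (- PI)%R PI I2 /\
    is_RInt_gen (V := C_R_NormedModule)
      (fun x : R => cpow_polar (- x) PI (s - 1) * f x)
      (at_point (- eps)%R) (Rbar_locally m_infty) I3 /\
    I = I1 + I2 + I3.

(* [is_G l s g]: G(s) is defined, using the branch l, and equals g. *)
Definition is_G (l : C -> C) (s g : C) : Prop :=
  exists eps0 : R, 0 < eps0 /\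
    forall eps : R, 0 < eps < eps0 ->
      exists I : C,
        is_hankel_integral s (fun z => cexp z / (1 + cexp z) * l z) eps I /\
        g = Gamma (1 - s) / (2 * PI * Ci) * I.

(* Main.v *)
(** For Re s > 0 put x = e^(-t).  The integrand of G on the negative axis z = -t is
    x/(1+x) (log(1-x) - log t), which is
    -log(1-x)/(1+x) + log(1-x) - log t * x/(1+x).
    The Mellin transforms of -log(1-x)/(1+x), -log(1-x) and x/(1+x) are
    Gamma(s) v(s), Gamma(s) zeta(s+1) and Gamma(s) eta(s), and the factor log t
    differentiates in s, so the Mellin transform of the integrand is
    Gamma v - Gamma zeta(s+1) - (Gamma eta)'.  The Hankel integral is 2 i sin(pi s)
    times this Mellin transform, and by the reflection formula
    Gamma(1-s) sin(pi s) / pi = 1 / Gamma(s).  Both sides are meromorphic, the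
    Hankel integral being entire in s, so the identity theorem extends the equality
    to all s.  The same Hankel integrals provide the continuations of eta, zeta
    and v.

    The reflection formula comes from Liouville's theorem: the difference
    Gamma(s) Gamma(1-s) - pi / sin(pi s) extends to a bounded entire function f
    with f(s+1) = -f(s). *)

Require Import Defs.
From Stdlib Require Import Reals Lra Lia ZArith ClassicalEpsilon FunctionalExtensionality.
From Coquelicot Require Import Coquelicot.

Open Scope R_scope.
Open Scope C_scope.

(** * Complex differentiability *)

(** [zeta] and [v] are picked by [epsilon], so nothing is known of them before some continuation is
    exhibited, and afterwards they are determined only up to their values at poles. The proof
    therefore works with explicit functions: [eta_hat] and [zeta_hat] are Hankel integrals, and
    [v_hat] is the asserted identity solved for v. The theorem becomes the claim that [v_hat]
    continues the Dirichlet series of v. All singularities in s lie at integers, and the hypotheses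
    exclude every integer, so identities are proved for [noninteger] s and pass between functions
    through punctured neighbourhoods. Two obstacles shape the analysis. For 0 < Re s <= 1 the series
    of eta and v do not converge absolutely, so sum and integral are exchanged by an explicit bound
    on the remainder of a power series in e^(-t). And the kernel of zeta has a pole at 0, which
    spoils the limit of small Hankel circles; multiplying by z and shifting s by 1 removes it. The
    estimates of improper integrals all rest on one majorant, [dom], whose primitive is
    elementary. *)

Lemma Rlt_Rmin_l {x a b : R} : (x < Rmin a b)%R -> (x < a)%R.
Proof. intros H. apply (Rlt_le_trans _ _ _ H (Rmin_l _ _)). Qed.

Lemma Rlt_Rmin_r {x a b : R} : (x < Rmin a b)%R -> (x < b)%R.
Proof. intros H. apply (Rlt_le_trans _ _ _ H (Rmin_r _ _)). Qed.

Lemma Rlt_div_mult (x e k : R) : (0 < k)%R -> (x < e / k)%R -> (x * k < e)%R.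
Proof.
  intros Hk H. apply (Rmult_lt_compat_r k) in H; [|exact Hk].
  unfold Rdiv in H. rewrite Rmult_assoc, Rinv_l in H; lra.
Qed.

Lemma exp_le_mono (x y : R) : (x <= y)%R -> (exp x <= exp y)%R.
Proof. intros [H|H]; [left; apply exp_increasing, H | rewrite H; lra]. Qed.

Lemma ln_le_mono (x y : R) : (0 < x)%R -> (x <= y)%R -> (ln x <= ln y)%R.
Proof. intros Hx [H|H]; [left; apply ln_increasing; assumption | rewrite H; lra]. Qed.

Lemma Cmod_Re_le (z : C) : (Rabs (Re z) <= Cmod z)%R.
Proof. apply re_le_Cmod. Qed.

Lemma Cmod_Im_le (z : C) : (Rabs (Im z) <= Cmod z)%R.
Proof.
  apply Rle_trans with (2 := Rmax_Cmod z). destruct z; simpl. apply Rmax_r.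
Qed.

Lemma Cmod_le_Re_Im (z : C) : (Cmod z <= Rabs (Re z) + Rabs (Im z))%R.
Proof.
  destruct z as [x y]; unfold Cmod, Re, Im; simpl.
  apply Rsqr_incr_0_var; [| pose proof (Rabs_pos x); pose proof (Rabs_pos y); lra].
  rewrite Rsqr_sqrt by nra. unfold Rsqr.
  assert (Rabs x * Rabs x = x * x)%R by (rewrite <- Rabs_mult; apply Rabs_pos_eq; nra).
  assert (Rabs y * Rabs y = y * y)%R by (rewrite <- Rabs_mult; apply Rabs_pos_eq; nra).
  pose proof (Rabs_pos x); pose proof (Rabs_pos y); nra.
Qed.

Lemma Cmod_triangle_minus (x y : C) : (Cmod (x - y) <= Cmod x + Cmod y)%R.
Proof. rewrite <- (Cmod_opp y). apply Cmod_triangle. Qed.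

Lemma Cmod_minus_sym (x y : C) : Cmod (x - y) = Cmod (y - x).
Proof. rewrite <- Cmod_opp. f_equal. ring. Qed.

Lemma Cmod_triangle_rev (x y : C) : (Cmod x - Cmod y <= Cmod (x - y))%R.
Proof.
  assert (H := Cmod_triangle (x - y) y).
  replace (x - y + y) with x in H by ring. lra.
Qed.

Lemma Cmod_triangle3 (x y z : C) : (Cmod (x - z) <= Cmod (x - y) + Cmod (y - z))%R.
Proof. replace (x - z) with ((x - y) + (y - z)) by ring. apply Cmod_triangle. Qed.

Lemma Cmod_pos_ne (z : C) : (0 < Cmod z)%R -> z <> 0.
Proof. intros H E. rewrite E, Cmod_0 in H. lra. Qed.

Lemma Cminus_ne (x y : C) : x <> y -> x - y <> 0.
Proof. intros H E. apply H. replace x with (x - y + y) by ring. rewrite E. ring. Qed.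

Lemma Cmult_ne (x y : C) : x <> 0 -> y <> 0 -> x * y <> 0.
Proof. apply Cmult_neq_0. Qed.

Lemma C_ext (x y : C) : Re x = Re y -> Im x = Im y -> x = y.
Proof. destruct x, y; simpl; intros; subst; reflexivity. Qed.

(** Limit arguments below end with this lemma: instead of naming a limit, they bound the distance of
    two fixed numbers by every e > 0. *)
Lemma Cmod_small_eq (x y : C) : (forall e : R, (0 < e)%R -> (Cmod (x - y) <= e)%R) -> x = y.
Proof.
  intros H. destruct (Req_dec (Cmod (x - y)) 0) as [E|E].
  - apply Cmod_eq_0 in E. replace x with (x - y + y) by ring. rewrite E. ring.
  - pose proof (Cmod_ge_0 (x - y)). specialize (H (Cmod (x - y) / 2)%R). lra.
Qed.

(** The uniform structure of [C] is that of a product, so its balls are squares; the square of half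
    side d/2 lies in the disc of radius d. *)
Lemma locally_Cmod (z : C) (P : C -> Prop) :
  locally (T := C_UniformSpace) z P <->
  exists d : R, (0 < d)%R /\ forall w, (Cmod (w - z) < d)%R -> P w.
Proof.
  split.
  - intros [e He]. exists e. split; [apply cond_pos|].
    intros w Hw. apply He. apply C_NormedModule_mixin_compat1. exact Hw.
  - intros [d [Hd H]]. assert (Hd2 : (0 < d / 2)%R) by lra.
    exists (mkposreal _ Hd2). intros w Hw. apply H.
    destruct Hw as [H1 H2]. apply Rle_lt_trans with (1 := Cmod_le_Re_Im _).
    change (Rabs (Re w - Re z) < d/2)%R in H1.
    change (Rabs (Im w - Im z) < d/2)%R in H2.
    change (Rabs (Re w - Re z) + Rabs (Im w - Im z) < d)%R. lra.
Qed.

Notation punctured := (locally' (T := C_UniformSpace)).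

Lemma locally'_Cmod (z : C) (P : C -> Prop) :
  punctured z P <->
  exists d : R, (0 < d)%R /\ forall w, (Cmod (w - z) < d)%R -> w <> z -> P w.
Proof. unfold locally', within. apply locally_Cmod. Qed.

Notation is_cderive := (is_derive (K := C_AbsRing) (V := C_NormedModule)).
Notation ex_cderive := (ex_derive (K := C_AbsRing) (V := C_NormedModule)).

Lemma is_cderive_eps (f : C -> C) (z l : C) :
  is_cderive f z l <->
  forall e : R, (0 < e)%R -> exists d : R, (0 < d)%R /\ forall w, (Cmod (w - z) < d)%R ->
    (Cmod (f w - f z - l * (w - z)) <= e * Cmod (w - z))%R.
Proof.
  split.
  - intros [_ H] e He.
    assert (H0 : is_filter_lim (locally (T := AbsRing_UniformSpace C_AbsRing) z) z)
      by (intros P HP; exact HP).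
    destruct (H z H0 (mkposreal e He)) as [d Hd].
    exists d. split; [apply cond_pos|]. intros w Hw.
    specialize (Hd w Hw).
    change (Cmod (f w - f z - (w - z) * l) <= e * Cmod (w - z))%R in Hd.
    rewrite (Cmult_comm l). exact Hd.
  - intros H. split. apply is_linear_scal_l.
    intros x Hx e.
    (* [filterdiff] quantifies over all limit points of the filter, and z is the only one. *)
    assert (Ex : z = x).
    { apply (is_filter_lim_locally_unique (K := C_AbsRing)
               (V := AbsRing_NormedModule C_AbsRing)). exact Hx. }
    subst x.
    destruct (H e (cond_pos e)) as [d [Hd1 Hd2]].
    exists (mkposreal d Hd1). intros w Hw. specialize (Hd2 w Hw).
    change (Cmod (f w - f z - (w - z) * l) <= e * Cmod (w - z))%R.
    rewrite <- (Cmult_comm l). exact Hd2.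
Qed.

Definition ccont (f : C -> C) (z : C) : Prop :=
  forall e : R, (0 < e)%R -> exists d : R, (0 < d)%R /\ forall w, (Cmod (w - z) < d)%R ->
    (Cmod (f w - f z) < e)%R.

Lemma is_cderive_ccont (f : C -> C) (z l : C) : is_cderive f z l -> ccont f z.
Proof.
  rewrite is_cderive_eps. intros H e He.
  destruct (H 1%R) as [d [Hd1 Hd2]]; [lra|].
  pose proof (Cmod_ge_0 l) as Hl.
  exists (Rmin d (e / (Cmod l + 2)))%R. split.
  { apply Rmin_pos; [lra|]. apply Rdiv_lt_0_compat; lra. }
  intros w Hw.
  assert (H1 : (Cmod (w - z) < d)%R) by exact (Rlt_Rmin_l Hw).
  assert (H2 : (Cmod (w - z) < e / (Cmod l + 2))%R) by exact (Rlt_Rmin_r Hw).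
  specialize (Hd2 w H1).
  replace (f w - f z) with ((f w - f z - l * (w - z)) + l * (w - z)) by ring.
  apply Rle_lt_trans with (1 := Cmod_triangle _ _). rewrite Cmod_mult.
  assert (H3 : (Cmod (w - z) * (Cmod l + 2) < e)%R).
  { apply (Rmult_lt_compat_r (Cmod l + 2)) in H2; [|lra].
    unfold Rdiv in H2. rewrite Rmult_assoc, Rinv_l in H2; lra. }
  pose proof (Cmod_ge_0 (w - z)). nra.
Qed.

Lemma ex_cderive_ccont (f : C -> C) (z : C) : ex_cderive f z -> ccont f z.
Proof. intros [l Hl]. exact (is_cderive_ccont _ _ _ Hl). Qed.

Lemma is_cderive_unique (f : C -> C) (z a b : C) :
  is_cderive f z a -> is_cderive f z b -> a = b.
Proof.
  intros Ha Hb. rewrite <- (is_C_derive_unique _ _ _ Ha). apply is_C_derive_unique, Hb.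
Qed.

Lemma is_cderive_local (f g : C -> C) (z l : C) (d : R) : (0 < d)%R ->
  (forall w, (Cmod (w - z) < d)%R -> f w = g w) -> is_cderive f z l -> is_cderive g z l.
Proof.
  intros Hd E. rewrite !is_cderive_eps. intros H e He.
  destruct (H e He) as [d' [H1 H2]]. exists (Rmin d d'). split; [apply Rmin_pos; assumption|].
  intros w Hw. rewrite <- (E w), <- (E z).
  - apply H2. apply (Rlt_Rmin_r Hw).
  - replace (z - z) with (RtoC 0) by ring. rewrite Cmod_0. exact Hd.
  - apply (Rlt_Rmin_l Hw).
Qed.

Lemma ex_cderive_local (f g : C -> C) (z : C) (d : R) : (0 < d)%R ->
  (forall w, (Cmod (w - z) < d)%R -> f w = g w) -> ex_cderive f z -> ex_cderive g z.
Proof. intros Hd E [l Hl]. exists l. exact (is_cderive_local _ _ _ _ _ Hd E Hl). Qed.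

Lemma is_cderive_val (f : C -> C) (z a b : C) : is_cderive f z a -> a = b -> is_cderive f z b.
Proof. intros H <-. exact H. Qed.

Lemma is_cderive_const (c z : C) : is_cderive (fun _ => c) z (RtoC 0).
Proof. apply (is_derive_const (K := C_AbsRing) (V := C_NormedModule) c z). Qed.

Lemma is_cderive_id (z : C) : is_cderive (fun w => w) z (RtoC 1).
Proof.
  rewrite is_cderive_eps. intros e He. exists 1%R. split; [lra|]. intros w _.
  replace (w - z - 1 * (w - z)) with (RtoC 0) by ring. rewrite Cmod_0.
  pose proof (Cmod_ge_0 (w - z)). nra.
Qed.

Lemma is_cderive_plus (f g : C -> C) (z a b : C) :
  is_cderive f z a -> is_cderive g z b -> is_cderive (fun w => f w + g w) z (a + b)%C.
Proof. intros Hf Hg. exact (is_derive_plus f g z a b Hf Hg). Qed.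

Lemma is_cderive_minus (f g : C -> C) (z a b : C) :
  is_cderive f z a -> is_cderive g z b -> is_cderive (fun w => f w - g w) z (a - b)%C.
Proof. intros Hf Hg. exact (is_derive_minus f g z a b Hf Hg). Qed.

Lemma is_cderive_opp (f : C -> C) (z a : C) :
  is_cderive f z a -> is_cderive (fun w => - f w) z (- a)%C.
Proof. intros Hf. exact (is_derive_opp f z a Hf). Qed.

(** [C] is a normed module over itself in two ways, as [C_NormedModule] and through
    [AbsRing_NormedModule]. The chain and product rules use the second one; both notions of
    derivative unfold to the same estimate. *)
Lemma is_cderive_AbsRing (f : C -> C) (z l : C) :
  is_cderive f z l <-> is_derive (K := C_AbsRing) (V := AbsRing_NormedModule C_AbsRing) f z l.
Proof. split; intros [_ H]; (split; [apply is_linear_scal_l | exact H]). Qed.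

Lemma is_cderive_comp (f g : C -> C) (z a b : C) :
  is_cderive f (g z) a -> is_cderive g z b -> is_cderive (fun w => f (g w)) z (a * b)%C.
Proof.
  rewrite (is_cderive_AbsRing g), Cmult_comm.
  apply (is_derive_comp (K := C_AbsRing) (V := C_NormedModule) f g z a b).
Qed.

Lemma is_cderive_mult (f g : C -> C) (z a b : C) :
  is_cderive f z a -> is_cderive g z b ->
  is_cderive (fun w => f w * g w) z (a * g z + f z * b)%C.
Proof.
  rewrite !is_cderive_AbsRing. intros Hf Hg.
  exact (is_derive_mult (K := C_AbsRing) f g z a b Hf Hg Cmult_comm).
Qed.

Lemma is_cderive_inv_id (z : C) : z <> 0 -> is_cderive (fun w => / w) z (- / (z * z))%C.
Proof.
  intros Hz. rewrite is_cderive_eps. intros e He.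
  assert (Hm : (0 < Cmod z)%R) by (apply Cmod_gt_0; exact Hz).
  set (m := Cmod z) in *.
  (* The remainder is exactly (w - z)^2 / (z^2 w). The first radius gives |w| > m/2, and the second
     then makes |w - z| / |z^2 w| at most e. *)
  exists (Rmin (m / 2) (e * (m * m * m) / 2))%R. split.
  { apply Rmin_pos; [lra|]. assert (0 < m * m * m)%R by (repeat apply Rmult_lt_0_compat; lra). nra. }
  intros w Hw.
  assert (Hw1 : (Cmod (w - z) < m / 2)%R) by exact (Rlt_Rmin_l Hw).
  assert (Hw2 : (Cmod (w - z) < e * (m * m * m) / 2)%R) by exact (Rlt_Rmin_r Hw).
  assert (Hwm : (m / 2 < Cmod w)%R).
  { assert (H := Cmod_triangle_rev z w). rewrite Cmod_minus_sym in H. fold m in H. lra. }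
  assert (Hw0 : w <> 0) by (apply Cmod_pos_ne; lra).
  replace (/ w - / z - - / (z * z) * (w - z)) with ((w - z) * ((w - z) / (z * z * w)))
    by (field; split; assumption).
  rewrite Cmod_mult, Rmult_comm. apply Rmult_le_compat_r; [apply Cmod_ge_0|].
  rewrite Cmod_div by (repeat apply Cmult_ne; assumption).
  rewrite !Cmod_mult. fold m.
  apply Rmult_le_reg_r with (m * m * Cmod w)%R.
  { repeat apply Rmult_lt_0_compat; lra. }
  unfold Rdiv. rewrite Rmult_assoc, Rinv_l.
  2: { apply Rgt_not_eq. repeat apply Rmult_lt_0_compat; lra. }
  assert (m * m * m / 2 <= m * m * Cmod w)%R.
  { unfold Rdiv. rewrite (Rmult_assoc (m * m)). apply Rmult_le_compat_l; [nra|lra]. }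
  nra.
Qed.

Lemma is_cderive_inv (f : C -> C) (z a : C) : f z <> 0 ->
  is_cderive f z a -> is_cderive (fun w => / f w) z (- a / (f z * f z))%C.
Proof.
  intros Hz Hf. eapply is_cderive_val.
  - apply (is_cderive_comp (fun w => / w) f); [apply is_cderive_inv_id, Hz | exact Hf].
  - field. exact Hz.
Qed.

Lemma is_cderive_div (f g : C -> C) (z a b : C) : g z <> 0 ->
  is_cderive f z a -> is_cderive g z b ->
  is_cderive (fun w => f w / g w) z ((a * g z - f z * b) / (g z * g z))%C.
Proof.
  intros Hz Hf Hg. eapply is_cderive_val.
  - apply is_cderive_mult; [exact Hf | apply is_cderive_inv; [exact Hz | exact Hg]].
  - simpl. field. exact Hz.
Qed.

Lemma ex_cderive_const (c z : C) : ex_cderive (fun _ => c) z.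
Proof. eexists; apply is_cderive_const. Qed.
Lemma ex_cderive_id (z : C) : ex_cderive (fun w => w) z.
Proof. eexists; apply is_cderive_id. Qed.
Lemma ex_cderive_plus (f g : C -> C) (z : C) :
  ex_cderive f z -> ex_cderive g z -> ex_cderive (fun w => f w + g w) z.
Proof. intros [a Ha] [b Hb]. eexists; apply is_cderive_plus; eassumption. Qed.
Lemma ex_cderive_minus (f g : C -> C) (z : C) :
  ex_cderive f z -> ex_cderive g z -> ex_cderive (fun w => f w - g w) z.
Proof. intros [a Ha] [b Hb]. eexists; apply is_cderive_minus; eassumption. Qed.
Lemma ex_cderive_opp (f : C -> C) (z : C) :
  ex_cderive f z -> ex_cderive (fun w => - f w) z.
Proof. intros [a Ha]. eexists; apply is_cderive_opp; eassumption. Qed.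
Lemma ex_cderive_mult (f g : C -> C) (z : C) :
  ex_cderive f z -> ex_cderive g z -> ex_cderive (fun w => f w * g w) z.
Proof. intros [a Ha] [b Hb]. eexists; apply is_cderive_mult; eassumption. Qed.
Lemma ex_cderive_inv (f : C -> C) (z : C) : f z <> 0 ->
  ex_cderive f z -> ex_cderive (fun w => / f w) z.
Proof. intros H [a Ha]. eexists; apply is_cderive_inv; eassumption. Qed.
Lemma ex_cderive_div (f g : C -> C) (z : C) : g z <> 0 ->
  ex_cderive f z -> ex_cderive g z -> ex_cderive (fun w => f w / g w) z.
Proof. intros H [a Ha] [b Hb]. eexists; apply is_cderive_div; eassumption. Qed.
Lemma ex_cderive_comp (f g : C -> C) (z : C) :
  ex_cderive f (g z) -> ex_cderive g z -> ex_cderive (fun w => f (g w)) z.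
Proof. intros [a Ha] [b Hb]. eexists; apply is_cderive_comp; eassumption. Qed.
Lemma ex_cderive_shift (c z : C) : ex_cderive (fun w => w - c) z.
Proof. apply (ex_cderive_minus (fun w => w) (fun _ => c)); [apply ex_cderive_id | apply ex_cderive_const]. Qed.
Lemma ex_cderive_pow (f : C -> C) (n : nat) (z : C) :
  ex_cderive f z -> ex_cderive (fun w => f w ^ n) z.
Proof.
  intros Hf. induction n as [|n IH]; [exact (ex_cderive_const 1 z)|].
  apply (ex_cderive_mult f (fun w => f w ^ n)); assumption.
Qed.

Lemma C_derive_is (f : C -> C) (z : C) : ex_cderive f z -> is_cderive f z (C_derive f z).
Proof. intros H. apply C_derive_correct; [exact 0 | exact H]. Qed.

Lemma holomorphic_at_Cmod (f : C -> C) (z : C) :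
  holomorphic_at f z <->
  exists d : R, (0 < d)%R /\ forall w, (Cmod (w - z) < d)%R -> ex_cderive f w.
Proof. apply locally_Cmod. Qed.

Lemma Cmod_self_lt (z : C) (d : R) : (0 < d)%R -> (Cmod (z - z) < d)%R.
Proof. intros. replace (z - z) with (RtoC 0) by ring. rewrite Cmod_0. assumption. Qed.

Lemma holomorphic_at_ex (f : C -> C) (z : C) : holomorphic_at f z -> ex_cderive f z.
Proof.
  rewrite holomorphic_at_Cmod. intros [d [Hd H]]. apply H, Cmod_self_lt, Hd.
Qed.

(** * Paths, integrals and the exponential *)

Notation is_rderive := (is_derive (K := R_AbsRing) (V := C_R_NormedModule)).
Notation rcont := (continuous (T := R_UniformSpace) (U := C_UniformSpace)).
Notation is_CInt := (is_RInt (V := C_R_NormedModule)).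
Notation ex_CInt := (ex_RInt (V := C_R_NormedModule)).
Notation CInt := (RInt (V := C_R_CompleteNormedModule)).

Lemma is_rderive_eps (g : R -> C) (t : R) (l : C) :
  is_rderive g t l <->
  forall e : R, (0 < e)%R -> exists d : R, (0 < d)%R /\ forall u, (Rabs (u - t) < d)%R ->
    (Cmod (g u - g t - l * (u - t)%R) <= e * Rabs (u - t))%R.
Proof.
  assert (E : forall u, (g u - g t - l * (u - t)%R) =
     minus (minus (g u) (g t)) (scal (V := C_R_NormedModule) (minus u t) l)).
  { intros u. apply C_ext; destruct (g u), (g t), l; simpl;
      unfold minus, plus, opp, scal, mult; simpl; unfold mult; simpl; ring. }
  split.
  - intros [_ H] e He.
    assert (H0 : is_filter_lim (locally t) t) by (intros P HP; exact HP).
    destruct (H t H0 (mkposreal e He)) as [d Hd].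
    exists d. split; [apply cond_pos|]. intros u Hu.
    specialize (Hd u Hu). rewrite E, Cmod_norm. exact Hd.
  - intros H. split. apply is_linear_scal_l.
    intros x Hx e.
    assert (Ex : t = x) by (apply (is_filter_lim_locally_unique); exact Hx).
    subst x.
    destruct (H e (cond_pos e)) as [d [Hd1 Hd2]].
    exists (mkposreal d Hd1). intros u Hu. specialize (Hd2 u Hu).
    rewrite E, Cmod_norm in Hd2. exact Hd2.
Qed.

Lemma rcont_eps (g : R -> C) (t : R) :
  rcont g t <->
  forall e : R, (0 < e)%R -> exists d : R, (0 < d)%R /\ forall u, (Rabs (u - t) < d)%R ->
    (Cmod (g u - g t) < e)%R.
Proof.
  split.
  - intros H e He.
    destruct (H (fun w => Cmod (w - g t) < e)%R) as [d Hd].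
    { apply locally_Cmod. exists e. split; [exact He | tauto]. }
    exists d. split; [apply cond_pos|]. intros u Hu. apply Hd. exact Hu.
  - intros H P HP. apply locally_Cmod in HP. destruct HP as [e [He HP]].
    destruct (H e He) as [d [Hd1 Hd2]].
    exists (mkposreal d Hd1). intros u Hu. apply HP, Hd2. exact Hu.
Qed.

Lemma is_rderive_rcont (g : R -> C) (t : R) (l : C) : is_rderive g t l -> rcont g t.
Proof. intros H. apply (ex_derive_continuous (V := C_R_NormedModule)). exists l. exact H. Qed.

Lemma is_rderive_pair (x y : R -> R) (t a b : R) :
  is_derive x t a -> is_derive y t b -> is_rderive (fun u => (x u, y u)) t (a, b).
Proof.
  intros Hx Hy. apply is_rderive_eps. intros e He.
  assert (He2 : (0 < e / 2)%R) by lra.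
  apply is_derive_Reals in Hx. apply is_derive_Reals in Hy.
  destruct (Hx _ He2) as [d1 H1]. destruct (Hy _ He2) as [d2 H2].
  exists (Rmin d1 d2). split; [apply Rmin_pos; apply cond_pos|]. intros u Hu.
  destruct (Req_dec u t) as [->|Hut].
  { replace (_ - _) with (RtoC 0) by (apply C_ext; simpl; ring).
    rewrite Cmod_0. replace (t - t)%R with 0%R by ring. rewrite Rabs_R0. lra. }
  assert (Hh : (u - t <> 0)%R) by lra.
  assert (K1 := H1 _ Hh (Rlt_Rmin_l Hu)).
  assert (K2 := H2 _ Hh (Rlt_Rmin_r Hu)).
  replace (t + (u - t))%R with u in K1, K2 by ring.
  assert (Hp : (0 < Rabs (u - t))%R) by (apply Rabs_pos_lt; exact Hh).
  assert (K1' : (Rabs (x u - x t - a * (u - t)) <= e / 2 * Rabs (u - t))%R).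
  { replace (x u - x t - a * (u - t))%R with (((x u - x t) / (u - t) - a) * (u - t))%R by (field; exact Hh).
    rewrite Rabs_mult. apply Rmult_le_compat_r; lra. }
  assert (K2' : (Rabs (y u - y t - b * (u - t)) <= e / 2 * Rabs (u - t))%R).
  { replace (y u - y t - b * (u - t))%R with (((y u - y t) / (u - t) - b) * (u - t))%R by (field; exact Hh).
    rewrite Rabs_mult. apply Rmult_le_compat_r; lra. }
  apply Rle_trans with (1 := Cmod_le_Re_Im _).
  replace (Re _) with (x u - x t - a * (u - t))%R by (simpl; ring).
  replace (Im _) with (y u - y t - b * (u - t))%R by (simpl; ring).
  lra.
Qed.

Lemma is_rderive_comp (f : C -> C) (g : R -> C) (t : R) (a b : C) :
  is_cderive f (g t) a -> is_rderive g t b -> is_rderive (fun u => f (g u)) t (a * b)%C.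
Proof.
  rewrite is_cderive_eps, !is_rderive_eps. intros Hf Hg e He.
  pose proof (Cmod_ge_0 a) as Ha. pose proof (Cmod_ge_0 b) as Hb.
  (* The two errors add up to e1 (|b| + e1) + |a| e1 times |w - t|; with e1 <= 1 this is at most e1
     (|a| + |b| + 2). *)
  set (e1 := Rmin 1 (e / (Cmod a + Cmod b + 2))).
  assert (He1 : (0 < e1)%R) by (apply Rmin_pos; [lra | apply Rdiv_lt_0_compat; lra]).
  assert (He2 : (e1 <= 1)%R) by apply Rmin_l.
  assert (He3 : (e1 * (Cmod a + Cmod b + 2) <= e)%R).
  { apply Rle_trans with (e / (Cmod a + Cmod b + 2) * (Cmod a + Cmod b + 2))%R.
    - apply Rmult_le_compat_r; [lra | apply Rmin_r].
    - right. field. lra. }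
  destruct (Hf e1 He1) as [d1 [Hd1 H1]].
  destruct (Hg e1 He1) as [d2 [Hd2 H2]].
  exists (Rmin d2 (d1 / (Cmod b + 2)))%R. split.
  { apply Rmin_pos; [lra | apply Rdiv_lt_0_compat; lra]. }
  intros w Hw.
  assert (Hw2 : (Rabs (w - t) < d2)%R) by exact (Rlt_Rmin_l Hw).
  assert (Hw1 : (Rabs (w - t) < d1 / (Cmod b + 2))%R) by exact (Rlt_Rmin_r Hw).
  specialize (H2 w Hw2).
  pose proof (Rabs_pos (w - t)) as Hwz.
  assert (Hgw : (Cmod (g w - g t) <= (Cmod b + e1) * Rabs (w - t))%R).
  { replace (g w - g t) with ((g w - g t - b * (w - t)%R) + b * (w - t)%R) by ring.
    apply Rle_trans with (1 := Cmod_triangle _ _). rewrite Cmod_mult, Cmod_R. nra. }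
  assert (Hlt : (Cmod (g w - g t) < d1)%R).
  { apply Rlt_div_mult in Hw1; [|lra]. nra. }
  specialize (H1 (g w) Hlt).
  replace (f (g w) - f (g t) - a * b * (w - t)%R)
    with ((f (g w) - f (g t) - a * (g w - g t)) + a * (g w - g t - b * (w - t)%R)) by ring.
  apply Rle_trans with (1 := Cmod_triangle _ _). rewrite Cmod_mult.
  pose proof (Cmod_ge_0 (g w - g t)).
  assert (Hx : (e1 * Cmod (g w - g t) <= e1 * ((Cmod b + e1) * Rabs (w - t)))%R)
    by (apply Rmult_le_compat_l; lra).
  assert (Hy : (Cmod a * Cmod (g w - g t - b * (w - t)%R) <= Cmod a * (e1 * Rabs (w - t)))%R)
    by (apply Rmult_le_compat_l; lra).
  apply Rle_trans with (e1 * (Cmod a + Cmod b + 2) * Rabs (w - t))%R; [|nra].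
  assert (0 <= e1 * Rabs (w - t))%R by nra.
  assert (0 <= e1 * Rabs (w - t) * (2 - e1))%R by (apply Rmult_le_pos; lra). nra.
Qed.

Lemma rcont_comp (f : C -> C) (g : R -> C) (t : R) :
  ccont f (g t) -> rcont g t -> rcont (fun u => f (g u)) t.
Proof.
  rewrite !rcont_eps. intros Hf Hg e He.
  destruct (Hf e He) as [d [Hd H]]. destruct (Hg d Hd) as [d' [Hd' H']].
  exists d'. split; [exact Hd'|]. intros u Hu. apply H, H', Hu.
Qed.

Lemma ex_derive_Rcontinuous (f : R -> R) (t : R) : ex_derive f t -> continuous f t.
Proof. apply (ex_derive_continuous (V := R_NormedModule)). Qed.

Lemma rcont_const (c : C) (t : R) : rcont (fun _ => c) t.
Proof. apply continuous_const. Qed.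

Lemma rcont_RtoC (g : R -> R) (t : R) : continuous g t -> rcont (fun u => RtoC (g u)) t.
Proof.
  intros Hg. rewrite rcont_eps. intros e He.
  destruct (Hg (fun y => Rabs (y - g t) < e)%R) as [d Hd].
  { exists (mkposreal e He). intros y Hy. exact Hy. }
  exists d. split; [apply cond_pos|]. intros u Hu.
  rewrite <- RtoC_minus, Cmod_R. apply Hd, Hu.
Qed.

Lemma rcont_pair (x y : R -> R) (t : R) :
  continuous x t -> continuous y t -> rcont (fun u => (x u, y u)) t.
Proof.
  intros Hx Hy. rewrite rcont_eps. intros e He. assert (He2 : (0 < e / 2)%R) by lra.
  destruct (Hx (fun z => Rabs (z - x t) < e / 2)%R) as [d1 H1].
  { exists (mkposreal _ He2). intros z Hz. exact Hz. }
  destruct (Hy (fun z => Rabs (z - y t) < e / 2)%R) as [d2 H2].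
  { exists (mkposreal _ He2). intros z Hz. exact Hz. }
  exists (Rmin d1 d2). split; [apply Rmin_pos; apply cond_pos|]. intros u Hu.
  apply Rle_lt_trans with (1 := Cmod_le_Re_Im _).
  assert (K1 := H1 u (Rlt_Rmin_l Hu)).
  assert (K2 := H2 u (Rlt_Rmin_r Hu)).
  change (Rabs (x u - x t) + Rabs (y u - y t) < e)%R. lra.
Qed.

Lemma rcont_plus (f g : R -> C) (t : R) :
  rcont f t -> rcont g t -> rcont (fun u => f u + g u) t.
Proof. intros Hf Hg. apply (continuous_plus (V := C_R_NormedModule) f g t Hf Hg). Qed.

Lemma rcont_minus (f g : R -> C) (t : R) :
  rcont f t -> rcont g t -> rcont (fun u => f u - g u) t.
Proof. intros Hf Hg. apply (continuous_minus (V := C_R_NormedModule) f g t Hf Hg). Qed.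

(** Stated on values rather than functions, so that it serves products along real paths, on the
    plane and in two real variables alike. *)
Lemma Cmult_close (x y : C) (e : R) : (0 < e)%R -> exists d : R, (0 < d)%R /\
  forall x' y', (Cmod (x' - x) < d)%R -> (Cmod (y' - y) < d)%R -> (Cmod (x' * y' - x * y) < e)%R.
Proof.
  intros He.
  set (k := (Cmod x + Cmod y + 1)%R).
  pose proof (Cmod_ge_0 x). pose proof (Cmod_ge_0 y).
  set (e1 := Rmin 1 (e / (2 * k))).
  assert (He1 : (0 < e1)%R).
  { apply Rmin_pos; [lra | apply Rdiv_lt_0_compat; unfold k; lra]. }
  assert (He2 : (e1 <= 1)%R) by apply Rmin_l.
  assert (He3 : (e1 * (2 * k) <= e)%R).
  { apply Rle_trans with (e / (2 * k) * (2 * k))%R.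
    - apply Rmult_le_compat_r; [unfold k; lra | apply Rmin_r].
    - right. field. unfold k; lra. }
  exists e1. split; [exact He1|]. intros x' y' K1 K2.
  replace (x' * y' - x * y)
    with ((x' - x) * (y' - y) + (x' - x) * y + x * (y' - y)) by ring.
  apply Rle_lt_trans with (1 := Cmod_triangle _ _).
  apply Rle_lt_trans with (1 := Rplus_le_compat_r _ _ _ (Cmod_triangle _ _)).
  rewrite !Cmod_mult.
  pose proof (Cmod_ge_0 (x' - x)). pose proof (Cmod_ge_0 (y' - y)).
  assert (Cmod (x' - x) * Cmod (y' - y) <= e1 * 1)%R by (apply Rmult_le_compat; lra).
  assert (Cmod (x' - x) * Cmod y <= e1 * Cmod y)%R by (apply Rmult_le_compat_r; lra).
  assert (Cmod x * Cmod (y' - y) <= Cmod x * e1)%R by (apply Rmult_le_compat_l; lra).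
  assert (0 < e1 * k)%R by (apply Rmult_lt_0_compat; unfold k; lra).
  unfold k in *. nra.
Qed.

Lemma rcont_mult (f g : R -> C) (t : R) :
  rcont f t -> rcont g t -> rcont (fun u => f u * g u) t.
Proof.
  rewrite !rcont_eps. intros Hf Hg e He.
  destruct (Cmult_close (f t) (g t) e He) as [d [Hd H]].
  destruct (Hf d Hd) as [d1 [Hd1 H1]]. destruct (Hg d Hd) as [d2 [Hd2 H2]].
  exists (Rmin d1 d2). split; [apply Rmin_pos; assumption|]. intros u Hu. apply H.
  - apply H1, (Rlt_Rmin_l Hu).
  - apply H2, (Rlt_Rmin_r Hu).
Qed.

Lemma ccont_mult (f g : C -> C) (z : C) :
  ccont f z -> ccont g z -> ccont (fun u => f u * g u) z.
Proof.
  intros Hf Hg e He.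
  destruct (Cmult_close (f z) (g z) e He) as [d [Hd H]].
  destruct (Hf d Hd) as [d1 [Hd1 H1]]. destruct (Hg d Hd) as [d2 [Hd2 H2]].
  exists (Rmin d1 d2). split; [apply Rmin_pos; assumption|]. intros u Hu. apply H.
  - apply H1, (Rlt_Rmin_l Hu).
  - apply H2, (Rlt_Rmin_r Hu).
Qed.

Lemma ccont_minus (f g : C -> C) (z : C) :
  ccont f z -> ccont g z -> ccont (fun u => f u - g u) z.
Proof.
  intros Hf Hg e He. assert (He2 : (0 < e / 2)%R) by lra.
  destruct (Hf _ He2) as [d1 [Hd1 H1]]. destruct (Hg _ He2) as [d2 [Hd2 H2]].
  exists (Rmin d1 d2). split; [apply Rmin_pos; assumption|]. intros u Hu.
  specialize (H1 u (Rlt_Rmin_l Hu)).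
  specialize (H2 u (Rlt_Rmin_r Hu)).
  replace (f u - g u - (f z - g z)) with ((f u - f z) - (g u - g z)) by ring.
  apply Rle_lt_trans with (1 := Cmod_triangle_minus _ _). lra.
Qed.

Lemma ccont_comp (f g : C -> C) (z : C) :
  ccont f (g z) -> ccont g z -> ccont (fun u => f (g u)) z.
Proof.
  intros Hf Hg e He.
  destruct (Hf e He) as [d [Hd H]]. destruct (Hg d Hd) as [d' [Hd' H']].
  exists d'. split; [exact Hd'|]. intros u Hu. apply H, H', Hu.
Qed.

Lemma ccont_local (f g : C -> C) (z : C) (d : R) : (0 < d)%R ->
  (forall w, (Cmod (w - z) < d)%R -> f w = g w) -> ccont f z -> ccont g z.
Proof.
  intros Hd E H e He. destruct (H e He) as [d' [Hd' H']].
  exists (Rmin d d'). split; [apply Rmin_pos; assumption|].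
  intros w Hw. rewrite <- (E w), <- (E z).
  - apply H'. apply (Rlt_Rmin_r Hw).
  - apply Cmod_self_lt, Hd.
  - apply (Rlt_Rmin_l Hw).
Qed.

Lemma rcont_inv (g : R -> C) (t : R) : g t <> 0 -> rcont g t -> rcont (fun u => / g u) t.
Proof.
  intros H Hg. apply (rcont_comp (fun z => / z) g); [|exact Hg].
  eapply is_cderive_ccont, is_cderive_inv_id, H.
Qed.

Lemma rcont_Cmod (g : R -> C) (t : R) : rcont g t -> continuous (fun u => Cmod (g u)) t.
Proof.
  rewrite rcont_eps. intros Hg P [e HP]. destruct (Hg e (cond_pos e)) as [d [Hd H]].
  exists (mkposreal d Hd). intros u Hu. apply HP. specialize (H u Hu).
  change (Rabs (Cmod (g u) - Cmod (g t)) < e)%R. apply Rle_lt_trans with (2 := H).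
  assert (H1 := Cmod_triangle_rev (g u) (g t)). assert (H2 := Cmod_triangle_rev (g t) (g u)).
  rewrite (Cmod_minus_sym (g t)) in H2. apply Rabs_le. lra.
Qed.

Lemma ex_CInt_cont (f : R -> C) (a b : R) :
  (forall t, (Rmin a b <= t <= Rmax a b)%R -> rcont f t) -> ex_CInt f a b.
Proof. intros H. apply (ex_RInt_continuous (V := C_R_CompleteNormedModule)). exact H. Qed.

Lemma CInt_correct (f : R -> C) (a b : R) : ex_CInt f a b -> is_CInt f a b (CInt f a b).
Proof. apply (RInt_correct (V := C_R_CompleteNormedModule)). Qed.

Lemma is_CInt_cont (f : R -> C) (a b : R) :
  (forall t, (Rmin a b <= t <= Rmax a b)%R -> rcont f t) -> is_CInt f a b (CInt f a b).
Proof. intros H. apply CInt_correct, ex_CInt_cont, H. Qed.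

Lemma CInt_unique (f : R -> C) (a b : R) (l : C) : is_CInt f a b l -> CInt f a b = l.
Proof. apply (is_RInt_unique (V := C_R_CompleteNormedModule)). Qed.

Lemma is_CInt_plus (f g : R -> C) (a b : R) (lf lg : C) :
  is_CInt f a b lf -> is_CInt g a b lg -> is_CInt (fun t => f t + g t) a b (lf + lg)%C.
Proof. intros Hf Hg. exact (is_RInt_plus (V := C_R_NormedModule) f g a b lf lg Hf Hg). Qed.

Lemma is_CInt_minus (f g : R -> C) (a b : R) (lf lg : C) :
  is_CInt f a b lf -> is_CInt g a b lg -> is_CInt (fun t => f t - g t) a b (lf - lg)%C.
Proof. intros Hf Hg. exact (is_RInt_minus (V := C_R_NormedModule) f g a b lf lg Hf Hg). Qed.

Lemma is_CInt_ext (f g : R -> C) (a b : R) (l : C) :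
  (forall t, (Rmin a b < t < Rmax a b)%R -> f t = g t) -> is_CInt f a b l -> is_CInt g a b l.
Proof. apply (is_RInt_ext (V := C_R_NormedModule)). Qed.

(** The scalars of [C_R_NormedModule] are real, so a complex factor is handled on the real and
    imaginary parts. *)
Lemma is_CInt_scal (c : C) (f : R -> C) (a b : R) (l : C) :
  is_CInt f a b l -> is_CInt (fun t => c * f t) a b (c * l)%C.
Proof.
  intros H.
  assert (H1 := is_RInt_fct_extend_fst (U := R_NormedModule) (V := R_NormedModule) f a b l H).
  assert (H2 := is_RInt_fct_extend_snd (U := R_NormedModule) (V := R_NormedModule) f a b l H).
  apply (is_RInt_fct_extend_pair (U := R_NormedModule) (V := R_NormedModule)).
  - apply (is_RInt_minus (V := R_NormedModule) (fun t => scal (fst c) (fst (f t))) (fun t => scal (snd c) (snd (f t))));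
      apply (is_RInt_scal (V := R_NormedModule)); assumption.
  - apply (is_RInt_plus (V := R_NormedModule) (fun t => scal (fst c) (snd (f t))) (fun t => scal (snd c) (fst (f t))));
      apply (is_RInt_scal (V := R_NormedModule)); assumption.
Qed.

Lemma is_CInt_const (c : C) (a b : R) : is_CInt (fun _ => c) a b ((b - a)%R * c)%C.
Proof.
  assert (H := is_RInt_const (V := C_R_NormedModule) a b c).
  replace ((b - a)%R * c) with (scal (V := C_R_NormedModule) (b - a)%R c); [exact H|].
  apply C_ext; destruct c; simpl; unfold scal; simpl; unfold mult; simpl; ring.
Qed.

Lemma is_CInt_norm (f : R -> C) (g : R -> R) (a b : R) (l : C) (m : R) : (a <= b)%R ->
  (forall t, (a <= t <= b)%R -> (Cmod (f t) <= g t)%R) ->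
  is_CInt f a b l -> is_RInt g a b m -> (Cmod l <= m)%R.
Proof.
  intros Hab H Hf Hg. rewrite Cmod_norm.
  apply (norm_RInt_le (V := C_R_NormedModule) f g a b l m Hab); [|exact Hf|exact Hg].
  intros x Hx. rewrite <- Cmod_norm. apply H, Hx.
Qed.

Lemma is_CInt_bound (f : R -> C) (a b : R) (l : C) (M : R) : (a <= b)%R ->
  (forall t, (a <= t <= b)%R -> (Cmod (f t) <= M)%R) ->
  is_CInt f a b l -> (Cmod l <= (b - a) * M)%R.
Proof.
  intros Hab H Hf. rewrite Cmod_norm.
  apply (norm_RInt_le_const (V := C_R_NormedModule) f a b l M Hab); [|exact Hf].
  intros x Hx. rewrite <- Cmod_norm. apply H, Hx.
Qed.

Lemma is_CInt_derive (f df : R -> C) (a b : R) :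
  (forall t, (Rmin a b <= t <= Rmax a b)%R -> is_rderive f t (df t)) ->
  (forall t, (Rmin a b <= t <= Rmax a b)%R -> rcont df t) ->
  is_CInt df a b (f b - f a)%C.
Proof. apply (is_RInt_derive (V := C_R_CompleteNormedModule)). Qed.

(** * The complex exponential *)

Lemma cexp_plus (a b : C) : cexp (a + b) = cexp a * cexp b.
Proof.
  destruct a as [x y], b as [u v]. unfold cexp, Re, Im; simpl.
  apply C_ext; simpl; rewrite exp_plus, ?cos_plus, ?sin_plus; ring.
Qed.

Lemma cexp_0 : cexp 0 = 1.
Proof. unfold cexp; simpl. rewrite exp_0, cos_0, sin_0. apply C_ext; simpl; ring. Qed.

Lemma Cmod_cexp (z : C) : Cmod (cexp z) = exp (Re z).
Proof.
  unfold cexp, Cmod; simpl.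
  replace (_ + _)%R with (exp (Re z) ^ 2)%R.
  - rewrite sqrt_pow2; [reflexivity | left; apply exp_pos].
  - assert (H := sin2_cos2 (Im z)). unfold Rsqr in H. simpl. nra.
Qed.

Lemma cexp_ne (z : C) : cexp z <> 0.
Proof. apply Cmod_pos_ne. rewrite Cmod_cexp. apply exp_pos. Qed.

Lemma cexp_opp (z : C) : cexp (- z) = / cexp z.
Proof.
  assert (H : cexp z * cexp (- z) = 1).
  { rewrite <- cexp_plus. replace (z + - z) with (RtoC 0) by ring. apply cexp_0. }
  pose proof (cexp_ne z).
  replace (cexp (- z)) with (/ cexp z * (cexp z * cexp (- z))) by (field; assumption).
  rewrite H. ring.
Qed.

Lemma cexp_minus (a b : C) : cexp (a - b) = cexp a / cexp b.
Proof. unfold Cminus. rewrite cexp_plus, cexp_opp. reflexivity. Qed.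

Lemma cexp_RtoC (x : R) : cexp x = exp x.
Proof. unfold cexp; simpl. rewrite cos_0, sin_0. apply C_ext; simpl; ring. Qed.

Lemma is_rderive_cexp_lin (u : C) (t : R) :
  is_rderive (fun t : R => cexp (t * u)) t (u * cexp (t * u))%C.
Proof.
  destruct u as [x y].
  replace (fun t : R => cexp (t * (x, y)))
    with (fun t : R => (exp (t * x) * cos (t * y), exp (t * x) * sin (t * y))%R).
  2: { apply functional_extensionality. intros s. unfold cexp; simpl. f_equal; f_equal; f_equal; ring. }
  unfold cexp. simpl.
  replace (_ * _) with ((exp (t * x) * (x * cos (t * y) - y * sin (t * y)))%R,
     (exp (t * x) * (x * sin (t * y) + y * cos (t * y)))%R).
  2: { apply C_ext; simpl; replace (t * x - 0 * y)%R with (t * x)%R by ring;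
       replace (t * y + 0 * x)%R with (t * y)%R by ring; ring. }
  apply is_rderive_pair; auto_derive; trivial; ring.
Qed.

Lemma Re_lin_le (u : C) (t : R) : (0 <= t <= 1)%R -> (Re (t * u) <= Cmod u)%R.
Proof.
  intros Ht. apply Rle_trans with (Cmod (t * u)).
  - apply Rle_trans with (2 := Cmod_Re_le _). apply Rle_abs.
  - rewrite Cmod_mult, Cmod_R, Rabs_pos_eq by lra. pose proof (Cmod_ge_0 u). nra.
Qed.

Lemma rcont_cexp_lin (u : C) (t : R) : rcont (fun t : R => cexp (t * u)) t.
Proof. eapply is_rderive_rcont, is_rderive_cexp_lin. Qed.

(** The derivative along the segment from 0 to u involves only real derivatives of exp, cos and sin,
    and its integral is e^u - 1. Integrating the result once more gives [cexp_bound2], from which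
    the complex derivative of [cexp] follows. *)
Lemma cexp_bound1 (u : C) : (Cmod (cexp u - 1) <= Cmod u * exp (Cmod u))%R.
Proof.
  assert (H : is_CInt (fun t : R => u * cexp (t * u)) 0 1 (cexp (1%R * u) - cexp (0%R * u))%C).
  { apply (is_CInt_derive (fun t : R => cexp (t * u)) (fun t : R => u * cexp (t * u))).
    - intros t _. apply is_rderive_cexp_lin.
    - intros t _. apply rcont_mult; [apply rcont_const | apply rcont_cexp_lin]. }
  replace (1%R * u) with u in H by ring. replace (0%R * u) with (RtoC 0) in H by ring.
  rewrite cexp_0 in H.
  apply Rle_trans with ((1 - 0) * (Cmod u * exp (Cmod u)))%R; [|lra].
  eapply is_CInt_bound; [lra | | exact H].
  intros t Ht. cbv beta. rewrite Cmod_mult, Cmod_cexp. apply Rmult_le_compat_l; [apply Cmod_ge_0|].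
  destruct (Re_lin_le u t Ht) as [K|K]; [left; apply exp_increasing, K | rewrite K; lra].
Qed.

Lemma cexp_bound2 (u : C) : (Cmod (cexp u - 1 - u) <= Cmod u * Cmod u * exp (Cmod u))%R.
Proof.
  assert (H : is_CInt (fun t : R => u * cexp (t * u) - u) 0 1 ((cexp (1%R * u) - cexp (0%R * u)) - (1 - 0)%R * u)%C).
  { apply is_CInt_minus; [|apply is_CInt_const].
    apply (is_CInt_derive (fun t : R => cexp (t * u)) (fun t : R => u * cexp (t * u))).
    - intros t _. apply is_rderive_cexp_lin.
    - intros t _. apply rcont_mult; [apply rcont_const | apply rcont_cexp_lin]. }
  replace (1%R * u) with u in H by ring. replace (0%R * u) with (RtoC 0) in H by ring.
  rewrite cexp_0 in H. replace (cexp u - 1 - (1 - 0)%R * u) with (cexp u - 1 - u) in H.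
  2: { rewrite RtoC_minus. ring. }
  apply Rle_trans with ((1 - 0) * (Cmod u * Cmod u * exp (Cmod u)))%R; [|lra].
  eapply is_CInt_bound; [lra | | exact H].
  intros t Ht. cbv beta. replace (u * cexp (t * u) - u) with (u * (cexp (t * u) - 1)) by ring.
  rewrite Cmod_mult, Rmult_assoc. apply Rmult_le_compat_l; [apply Cmod_ge_0|].
  apply Rle_trans with (1 := cexp_bound1 _).
  assert (Hu : (Cmod (t * u) <= Cmod u)%R).
  { rewrite Cmod_mult, Cmod_R, Rabs_pos_eq by lra. pose proof (Cmod_ge_0 u). nra. }
  apply Rmult_le_compat; [apply Cmod_ge_0 | left; apply exp_pos | exact Hu |].
  destruct Hu as [K|K]; [left; apply exp_increasing, K | rewrite K; lra].
Qed.

Lemma is_cderive_cexp (z : C) : is_cderive cexp z (cexp z).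
Proof.
  apply is_cderive_eps. intros e He.
  set (m := Cmod (cexp z)). assert (Hm : (0 <= m)%R) by apply Cmod_ge_0.
  (* For |h| < 1 the factor e^|h| is at most 3, so the remainder is at most 3 m |h|^2. *)
  exists (Rmin 1 (e / (3 * m + 1))). split.
  { apply Rmin_pos; [lra|]. apply Rdiv_lt_0_compat; lra. }
  intros w Hw. set (h := (w - z)) in *.
  assert (H1 : (Cmod h < 1)%R) by exact (Rlt_Rmin_l Hw).
  assert (H2 : (Cmod h < e / (3 * m + 1))%R) by exact (Rlt_Rmin_r Hw).
  replace (cexp w - cexp z - cexp z * h) with (cexp z * (cexp h - 1 - h)).
  2: { replace w with (h + z) by (unfold h; ring). rewrite cexp_plus. ring. }
  rewrite Cmod_mult. fold m.
  assert (K := cexp_bound2 h).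
  assert (E : (exp (Cmod h) <= 3)%R).
  { apply Rle_trans with (2 := exp_le_3). left. apply exp_increasing. exact H1. }
  pose proof (Cmod_ge_0 h) as Hh. pose proof (exp_pos (Cmod h)).
  apply Rlt_div_mult in H2; [|lra].
  assert (Cmod h * Cmod h * exp (Cmod h) <= Cmod h * Cmod h * 3)%R by (apply Rmult_le_compat_l; nra).
  apply Rle_trans with (m * (Cmod h * Cmod h * 3))%R; [apply Rmult_le_compat_l; lra|].
  replace (m * (Cmod h * Cmod h * 3))%R with ((3 * m * Cmod h) * Cmod h)%R by ring.
  apply Rmult_le_compat_r; lra.
Qed.

Lemma ex_cderive_cexp (f : C -> C) (z : C) : ex_cderive f z -> ex_cderive (fun w => cexp (f w)) z.
Proof.
  intros [a Ha]. eexists. apply (is_cderive_comp cexp f); [apply is_cderive_cexp | exact Ha].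
Qed.

Lemma rcont_cexp (g : R -> C) (t : R) : rcont g t -> rcont (fun u => cexp (g u)) t.
Proof. intros H. apply rcont_comp; [eapply is_cderive_ccont, is_cderive_cexp | exact H]. Qed.

(** * Goursat's theorem *)

Section Bisection.

Variable Bad : R -> R -> R -> R -> Prop.
Hypothesis Bad_quarter : forall a b c d, (a <= b)%R -> (c <= d)%R -> Bad a b c d ->
  Bad a ((a + b) / 2) c ((c + d) / 2) \/ Bad ((a + b) / 2) b c ((c + d) / 2) \/
  Bad a ((a + b) / 2) ((c + d) / 2) d \/ Bad ((a + b) / 2) b ((c + d) / 2) d.

(** The fourth quarter is the default: if the other three are not bad, [Bad_quarter] makes it
    bad. *)
Let next (q : R * R * (R * R)) : R * R * (R * R) :=
  let '((a, b), (c, d)) := q in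
  let m := ((a + b) / 2)%R in let n := ((c + d) / 2)%R in
  if excluded_middle_informative (Bad a m c n) then ((a, m), (c, n)) else
  if excluded_middle_informative (Bad m b c n) then ((m, b), (c, n)) else
  if excluded_middle_informative (Bad a m n d) then ((a, m), (n, d)) else ((m, b), (n, d)).

Lemma nested_intervals (u w : nat -> R) :
  (forall n, (u n <= u (S n))%R) -> (forall n, (w (S n) <= w n)%R) ->
  (forall n, (u n <= w n)%R) -> exists x, forall n, (u n <= x <= w n)%R.
Proof.
  intros Hu Hw Huw.
  assert (Hw0 : forall n k, (w (n + k)%nat <= w n)%R).
  { intros n k. induction k as [|k IH]; [rewrite Nat.add_0_r; lra|].
    rewrite Nat.add_succ_r. specialize (Hw (n + k)%nat). lra. }
  assert (Hb : forall n, (u n <= w O)%R).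
  { intros n. apply Rle_trans with (1 := Huw n). apply (Hw0 O n). }
  destruct (ex_finite_lim_seq_incr u (w O) Hu Hb) as [x Hx].
  exists x. intros n. split.
  - apply (is_lim_seq_incr_compare u x Hx Hu).
  - apply (is_lim_seq_incr_n u n) in Hx.
    apply (is_lim_seq_le (fun k => u (k + n)%nat) (fun _ => w n) x (w n)); [|exact Hx|apply is_lim_seq_const].
    intros k. apply Rle_trans with (1 := Huw _). rewrite Nat.add_comm. apply Hw0.
Qed.

(** Repeated quartering of a bad rectangle closes in on a point. The property [Bad] is left abstract
    because both Goursat's theorem and the boundedness of continuous functions on rectangles are
    obtained this way. *)
Lemma bisection (a b c d : R) : (a <= b)%R -> (c <= d)%R -> Bad a b c d ->
  exists x y, (a <= x <= b)%R /\ (c <= y <= d)%R /\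
    forall e, (0 < e)%R -> exists a' b' c' d',
      (a <= a' <= x)%R /\ (x <= b' <= b)%R /\ (c <= c' <= y)%R /\ (y <= d' <= d)%R /\
      (b' - a' < e)%R /\ (d' - c' < e)%R /\ Bad a' b' c' d'.
Proof.
  intros Hab Hcd HB.
  set (Q := fun n => Nat.iter n next ((a, b), (c, d))).
  assert (Inv : forall n,
     (fst (fst (Q n)) <= snd (fst (Q n)))%R /\ (fst (snd (Q n)) <= snd (snd (Q n)))%R /\
     (snd (fst (Q n)) - fst (fst (Q n)) = (b - a) / 2 ^ n)%R /\
     (snd (snd (Q n)) - fst (snd (Q n)) = (d - c) / 2 ^ n)%R /\
     Bad (fst (fst (Q n))) (snd (fst (Q n))) (fst (snd (Q n))) (snd (snd (Q n)))).
  { induction n as [|n IH].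
    - simpl. repeat split; try assumption; field.
    - change (Q (S n)) with (next (Q n)).
      destruct (Q n) as [[a0 b0] [c0 d0]]. simpl in IH. destruct IH as (H1 & H2 & H3 & H4 & H5).
      destruct (Bad_quarter _ _ _ _ H1 H2 H5) as [K|K]; unfold next.
      all: repeat (match goal with |- context [excluded_middle_informative ?P] =>
             destruct (excluded_middle_informative P) end; simpl);
        try (exfalso; tauto);
        assert (P2 : (2 ^ n <> 0)%R) by (apply pow_nonzero; lra);
        repeat split; try lra; try assumption; try tauto;
        try (replace ((b - a) / (2 * 2 ^ n))%R with ((b - a) / 2 ^ n / 2)%R by (field; exact P2); rewrite <- H3; field);
        try (replace ((d - c) / (2 * 2 ^ n))%R with ((d - c) / 2 ^ n / 2)%R by (field; exact P2); rewrite <- H4; field). }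
  assert (Mono : forall n,
     (fst (fst (Q n)) <= fst (fst (Q (S n))))%R /\ (snd (fst (Q (S n))) <= snd (fst (Q n)))%R /\
     (fst (snd (Q n)) <= fst (snd (Q (S n))))%R /\ (snd (snd (Q (S n))) <= snd (snd (Q n)))%R).
  { intros n. destruct (Inv n) as (H1 & H2 & _).
    change (Q (S n)) with (next (Q n)). destruct (Q n) as [[a0 b0] [c0 d0]]. simpl in H1, H2.
    unfold next.
    repeat (match goal with |- context [excluded_middle_informative ?P] =>
             destruct (excluded_middle_informative P) end); simpl; repeat split; lra. }
  destruct (nested_intervals (fun n => fst (fst (Q n))) (fun n => snd (fst (Q n)))) as [x Hx];
    [intro; apply Mono | intro; apply Mono | intro; apply Inv |].
  destruct (nested_intervals (fun n => fst (snd (Q n))) (fun n => snd (snd (Q n)))) as [y Hy];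
    [intro; apply Mono | intro; apply Mono | intro; apply Inv |].
  assert (Low : forall n, (a <= fst (fst (Q n)))%R /\ (snd (fst (Q n)) <= b)%R /\
                          (c <= fst (snd (Q n)))%R /\ (snd (snd (Q n)) <= d)%R).
  { induction n as [|n IH]; [simpl; lra|]. specialize (Mono n). lra. }
  exists x, y. split; [apply (Hx O) | split; [apply (Hy O)|]].
  intros e He.
  assert (Small : forall L, (0 <= L)%R -> exists n, forall m, (n <= m)%nat -> (L / 2 ^ m < e)%R).
  { intros L HL.
    assert (Hlim : is_lim_seq (fun n => L * (/ 2) ^ n)%R 0).
    { replace (Finite 0) with (Rbar_mult L 0) by (simpl; f_equal; ring).
      apply is_lim_seq_scal_l. apply is_lim_seq_geom. rewrite Rabs_pos_eq; lra. }
    apply is_lim_seq_spec in Hlim. destruct (Hlim (mkposreal e He)) as [n Hn].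
    exists n. intros m Hm. specialize (Hn m Hm). simpl in Hn.
    rewrite Rminus_0_r, pow_inv in Hn.
    apply Rle_lt_trans with (2 := Hn), Rle_abs. }
  destruct (Small (b - a)%R) as [n1 Hn1]; [lra|].
  destruct (Small (d - c)%R) as [n2 Hn2]; [lra|].
  set (n := max n1 n2).
  specialize (Hn1 n ltac:(apply Nat.le_max_l)). specialize (Hn2 n ltac:(apply Nat.le_max_r)).
  destruct (Inv n) as (_ & _ & H3 & H4 & H5). specialize (Low n).
  specialize (Hx n). specialize (Hy n). simpl in Hx, Hy.
  exists (fst (fst (Q n))), (snd (fst (Q n))), (fst (snd (Q n))), (snd (snd (Q n))).
  repeat split; try lra; assumption.
Qed.

End Bisection.

(** The integral of F dz along the boundary of [a, b] x [c, d], counterclockwise; dz = i dy on the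
    vertical sides. *)
Definition rectint (F : C -> C) (a b c d : R) : C :=
  CInt (fun x => F (x, c)) a b - CInt (fun x => F (x, d)) a b
  + Ci * (CInt (fun y => F (b, y)) c d - CInt (fun y => F (a, y)) c d).

Definition on_rect (P : C -> Prop) (a b c d : R) : Prop :=
  forall x y, (a <= x <= b)%R -> (c <= y <= d)%R -> P (x, y).

Lemma rcont_hor (y x : R) : rcont (fun x => (x, y)) x.
Proof. apply rcont_pair; [apply continuous_id | apply continuous_const]. Qed.

Lemma rcont_ver (x y : R) : rcont (fun y => (x, y)) y.
Proof. apply rcont_pair; [apply continuous_const | apply continuous_id]. Qed.

Lemma is_CInt_hor (F : C -> C) (a b y : R) : (a <= b)%R ->
  (forall x, (a <= x <= b)%R -> ccont F (x, y)) ->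
  is_CInt (fun x => F (x, y)) a b (CInt (fun x => F (x, y)) a b).
Proof.
  intros Hab H. apply is_CInt_cont. rewrite Rmin_left, Rmax_right by exact Hab.
  intros t Ht. apply (rcont_comp F); [apply H, Ht | apply rcont_hor].
Qed.

Lemma is_CInt_ver (F : C -> C) (x c d : R) : (c <= d)%R ->
  (forall y, (c <= y <= d)%R -> ccont F (x, y)) ->
  is_CInt (fun y => F (x, y)) c d (CInt (fun y => F (x, y)) c d).
Proof.
  intros Hab H. apply is_CInt_cont. rewrite Rmin_left, Rmax_right by exact Hab.
  intros t Ht. apply (rcont_comp F); [apply H, Ht | apply rcont_ver].
Qed.

Lemma CInt_Chasles (f : R -> C) (a m b : R) : ex_CInt f a m -> ex_CInt f m b ->
  CInt f a b = CInt f a m + CInt f m b.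
Proof. intros H1 H2. symmetry. exact (RInt_Chasles (V := C_R_CompleteNormedModule) f a m b H1 H2). Qed.

Lemma rectint_split_hor (F : C -> C) (a m b c d : R) : (a <= m <= b)%R -> (c <= d)%R ->
  on_rect (ccont F) a b c d ->
  rectint F a b c d = rectint F a m c d + rectint F m b c d.
Proof.
  intros Hm Hcd H. unfold rectint.
  rewrite (CInt_Chasles (fun x => F (x, c)) a m b), (CInt_Chasles (fun x => F (x, d)) a m b);
    try (eexists; apply is_CInt_hor; [lra | intros; apply H; lra]).
  ring.
Qed.

Lemma rectint_split_ver (F : C -> C) (a b c n d : R) : (a <= b)%R -> (c <= n <= d)%R ->
  on_rect (ccont F) a b c d ->
  rectint F a b c d = rectint F a b c n + rectint F a b n d.
Proof.
  intros Hab Hn H. unfold rectint.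
  rewrite (CInt_Chasles (fun y => F (a, y)) c n d), (CInt_Chasles (fun y => F (b, y)) c n d);
    try (eexists; apply is_CInt_ver; [lra | intros; apply H; lra]).
  ring.
Qed.

Lemma rectint_minus (F G : C -> C) (a b c d : R) : (a <= b)%R -> (c <= d)%R ->
  on_rect (ccont F) a b c d -> on_rect (ccont G) a b c d ->
  rectint (fun z => F z - G z) a b c d = rectint F a b c d - rectint G a b c d.
Proof.
  intros Hab Hcd HF HG. unfold rectint.
  assert (Hh : forall y, (c <= y <= d)%R -> CInt (fun x => F (x, y) - G (x, y)) a b
     = CInt (fun x => F (x, y)) a b - CInt (fun x => G (x, y)) a b).
  { intros y Hy. apply CInt_unique, is_CInt_minus; apply is_CInt_hor; try exact Hab;
      intros; [apply HF | apply HG]; lra. }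
  assert (Hv : forall x, (a <= x <= b)%R -> CInt (fun y => F (x, y) - G (x, y)) c d
     = CInt (fun y => F (x, y)) c d - CInt (fun y => G (x, y)) c d).
  { intros x Hx. apply CInt_unique, is_CInt_minus; apply is_CInt_ver; try exact Hcd;
      intros; [apply HF | apply HG]; lra. }
  rewrite (Hh c), (Hh d), (Hv a), (Hv b) by lra. ring.
Qed.

Lemma rectint_primitive (G g : C -> C) (a b c d : R) : (a <= b)%R -> (c <= d)%R ->
  (forall z, is_cderive G z (g z)) -> (forall z, ccont g z) ->
  rectint g a b c d = 0.
Proof.
  intros Hab Hcd HG Hg. unfold rectint.
  assert (Hh : forall y, is_CInt (fun x => g (x, y)) a b (G (b, y) - G (a, y))%C).
  { intros y. apply (is_CInt_derive (fun x => G (x, y))).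
    - intros t _. replace (g (t, y)) with (g (t, y) * (1, 0)%R) by (change ((1,0)%R) with (RtoC 1); ring).
      apply (is_rderive_comp G (fun x => (x, y))); [apply HG|].
      apply is_rderive_pair; [apply (is_derive_id (K := R_AbsRing)) | apply (is_derive_const (K := R_AbsRing) (V := R_NormedModule))].
    - intros t _. apply (rcont_comp g); [apply Hg | apply rcont_hor]. }
  assert (Hv : forall x, is_CInt (fun y => g (x, y) * Ci) c d (G (x, d) - G (x, c))%C).
  { intros x. apply (is_CInt_derive (fun y => G (x, y))).
    - intros t _. apply (is_rderive_comp G (fun y => (x, y))); [apply HG|].
      apply is_rderive_pair; [apply (is_derive_const (K := R_AbsRing) (V := R_NormedModule)) | apply (is_derive_id (K := R_AbsRing))].
    - intros t _. apply rcont_mult; [|apply rcont_const].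
      apply (rcont_comp g); [apply Hg | apply rcont_ver]. }
  assert (Hv' : forall x, Ci * CInt (fun y => g (x, y)) c d = (G (x, d) - G (x, c))%C).
  { intros x. rewrite <- (CInt_unique _ _ _ _ (Hv x)). symmetry. apply CInt_unique.
    apply is_CInt_ext with (fun y => Ci * g (x, y)); [intros; ring|].
    apply is_CInt_scal. apply is_CInt_ver; [exact Hcd | intros; apply Hg]. }
  rewrite (CInt_unique _ _ _ _ (Hh c)), (CInt_unique _ _ _ _ (Hh d)).
  replace (Ci * (CInt (fun y => g (b, y)) c d - CInt (fun y => g (a, y)) c d))
    with (Ci * CInt (fun y => g (b, y)) c d - Ci * CInt (fun y => g (a, y)) c d) by ring.
  rewrite !Hv'. ring.
Qed.

Lemma rectint_bound (F : C -> C) (a b c d M : R) : (a <= b)%R -> (c <= d)%R ->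
  on_rect (ccont F) a b c d -> on_rect (fun z => (Cmod (F z) <= M)%R) a b c d ->
  (Cmod (rectint F a b c d) <= 2 * ((b - a) + (d - c)) * M)%R.
Proof.
  intros Hab Hcd HF HM. unfold rectint.
  assert (Hh : forall y, (c <= y <= d)%R -> (Cmod (CInt (fun x => F (x, y)) a b) <= (b - a) * M)%R).
  { intros y Hy. apply is_CInt_bound with (f := fun x => F (x, y)); [exact Hab | | ].
    - intros; apply HM; lra.
    - apply is_CInt_hor; [exact Hab | intros; apply HF; lra]. }
  assert (Hv : forall x, (a <= x <= b)%R -> (Cmod (CInt (fun y => F (x, y)) c d) <= (d - c) * M)%R).
  { intros x Hx. apply is_CInt_bound with (f := fun y => F (x, y)); [exact Hcd | | ].
    - intros; apply HM; lra.
    - apply is_CInt_ver; [exact Hcd | intros; apply HF; lra]. }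
  apply Rle_trans with (1 := Cmod_triangle _ _). rewrite Cmod_mult, Cmod_Ci, Rmult_1_l.
  assert (H1 := Cmod_triangle_minus (CInt (fun x => F (x, c)) a b) (CInt (fun x => F (x, d)) a b)).
  assert (H2 := Cmod_triangle_minus (CInt (fun y => F (b, y)) c d) (CInt (fun y => F (a, y)) c d)).
  assert (Hc := Hh c ltac:(lra)). assert (Hd := Hh d ltac:(lra)).
  assert (Ha := Hv a ltac:(lra)). assert (Hb := Hv b ltac:(lra)). lra.
Qed.

(* Goursat: a rectangle with [|rectint| > e * (w + h)^2] has a quarter with the
   same property, while differentiability excludes it near the limit point. *)
Theorem goursat (F : C -> C) (a b c d : R) : (a <= b)%R -> (c <= d)%R ->
  on_rect (ex_cderive F) a b c d -> rectint F a b c d = 0.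
Proof.
  intros Hab Hcd HF.
  apply Cmod_small_eq. intros e0 He0.
  replace (rectint F a b c d - 0) with (rectint F a b c d) by ring.
  destruct (Rle_lt_dec (Cmod (rectint F a b c d)) e0) as [|Hlt]; [assumption|exfalso].
  set (S := ((b - a) + (d - c))%R). assert (HS : (0 <= S)%R) by (unfold S; lra).
  (* This makes e S^2 <= e0, so the whole rectangle is bad if its integral exceeds e0; the summand 1
     covers a degenerate rectangle with S = 0. *)
  set (e := (e0 / (S * S + 1))%R).
  assert (He : (0 < e)%R) by (apply Rdiv_lt_0_compat; nra).
  set (Bad := fun a' b' c' d' : R => ((a <= a' /\ b' <= b /\ c <= c' /\ d' <= d) /\
     Cmod (rectint F a' b' c' d') > e * (((b' - a') + (d' - c')) * ((b' - a') + (d' - c'))))%R).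
  destruct (bisection Bad) with (a := a) (b := b) (c := c) (d := d)
    as (x & y & Hx & Hy & Hbad); try assumption.
  - clear - HF. intros a' b' c' d' Hab' Hcd' [Hin Hgt].
    set (m := ((a' + b') / 2)%R). set (n := ((c' + d') / 2)%R).
    assert (CF : on_rect (ccont F) a' b' c' d').
    { intros u v Hu Hv. apply ex_cderive_ccont, HF; lra. }
    assert (Hm : (a' <= m <= b')%R) by (unfold m; lra).
    assert (Hn : (c' <= n <= d')%R) by (unfold n; lra).
    assert (E : rectint F a' b' c' d' =
      (rectint F a' m c' n + rectint F m b' c' n) + (rectint F a' m n d' + rectint F m b' n d')).
    { rewrite (rectint_split_ver F a' b' c' n d') by assumption.
      rewrite (rectint_split_hor F a' m b' c' n), (rectint_split_hor F a' m b' n d'); try reflexivity; try lra;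
        intros u v Hu Hv; apply CF; lra. }
    set (q := (e * (((b' - a') + (d' - c')) / 2 * (((b' - a') + (d' - c')) / 2)))%R).
    assert (Hq : (e * (((b' - a') + (d' - c')) * ((b' - a') + (d' - c'))) = 4 * q)%R) by (unfold q; field).
    assert (T1 := Cmod_triangle (rectint F a' m c' n + rectint F m b' c' n) (rectint F a' m n d' + rectint F m b' n d')).
    assert (T2 := Cmod_triangle (rectint F a' m c' n) (rectint F m b' c' n)).
    assert (T3 := Cmod_triangle (rectint F a' m n d') (rectint F m b' n d')).
    rewrite <- E in T1. unfold Bad.
    assert (Q1 : (e * (((m - a') + (n - c')) * ((m - a') + (n - c'))) = q)%R) by (unfold q, m, n; field).
    assert (Q2 : (e * (((b' - m) + (n - c')) * ((b' - m) + (n - c'))) = q)%R) by (unfold q, m, n; field).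
    assert (Q3 : (e * (((m - a') + (d' - n)) * ((m - a') + (d' - n))) = q)%R) by (unfold q, m, n; field).
    assert (Q4 : (e * (((b' - m) + (d' - n)) * ((b' - m) + (d' - n))) = q)%R) by (unfold q, m, n; field).
    rewrite Q1, Q2, Q3, Q4.
    destruct (Rle_lt_dec (Cmod (rectint F a' m c' n)) q); [|left; split; lra].
    destruct (Rle_lt_dec (Cmod (rectint F m b' c' n)) q); [|right; left; split; lra].
    destruct (Rle_lt_dec (Cmod (rectint F a' m n d')) q); [|right; right; left; split; lra].
    right; right; right; split; lra.
  - split; [lra|]. fold S. apply Rlt_gt. apply Rle_lt_trans with (2 := Hlt).
    unfold e. apply Rmult_le_reg_r with (S * S + 1)%R; [nra|].
    replace (e0 / (S * S + 1) * (S * S) * (S * S + 1))%R with (e0 * (S * S))%R by (field; nra).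
    nra.
  - destruct (HF x y Hx Hy) as [l Hl]. rewrite is_cderive_eps in Hl.
    destruct (Hl (e / 2)%R) as [dl [Hdl Hlin]]; [lra|].
    destruct (Hbad (dl / 2)%R) as (a' & b' & c' & d' & Ha' & Hb' & Hc' & Hd' & Hw & Hh & [_ Hgt]); [lra|].
    (* The affine approximation has a primitive, so subtracting it does not change the integral.
       What remains is at most e/2 (w + h) on a rectangle of perimeter 2 (w + h), which contradicts
       badness. *)
    set (A := fun z : C => F (x, y) + l * (z - (x, y))).
    assert (CA : forall z, ccont A z).
    { intros z. apply ex_cderive_ccont. unfold A.
      apply ex_cderive_plus; [apply ex_cderive_const|].
      apply ex_cderive_mult; [apply ex_cderive_const|].
      apply ex_cderive_shift. }
    assert (CF : on_rect (ccont F) a' b' c' d').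
    { intros u v Hu Hv. apply ex_cderive_ccont, HF; lra. }
    assert (E : rectint (fun z => F z - A z) a' b' c' d' = rectint F a' b' c' d').
    { rewrite rectint_minus; try lra; [|exact CF | intros u v _ _; apply CA].
      rewrite (rectint_primitive
        (fun z => (F (x, y) - l * (x, y)) * z + (l / 2) * (z * z)) A); try lra; [ring | | exact CA].
      intros z. eapply is_cderive_val.
      - apply is_cderive_plus; [apply is_cderive_mult; [apply is_cderive_const | apply is_cderive_id]|].
        apply is_cderive_mult; [apply is_cderive_const|].
        apply is_cderive_mult; apply is_cderive_id.
      - unfold A. simpl. field. }
    rewrite <- E in Hgt.
    assert (B := rectint_bound (fun z => F z - A z) a' b' c' d' (e / 2 * ((b' - a') + (d' - c')))%R).
    assert (Hgt2 : (Cmod (rectint (fun z => F z - A z)%C a' b' c' d') <=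
       2 * (b' - a' + (d' - c')) * (e / 2 * (b' - a' + (d' - c'))))%R).
    { apply B; try lra.
      - intros u v Hu Hv. apply ccont_minus; [apply CF; lra | apply CA].
      - intros u v Hu Hv.
        assert (Hd : (Cmod ((u, v) - (x, y)) <= (b' - a') + (d' - c'))%R).
        { apply Rle_trans with (1 := Cmod_le_Re_Im _). simpl.
          apply Rplus_le_compat; apply Rabs_le; lra. }
        replace (F (u, v) - A (u, v)) with (F (u, v) - F (x, y) - l * ((u, v) - (x, y))) by (unfold A; ring).
        apply Rle_trans with (e / 2 * Cmod ((u, v) - (x, y)))%R; [apply Hlin; lra|].
        apply Rmult_le_compat_l; lra. }
    lra.
Qed.

(** * Cauchy's formula *)

(** The integral of g dz over the circle, divided by i. At r = 0 it is defined and vanishes, which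
    is how shrinking circles are treated. *)
Definition circ (g : C -> C) (q : C) (r : R) : C :=
  CInt (fun t => g (q + polar r t) * polar r t) (- PI)%R PI.

Lemma polar_cexp (r t : R) : (0 < r)%R -> polar r t = cexp (ln r, t).
Proof. intros Hr. unfold polar, cexp; simpl. rewrite exp_ln by exact Hr. reflexivity. Qed.

Lemma Cmod_polar (r t : R) : (0 <= r)%R -> Cmod (polar r t) = r.
Proof.
  intros Hr. unfold polar, Cmod; simpl.
  replace (_ + _)%R with (r ^ 2)%R.
  - apply sqrt_pow2, Hr.
  - assert (H := sin2_cos2 t). unfold Rsqr in H. simpl. nra.
Qed.

Lemma rcont_polar (r t : R) : rcont (fun t => polar r t) t.
Proof.
  apply rcont_pair.
  - apply ex_derive_Rcontinuous. auto_derive; trivial.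
  - apply ex_derive_Rcontinuous. auto_derive; trivial.
Qed.

Lemma rcont_circle (f : C -> C) (q : C) (r t : R) :
  ccont f (q + polar r t) -> rcont (fun t => f (q + polar r t)) t.
Proof.
  intros H. apply (rcont_comp f); [exact H|].
  apply rcont_plus; [apply rcont_const | apply rcont_polar].
Qed.

Lemma neg_pi_le_pi : (- PI <= PI)%R.
Proof. pose proof PI_RGT_0. lra. Qed.

Lemma is_CInt_circ (g : C -> C) (q : C) (r : R) :
  (forall z, Cmod (z - q) = r -> ccont g z) -> (0 <= r)%R ->
  is_CInt (fun t => g (q + polar r t) * polar r t) (- PI)%R PI (circ g q r).
Proof.
  intros H Hr. apply is_CInt_cont. intros t _.
  apply rcont_mult; [|apply rcont_polar]. apply rcont_circle, H.
  replace (q + polar r t - q) with (polar r t) by ring. apply Cmod_polar, Hr.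
Qed.

(* In the coordinate w = log (z - q) an annulus is a rectangle, and two of its
   sides carry the same values. *)
Lemma circ_annulus (g : C -> C) (q : C) (r1 r2 : R) : (0 < r1 <= r2)%R ->
  (forall z, (r1 <= Cmod (z - q) <= r2)%R -> ex_cderive g z) -> circ g q r1 = circ g q r2.
Proof.
  intros [Hr1 Hr2] Hg.
  set (F := fun w => g (q + cexp w) * cexp w).
  assert (Hln : (ln r1 <= ln r2)%R).
  { destruct Hr2 as [K|K]; [left; apply ln_increasing; lra | rewrite K; lra]. }
  assert (H : rectint F (ln r1) (ln r2) (- PI) PI = 0).
  { apply goursat; [exact Hln | apply neg_pi_le_pi |].
    intros x y Hx Hy. unfold F. apply ex_cderive_mult; [|apply ex_cderive_cexp, ex_cderive_id].
    apply ex_cderive_comp.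
    - apply Hg. replace (q + cexp (x, y) - q) with (cexp (x, y)) by ring.
      rewrite Cmod_cexp. simpl. rewrite <- (exp_ln r1), <- (exp_ln r2) by lra.
      split; apply exp_le_mono; lra.
    - apply ex_cderive_plus; [apply ex_cderive_const | apply ex_cderive_cexp, ex_cderive_id]. }
  unfold rectint in H.
  assert (E : CInt (fun x => F (x, (- PI)%R)) (ln r1) (ln r2) = CInt (fun x => F (x, PI)) (ln r1) (ln r2)).
  { f_equal. apply functional_extensionality. intros x. unfold F, cexp; simpl.
    rewrite cos_neg, sin_neg, sin_PI, Ropp_0. reflexivity. }
  rewrite E in H.
  assert (E1 : forall r, (0 < r)%R -> CInt (fun y => F (ln r, y)) (- PI)%R PI = circ g q r).
  { intros r Hr. unfold circ. f_equal. apply functional_extensionality. intros t.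
    unfold F. rewrite polar_cexp by exact Hr. reflexivity. }
  rewrite !E1 in H by lra.
  assert (K : Ci * (circ g q r2 - circ g q r1) = 0) by (rewrite <- H; ring).
  replace (circ g q r1) with (circ g q r2 - (- Ci * (Ci * (circ g q r2 - circ g q r1)))).
  - rewrite K. ring.
  - replace (- Ci * (Ci * (circ g q r2 - circ g q r1))) with (- (Ci * Ci) * (circ g q r2 - circ g q r1)) by ring.
    replace (Ci * Ci) with (- (1)) by (apply C_ext; simpl; ring). ring.
Qed.

(** Compactness of [a, b], applied to real and imaginary parts; it lets the radius vary under a
    circle integral. *)
Lemma uniform_strip (Phi : R -> R -> C) (a b c : R) :
  (forall t, (a <= t <= b)%R -> forall e, (0 < e)%R -> exists d, (0 < d)%R /\ forall u v,
     (Rabs (u - t) < d)%R -> (Rabs (v - c) < d)%R -> (Cmod (Phi u v - Phi t c) < e)%R) ->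
  forall e, (0 < e)%R -> exists d, (0 < d)%R /\ forall t v, (a <= t <= b)%R ->
     (Rabs (v - c) < d)%R -> (Cmod (Phi t v - Phi t c) < e)%R.
Proof.
  intros H e He. assert (He2 : (0 < e / 2)%R) by lra.
  assert (P : forall pr : C -> R, (forall z w, Rabs (pr z - pr w) <= Cmod (z - w))%R ->
    exists d, (0 < d)%R /\ forall t v, (a <= t <= b)%R ->
     (Rabs (v - c) < d)%R -> (Rabs (pr (Phi t v) - pr (Phi t c)) < e / 2)%R).
  { intros pr Hpr.
    destruct (uniform_continuity_2d_1d (fun u v => pr (Phi u v)) a b c) with (eps := mkposreal _ He2) as [d Hd].
    - intros t Ht e1. destruct (H t Ht e1 (cond_pos e1)) as [d [Hd1 Hd2]].
      exists (mkposreal d Hd1). intros u v Hu Hv. apply Rle_lt_trans with (1 := Hpr _ _).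
      apply Hd2; assumption.
    - exists d. split; [apply cond_pos|]. intros t v Ht Hv.
      apply Rabs_lt_between in Hv. pose proof (cond_pos d).
      apply (Hd t c t v); try lra. replace (t - t)%R with 0%R by ring. rewrite Rabs_R0. lra. }
  destruct (P Re) as [d1 [Hd1 H1]].
  { intros z w. apply Rle_trans with (2 := Cmod_Re_le _). right. reflexivity. }
  destruct (P Im) as [d2 [Hd2 H2]].
  { intros z w. apply Rle_trans with (2 := Cmod_Im_le _). right. reflexivity. }
  exists (Rmin d1 d2). split; [apply Rmin_pos; assumption|]. intros t v Ht Hv.
  apply Rle_lt_trans with (1 := Cmod_le_Re_Im _).
  assert (K1 := H1 t v Ht (Rlt_Rmin_l Hv)).
  assert (K2 := H2 t v Ht (Rlt_Rmin_r Hv)).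
  change (Rabs (Re (Phi t v) - Re (Phi t c)) + Rabs (Im (Phi t v) - Im (Phi t c)) < e)%R. lra.
Qed.

Lemma polar_cont2 (r t e : R) : (0 < e)%R -> exists d, (0 < d)%R /\ forall u v,
  (Rabs (u - t) < d)%R -> (Rabs (v - r) < d)%R -> (Cmod (polar v u - polar r t) < e)%R.
Proof.
  intros He.
  destruct (proj1 (rcont_eps _ _) (rcont_polar 1 t) (e / (2 * (Rabs r + 2)))%R) as [d [Hd H]].
  { pose proof (Rabs_pos r). apply Rdiv_lt_0_compat; lra. }
  exists (Rmin (Rmin d 1) (e / 2)). split; [repeat apply Rmin_pos; lra|]. intros u v Hu Hv.
  assert (Hu1 : (Rabs (u - t) < d)%R).
  { apply Rlt_le_trans with (1 := Hu). eapply Rle_trans; [apply Rmin_l|apply Rmin_l]. }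
  assert (Hv1 : (Rabs (v - r) < 1)%R).
  { apply Rlt_le_trans with (1 := Hv). eapply Rle_trans; [apply Rmin_l|apply Rmin_r]. }
  assert (Hv2 : (Rabs (v - r) < e / 2)%R) by exact (Rlt_Rmin_r Hv).
  specialize (H u Hu1).
  replace (polar v u - polar r t)
    with (v * (polar 1 u - polar 1 t) + (v - r)%R * polar 1 t)
    by (apply C_ext; simpl; ring).
  apply Rle_lt_trans with (1 := Cmod_triangle _ _). rewrite !Cmod_mult, !Cmod_R, (Cmod_polar 1) by lra.
  assert (Hr : (Rabs v <= Rabs r + 1)%R).
  { replace v with ((v - r) + r)%R by ring. apply Rle_trans with (1 := Rabs_triang _ _). lra. }
  assert (Hm : (Rabs v * Cmod (polar 1 u - polar 1 t) <= e / 2)%R).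
  { pose proof (Rabs_pos r). pose proof (Rabs_pos v). pose proof (Cmod_ge_0 (polar 1 u - polar 1 t)).
    apply Rle_trans with ((Rabs r + 2) * (e / (2 * (Rabs r + 2))))%R.
    - apply Rmult_le_compat; lra.
    - right. field. lra. }
  lra.
Qed.

Lemma circ_cont (g : C -> C) (q : C) (r0 : R) : (0 <= r0)%R ->
  (forall z, Cmod (z - q) = r0 -> ccont g z) ->
  forall e, (0 < e)%R -> exists d, (0 < d)%R /\
    forall r, (0 <= r)%R -> (Rabs (r - r0) < d)%R ->
      (forall z, Cmod (z - q) = r -> ccont g z) -> (Cmod (circ g q r - circ g q r0) <= e)%R.
Proof.
  intros Hr0 Hg e He. pose proof PI_RGT_0 as HPI.
  destruct (uniform_strip (fun t r => g (q + polar r t) * polar r t) (- PI) PI r0) with (e := (e / (2 * PI))%R)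
    as [d [Hd H]].
  - intros t _ e1 He1.
    destruct (Cmult_close (g (q + polar r0 t)) (polar r0 t) e1 He1) as [d1 [Hd1 H1]].
    destruct (Hg (q + polar r0 t)) with (e := d1) as [d2 [Hd2 H2]]; [|exact Hd1|].
    { replace (q + polar r0 t - q) with (polar r0 t) by ring. apply Cmod_polar, Hr0. }
    destruct (polar_cont2 r0 t (Rmin d1 d2)) as [d3 [Hd3 H3]]; [apply Rmin_pos; assumption|].
    exists d3. split; [exact Hd3|]. intros u v Hu Hv. specialize (H3 u v Hu Hv). apply H1.
    + apply H2. replace (q + polar v u - (q + polar r0 t)) with (polar v u - polar r0 t) by ring.
      apply (Rlt_Rmin_r H3).
    + apply (Rlt_Rmin_l H3).
  - apply Rdiv_lt_0_compat; lra.
  - exists d. split; [exact Hd|]. intros r Hr Hrr Hgr.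
    apply Rle_trans with ((PI - - PI) * (e / (2 * PI)))%R.
    + eapply is_CInt_bound; [apply neg_pi_le_pi | | apply is_CInt_minus; apply is_CInt_circ; assumption].
      intros t Ht. left. apply (H t r); assumption.
    + right. field. lra.
Qed.

(** For circles around q, the annulus argument fails at radius 0 and at the radius [rho] of the
    circle through the point where Cauchy's formula is evaluated. Continuity in the radius closes
    both gaps. *)
Lemma const_from_zero (c : R -> C) (R0 rho : R) : (0 < rho < R0)%R ->
  (forall r0, (0 <= r0 < R0)%R -> forall e, (0 < e)%R -> exists d, (0 < d)%R /\
     forall r, (0 <= r < R0)%R -> (Rabs (r - r0) < d)%R -> (Cmod (c r - c r0) <= e)%R) ->
  (forall r1 r2, (0 < r1 <= r2)%R -> (r2 < R0)%R -> (r2 < rho \/ rho < r1)%R -> c r1 = c r2) ->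
  forall r, (0 <= r < R0)%R -> c r = c 0%R.
Proof.
  intros Hrho Hc Hk.
  assert (lt : forall r, (0 <= r < rho)%R -> c r = c 0%R).
  { intros r Hr. destruct (Req_dec r 0) as [->|Hr0]; [reflexivity|].
    apply Cmod_small_eq. intros e He.
    destruct (Hc 0%R ltac:(lra) e He) as [d [Hd H]].
    set (x := Rmin (d / 2) r).
    assert (Hx : (0 < x)%R) by (apply Rmin_pos; lra).
    assert (Hx1 : (x <= d / 2)%R) by apply Rmin_l. assert (Hx2 : (x <= r)%R) by apply Rmin_r.
    rewrite <- (Hk x r) by lra. apply H; [lra|]. rewrite Rminus_0_r, Rabs_pos_eq; lra. }
  assert (eq : c rho = c 0%R).
  { apply Cmod_small_eq. intros e He.
    destruct (Hc rho ltac:(lra) e He) as [d [Hd H]].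
    set (x := Rmax (rho - d / 2) (rho / 2)).
    assert (Hx1 : (rho - d / 2 <= x)%R) by apply Rmax_l. assert (Hx2 : (rho / 2 <= x)%R) by apply Rmax_r.
    assert (Hx3 : (x < rho)%R) by (apply Rmax_lub_lt; lra).
    rewrite <- (lt x) by lra. rewrite Cmod_minus_sym. apply H; [lra|].
    rewrite Rabs_minus_sym, Rabs_pos_eq; lra. }
  intros r Hr. destruct (Rtotal_order r rho) as [L|[L|L]]; [apply lt; lra | rewrite L; exact eq |].
  rewrite <- eq. apply Cmod_small_eq. intros e He.
  destruct (Hc rho ltac:(lra) e He) as [d [Hd H]].
  set (x := Rmin (rho + d / 2) r).
  assert (Hx : (rho < x)%R) by (apply Rmin_glb_lt; lra).
  assert (Hx1 : (x <= rho + d / 2)%R) by apply Rmin_l. assert (Hx2 : (x <= r)%R) by apply Rmin_r.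
  rewrite <- (Hk x r) by lra. apply H; [lra|]. rewrite Rabs_pos_eq; lra.
Qed.

(** For a = q the integrand is 1. The difference from this case is (a - q) / ((z - q) (z - a)) times
    z - q; since this rational function decays like |z|^(-2), enlarging the circle shows that its
    integral vanishes. *)
Lemma circ_kernel (q a : C) (r : R) : (Cmod (a - q) < r)%R ->
  CInt (fun t => polar r t / (q + polar r t - a)) (- PI)%R PI = RtoC (2 * PI)%R.
Proof.
  intros Ha. set (b := a - q). fold b in Ha. pose proof PI_RGT_0 as HPI.
  pose proof (Cmod_ge_0 b) as Hb. assert (Hr : (0 < r)%R) by lra.
  set (g := fun z => b / ((z - q) * (z - a))).
  assert (Hne : forall z, (Cmod b < Cmod (z - q))%R -> z - q <> 0 /\ z - a <> 0).
  { intros z Hz. split; [apply Cmod_pos_ne; lra|]. apply Cmod_pos_ne.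
    replace (z - a) with ((z - q) - b) by (unfold b; ring).
    apply Rlt_le_trans with (2 := Cmod_triangle_rev _ _). lra. }
  assert (Hg : forall z, (Cmod b < Cmod (z - q))%R -> ex_cderive g z).
  { intros z Hz. destruct (Hne z Hz). unfold g. apply ex_cderive_div.
    - apply Cmult_ne; assumption.
    - apply ex_cderive_const.
    - apply ex_cderive_mult; apply ex_cderive_minus; try apply ex_cderive_id; apply ex_cderive_const. }
  assert (E0 : circ g q r = 0).
  { apply Cmod_small_eq. intros e He. replace (circ g q r - 0) with (circ g q r) by ring.
    (* Chosen so that 2 pi |b| / (r2 - |b|) <= e. *)
    set (r2 := (r + Cmod b + 2 * PI * Cmod b / e)%R).
    assert (0 <= 2 * PI * Cmod b / e)%R by (apply Rdiv_le_0_compat; [nra|exact He]).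
    rewrite (circ_annulus g q r r2); [| unfold r2; lra | intros z Hz; apply Hg; lra].
    assert (Hr2 : (0 < r2)%R) by (unfold r2; lra).
    apply Rle_trans with ((PI - - PI) * (Cmod b / (r2 - Cmod b)))%R.
    - eapply is_CInt_bound; [apply neg_pi_le_pi | | apply is_CInt_circ; [|lra]].
      + intros t _. cbv beta.
        assert (Hm : Cmod (polar r2 t) = r2) by (apply Cmod_polar; lra).
        assert (Hz : (Cmod b < Cmod (q + polar r2 t - q))%R).
        { replace (q + polar r2 t - q) with (polar r2 t) by ring. rewrite Hm. unfold r2; lra. }
        destruct (Hne _ Hz) as [K1 K2]. unfold g.
        replace (b / ((q + polar r2 t - q) * (q + polar r2 t - a)) * polar r2 t)
          with (b / (q + polar r2 t - a)).
        2: { replace (q + polar r2 t - q) with (polar r2 t) in * by ring. field. split; assumption. }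
        rewrite Cmod_div by exact K2. apply Rmult_le_compat_l; [exact Hb|].
        apply Rinv_le_contravar; [unfold r2; lra|].
        replace (q + polar r2 t - a) with (polar r2 t - b) by (unfold b; ring).
        apply Rle_trans with (2 := Cmod_triangle_rev _ _). rewrite Hm. lra.
      + intros z Hz. apply ex_cderive_ccont, Hg. rewrite Hz. unfold r2; lra.
    - replace (r2 - Cmod b)%R with (r + 2 * PI * Cmod b / e)%R by (unfold r2; ring).
      apply Rmult_le_reg_r with (r + 2 * PI * Cmod b / e)%R; [lra|].
      replace ((PI - - PI) * (Cmod b / (r + 2 * PI * Cmod b / e)) * (r + 2 * PI * Cmod b / e))%R
        with (2 * PI * Cmod b)%R by (field; split; [lra|nra]).
      rewrite Rmult_plus_distr_l. replace (e * (2 * PI * Cmod b / e))%R with (2 * PI * Cmod b)%R by (field; lra).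
      nra. }
  assert (Hr0 : forall t, Cmod (q + polar r t - q) = r).
  { intros t. replace (q + polar r t - q) with (polar r t) by ring. apply Cmod_polar; lra. }
  replace (RtoC (2 * PI)%R) with ((PI - - PI)%R * 1 + circ g q r).
  2: { rewrite E0. apply C_ext; simpl; ring. }
  apply CInt_unique.
  apply is_CInt_ext with (fun t => 1 + g (q + polar r t) * polar r t).
  - intros t _. destruct (Hne (q + polar r t)) as [K1 K2]; [rewrite Hr0; exact Ha|].
    unfold g. replace (q + polar r t - q) with (polar r t) in * by ring.
    unfold b. field. split; assumption.
  - apply is_CInt_plus; [apply is_CInt_const|]. apply is_CInt_circ; [|lra].
    intros z Hz. apply ex_cderive_ccont, Hg. lra.
Qed.

(* The punctured hypothesis makes the formula usable for removable singularities. *)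
Lemma cauchy_formula_punctured (f : C -> C) (q a : C) (r R0 : R) :
  (forall z, (Cmod (z - q) < R0)%R -> ccont f z) ->
  (forall z, (Cmod (z - q) < R0)%R -> z <> q -> ex_cderive f z) ->
  a <> q -> (Cmod (a - q) < r)%R -> (r < R0)%R ->
  CInt (fun t => f (q + polar r t) * (polar r t / (q + polar r t - a))) (- PI)%R PI = (2 * PI)%R * f a.
Proof.
  intros Hc Hd Haq Har HrR.
  assert (Hrho : (0 < Cmod (a - q))%R) by (apply Cmod_gt_0, Cminus_ne, Haq).
  destruct (Hd a ltac:(lra) Haq) as [l Hl].
  (* The difference quotient of f at a is continuous, and holomorphic except possibly at q and a;
     its circle integral is therefore constant in the radius and equal to its value 0 at radius
     0. *)
  set (g := fun z => if excluded_middle_informative (z = a) then l else (f z - f a) / (z - a)).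
  assert (Hg : forall z, z <> a -> exists d, (0 < d)%R /\ forall w, (Cmod (w - z) < d)%R ->
     (f w - f a) / (w - a) = g w).
  { intros z Hz. exists (Cmod (z - a)). split; [apply Cmod_gt_0, Cminus_ne, Hz|].
    intros w Hw. unfold g. destruct excluded_middle_informative as [E|E]; [|reflexivity].
    exfalso. subst w. rewrite Cmod_minus_sym in Hw. lra. }
  assert (Cg : forall z, (Cmod (z - q) < R0)%R -> ccont g z).
  { intros z Hz. destruct (excluded_middle_informative (z = a)) as [->|Hza].
    - intros e He. rewrite is_cderive_eps in Hl. destruct (Hl (e / 2)%R) as [d [Hd1 Hd2]]; [lra|].
      exists d. split; [exact Hd1|]. intros w Hw. unfold g.
      destruct (excluded_middle_informative (a = a)) as [_|]; [|congruence].
      destruct excluded_middle_informative as [E|E]; [apply Cmod_self_lt, He|].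
      assert (Hwa : w - a <> 0) by (apply Cminus_ne, E).
      replace ((f w - f a) / (w - a) - l) with ((f w - f a - l * (w - a)) / (w - a)) by (field; exact Hwa).
      rewrite Cmod_div by exact Hwa. assert (0 < Cmod (w - a))%R by (apply Cmod_gt_0, Hwa).
      apply Rmult_lt_reg_r with (Cmod (w - a)); [assumption|].
      unfold Rdiv. rewrite Rmult_assoc, Rinv_l by lra. specialize (Hd2 w Hw). nra.
    - destruct (Hg z Hza) as [d [Hd1 Hd2]].
      apply ccont_local with (2 := Hd2); [exact Hd1|]. apply ccont_mult.
      + apply ccont_minus; [apply Hc, Hz | apply ex_cderive_ccont, ex_cderive_const].
      + apply ex_cderive_ccont, ex_cderive_inv; [apply Cminus_ne, Hza|].
        apply ex_cderive_shift. }
  assert (Dg : forall z, (Cmod (z - q) < R0)%R -> z <> q -> z <> a -> ex_cderive g z).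
  { intros z Hz Hzq Hza. destruct (Hg z Hza) as [d [Hd1 Hd2]].
    apply ex_cderive_local with (2 := Hd2); [exact Hd1|]. apply ex_cderive_div.
    - apply Cminus_ne, Hza.
    - apply ex_cderive_minus; [apply Hd; assumption | apply ex_cderive_const].
    - apply ex_cderive_shift. }
  assert (E0 : circ g q r = circ g q 0).
  { apply (const_from_zero (circ g q) R0 (Cmod (a - q))); [lra | | | lra].
    - intros r0 Hr0 e He. destruct (circ_cont g q r0) with (e := e) as [d [Hd1 Hd2]]; [lra | | exact He |].
      + intros z Hz. apply Cg. lra.
      + exists d. split; [exact Hd1|]. intros r' Hr' Hrr. apply Hd2; [lra | exact Hrr|].
        intros z Hz. apply Cg. lra.
    - intros r1 r2 H12 H2 Hor. apply circ_annulus; [exact H12|]. intros z Hz. apply Dg; [lra| |].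
      + intros ->. replace (q - q) with (RtoC 0) in Hz by ring. rewrite Cmod_0 in Hz. lra.
      + intros ->. lra. }
  assert (E1 : circ g q 0 = 0).
  { apply CInt_unique. apply is_CInt_ext with (fun _ => RtoC 0).
    - intros t _. replace (polar 0 t) with (RtoC 0) by (apply C_ext; simpl; ring). ring.
    - assert (K := is_CInt_const 0 (- PI) PI).
      replace ((PI - - PI)%R * 0) with (RtoC 0) in K by ring. exact K. }
  assert (Hr : (0 < r)%R) by lra.
  assert (Hm : forall t, Cmod (q + polar r t - q) = r).
  { intros t. replace (q + polar r t - q) with (polar r t) by ring. apply Cmod_polar; lra. }
  assert (Hne : forall t, q + polar r t <> a).
  { intros t E. assert (K := Hm t). rewrite E in K. lra. }
  assert (K : is_CInt (fun t => polar r t / (q + polar r t - a)) (- PI)%R PI (RtoC (2 * PI)%R)).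
  { rewrite <- (circ_kernel q a r Har). apply is_CInt_cont. intros t _.
    apply rcont_mult; [apply rcont_polar|]. apply rcont_inv; [apply Cminus_ne, Hne|].
    apply rcont_minus; [|apply rcont_const]. apply rcont_plus; [apply rcont_const | apply rcont_polar]. }
  apply CInt_unique. replace ((2 * PI)%R * f a) with (circ g q r + f a * (2 * PI)%R) by (rewrite E0, E1; ring).
  apply is_CInt_ext with (fun t => g (q + polar r t) * polar r t + f a * (polar r t / (q + polar r t - a))).
  - intros t _. unfold g. destruct excluded_middle_informative as [E|E]; [exfalso; exact (Hne t E)|].
    field. apply Cminus_ne, E.
  - apply is_CInt_plus; [|apply is_CInt_scal, K]. apply is_CInt_circ; [|lra].
    intros z Hz. apply Cg. lra.
Qed.

(** Differentiation in a raises k by one: up to the factor 2 pi, k = 1 represents f and k = 2 its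
    derivative. *)
Definition cauchy_transform (phi : R -> C) (q : C) (r : R) (k : nat) (a : C) : C :=
  CInt (fun t => phi t / (q + polar r t - a) ^ k) (- PI)%R PI.

Lemma is_CInt_cauchy_transform (phi : R -> C) (q : C) (r : R) (k : nat) (a : C) :
  (forall t, rcont phi t) -> (Cmod (a - q) < r)%R ->
  is_CInt (fun t => phi t / (q + polar r t - a) ^ k) (- PI)%R PI (cauchy_transform phi q r k a).
Proof.
  intros Hphi Ha. apply is_CInt_cont. intros t _. apply rcont_mult; [apply Hphi|].
  assert (Hne : q + polar r t - a <> 0).
  { apply Cmod_pos_ne. replace (q + polar r t - a) with (polar r t - (a - q)) by ring.
    apply Rlt_le_trans with (2 := Cmod_triangle_rev _ _).
    pose proof (Cmod_ge_0 (a - q)). rewrite Cmod_polar; lra. }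
  apply rcont_inv; [apply Cpow_nz, Hne|].
  apply (rcont_comp (fun z => (z - a) ^ k) (fun t => q + polar r t)).
  - apply ex_cderive_ccont, ex_cderive_pow.
    apply ex_cderive_shift.
  - apply rcont_plus; [apply rcont_const | apply rcont_polar].
Qed.

(** The remainders are h^2 / (u^2 (u - h)) for k = 1 and h^2 (3 u - 2 h) / (u^3 (u - h)^2) for k =
    2. With |u - h| >= m/2 and |3 u - 2 h| <= 4 |u| they are bounded by the two summands, whose sum
    serves both cases. These values of k yield f' and the differentiability of f'. *)
Lemma inv_pow_taylor (k : nat) (u h : C) (m D : R) : (k = 1 \/ k = 2)%nat ->
  (0 < m)%R -> (m <= Cmod u <= D)%R -> (Cmod h <= m / 2)%R ->
  (Cmod (/ (u - h) ^ k - / u ^ k - h * (INR k / u ^ S k))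
     <= Cmod h * Cmod h * (16 / (m * m * m) + 16 / (m * m * m * m)))%R.
Proof.
  intros Hk Hm Hu Hh.
  assert (Hu0 : u <> 0) by (apply Cmod_pos_ne; lra).
  assert (Huh : (m / 2 <= Cmod (u - h))%R).
  { apply Rle_trans with (2 := Cmod_triangle_rev _ _). lra. }
  assert (Huh0 : u - h <> 0) by (apply Cmod_pos_ne; lra).
  pose proof (Cmod_ge_0 h) as Hh0.
  assert (0 < m * m * m)%R by (repeat apply Rmult_lt_0_compat; lra).
  assert (0 < m * m * m * m)%R by (repeat apply Rmult_lt_0_compat; lra).
  assert (P1 : (0 < 16 / (m * m * m))%R) by (apply Rdiv_lt_0_compat; lra).
  assert (P2 : (0 < 16 / (m * m * m * m))%R) by (apply Rdiv_lt_0_compat; lra).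
  destruct Hk as [->| ->].
  - replace (/ (u - h) ^ 1 - / u ^ 1 - h * (INR 1 / u ^ 2)) with (h * h * / (u * u * (u - h))).
    2: { simpl. field. split; assumption. }
    rewrite !Cmod_mult. apply Rmult_le_compat_l; [nra|].
    rewrite Cmod_inv by (repeat apply Cmult_ne; assumption). rewrite !Cmod_mult.
    apply Rle_trans with (16 / (m * m * m))%R; [|lra].
    apply Rle_trans with (/ (m * m * (m / 2)))%R.
    + apply Rinv_le_contravar; [repeat apply Rmult_lt_0_compat; lra|].
      repeat apply Rmult_le_compat; nra.
    + replace (/ (m * m * (m / 2)))%R with (2 / (m * m * m))%R by (field; lra).
      apply Rmult_le_compat_r; [left; apply Rinv_0_lt_compat; lra|lra].
  - replace (/ (u - h) ^ 2 - / u ^ 2 - h * (INR 2 / u ^ 3))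
      with (h * h * ((3 * u - 2 * h) / u * / (u * u * ((u - h) * (u - h))))).
    2: { simpl. rewrite RtoC_plus. field. split; assumption. }
    rewrite !Cmod_mult. apply Rmult_le_compat_l; [nra|].
    rewrite Cmod_div by assumption.
    rewrite Cmod_inv by (repeat apply Cmult_ne; assumption). rewrite !Cmod_mult.
    apply Rle_trans with (16 / (m * m * m * m))%R; [|lra].
    apply Rle_trans with (4 * / (m * m * (m / 2 * (m / 2))))%R.
    + apply Rmult_le_compat.
      * apply Rdiv_le_0_compat; [apply Cmod_ge_0|lra].
      * left. apply Rinv_0_lt_compat. repeat apply Rmult_lt_0_compat; lra.
      * apply Rmult_le_reg_r with (Cmod u); [lra|]. unfold Rdiv. rewrite Rmult_assoc, Rinv_l by lra.
        assert (T := Cmod_triangle_minus (3 * u) (2 * h)). rewrite !Cmod_mult, !Cmod_R in T.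
        rewrite !Rabs_pos_eq in T by lra. lra.
      * apply Rinv_le_contravar; [repeat apply Rmult_lt_0_compat; lra|].
        repeat apply Rmult_le_compat; nra.
    + right. field. lra.
Qed.

(** The Taylor bound is uniform on the circle because a keeps the distance m from it; integrating it
    against |phi| justifies differentiation under the integral. *)
Lemma is_cderive_cauchy_transform (phi : R -> C) (q : C) (r : R) (k : nat) (a : C) :
  (k = 1 \/ k = 2)%nat -> (forall t, rcont phi t) -> (Cmod (a - q) < r)%R ->
  is_cderive (cauchy_transform phi q r k) a (INR k * cauchy_transform phi q r (S k) a)%C.
Proof.
  intros Hk Hphi Ha. apply is_cderive_eps. intros e He.
  set (m := (r - Cmod (a - q))%R). assert (Hm : (0 < m)%R) by (unfold m; lra).
  pose proof (Cmod_ge_0 (a - q)) as Ha0.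
  assert (Hint : ex_RInt (fun t => Cmod (phi t)) (- PI) PI).
  { apply (ex_RInt_continuous (V := R_CompleteNormedModule)). intros t _. apply rcont_Cmod, Hphi. }
  set (A := RInt (fun t => Cmod (phi t)) (- PI) PI).
  assert (HA : is_RInt (fun t => Cmod (phi t)) (- PI) PI A) by (apply (RInt_correct (V := R_CompleteNormedModule)), Hint).
  assert (HA0 : (0 <= A)%R).
  { apply RInt_ge_0; [apply neg_pi_le_pi | exact Hint | intros; apply Cmod_ge_0]. }
  set (K := (16 / (m * m * m) + 16 / (m * m * m * m))%R).
  assert (HK : (0 < K)%R).
  { apply Rplus_lt_0_compat; apply Rdiv_lt_0_compat; try lra; repeat apply Rmult_lt_0_compat; lra. }
  assert (HAK : (0 <= A * K)%R) by nra.
  exists (Rmin (m / 2) (e / (A * K + 1))). split.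
  { apply Rmin_pos; [lra | apply Rdiv_lt_0_compat; lra]. }
  intros w Hw. set (h := w - a) in *.
  assert (Hh1 : (Cmod h < m / 2)%R) by exact (Rlt_Rmin_l Hw).
  assert (Hh2 : (Cmod h < e / (A * K + 1))%R) by exact (Rlt_Rmin_r Hw).
  assert (Hwq : (Cmod (w - q) < r)%R).
  { replace (w - q) with (h + (a - q)) by (unfold h; ring).
    apply Rle_lt_trans with (1 := Cmod_triangle _ _). unfold m in *. lra. }
  assert (I : is_CInt (fun t => (phi t / (q + polar r t - w) ^ k - phi t / (q + polar r t - a) ^ k)
      - (INR k * h) * (phi t / (q + polar r t - a) ^ S k)) (- PI)%R PI
      ((cauchy_transform phi q r k w - cauchy_transform phi q r k a)
       - (INR k * h) * cauchy_transform phi q r (S k) a)%C).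
  { apply is_CInt_minus; [apply is_CInt_minus|apply is_CInt_scal];
      apply is_CInt_cauchy_transform; assumption. }
  replace (_ - INR k * cauchy_transform phi q r (S k) a * h) with
     ((cauchy_transform phi q r k w - cauchy_transform phi q r k a)
       - (INR k * h) * cauchy_transform phi q r (S k) a) by ring.
  assert (B : (Cmod ((cauchy_transform phi q r k w - cauchy_transform phi q r k a)
       - (INR k * h) * cauchy_transform phi q r (S k) a) <= Cmod h * Cmod h * K * A)%R).
  { eapply is_CInt_norm; [apply neg_pi_le_pi | | exact I |
      apply (is_RInt_scal (V := R_NormedModule) (fun t => Cmod (phi t)) (- PI)%R PI (Cmod h * Cmod h * K)%R), HA].
    intros t _. change (scal ?x ?y) with (x * y)%R. cbv beta.
    set (u := q + polar r t - a).
    assert (Hu : (m <= Cmod u <= r + Cmod (a - q))%R).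
    { assert (Cmod (polar r t) = r) by (apply Cmod_polar; lra).
      unfold u. replace (q + polar r t - a) with (polar r t - (a - q)) by ring. split.
      - apply Rle_trans with (2 := Cmod_triangle_rev _ _). unfold m. lra.
      - apply Rle_trans with (1 := Cmod_triangle_minus _ _). lra. }
    assert (Hu0 : u <> 0) by (apply Cmod_pos_ne; lra).
    assert (Huh0 : u - h <> 0).
    { apply Cmod_pos_ne. apply Rlt_le_trans with (2 := Cmod_triangle_rev _ _). lra. }
    replace (q + polar r t - w) with (u - h) by (unfold u, h; ring).
    replace (phi t / (u - h) ^ k - phi t / u ^ k - INR k * h * (phi t / u ^ S k))
      with (phi t * (/ (u - h) ^ k - / u ^ k - h * (INR k / u ^ S k))).
    2: { unfold Cdiv. ring. }
    rewrite Cmod_mult, Rmult_comm. apply Rmult_le_compat_r; [apply Cmod_ge_0|].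
    apply inv_pow_taylor with (D := (r + Cmod (a - q))%R); try assumption. lra. }
  apply Rle_trans with (1 := B).
  apply Rlt_div_mult in Hh2; [|lra].
  pose proof (Cmod_ge_0 h). nra.
Qed.

Section CauchyFormula.

Variables (f : C -> C) (q : C) (R0 : R).
Hypothesis f_cont : forall z, (Cmod (z - q) < R0)%R -> ccont f z.
Hypothesis f_hol : forall z, (Cmod (z - q) < R0)%R -> z <> q -> ex_cderive f z.

Let phi (r t : R) : C := f (q + polar r t) * polar r t.

Lemma rcont_phi (r : R) : (0 < r < R0)%R -> forall t, rcont (phi r) t.
Proof.
  intros Hr t. apply rcont_mult; [|apply rcont_polar]. apply rcont_circle, f_cont.
  replace (q + polar r t - q) with (polar r t) by ring. rewrite Cmod_polar; lra.
Qed.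

Lemma cauchy_transform_ne (a : C) (r : R) : (Cmod (a - q) < r < R0)%R -> a <> q ->
  cauchy_transform (phi r) q r 1 a = (2 * PI)%R * f a.
Proof.
  intros Ha Haq. rewrite <- (cauchy_formula_punctured f q a r R0); try assumption; try lra.
  unfold cauchy_transform. f_equal. apply functional_extensionality. intros t.
  unfold phi. rewrite Cpow_1_r. unfold Cdiv. ring.
Qed.

(** The punctured formula excludes a = q. Both sides are continuous there, so the centre is reached
    from the points q + x. *)
Lemma cauchy_formula (a : C) (r : R) : (Cmod (a - q) < r < R0)%R ->
  cauchy_transform (phi r) q r 1 a = (2 * PI)%R * f a.
Proof.
  intros Ha. destruct (excluded_middle_informative (a = q)) as [->|Haq]; [|apply cauchy_transform_ne; assumption].
  pose proof (Cmod_ge_0 (q - q)).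
  apply Cmod_small_eq. intros e He.
  assert (C1 : ccont (fun z => cauchy_transform (phi r) q r 1 z - (2 * PI)%R * f z) q).
  { apply ccont_minus.
    - eapply is_cderive_ccont, is_cderive_cauchy_transform; [left; reflexivity | apply rcont_phi; lra | lra].
    - apply ccont_mult; [apply ex_cderive_ccont, ex_cderive_const | apply f_cont; lra]. }
  destruct (C1 e He) as [d [Hd1 Hd2]].
  set (x := Rmin (d / 2) (r / 2)). assert (Hx : (0 < x)%R) by (apply Rmin_pos; lra).
  assert (Hx1 : (x <= d / 2)%R) by apply Rmin_l. assert (Hx2 : (x <= r / 2)%R) by apply Rmin_r.
  assert (E : q + x - q = x) by ring.
  assert (Em : Cmod (q + x - q) = x) by (rewrite E, Cmod_R, Rabs_pos_eq; lra).
  specialize (Hd2 (q + x)). rewrite Em in Hd2. specialize (Hd2 ltac:(lra)).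
  rewrite (cauchy_transform_ne (q + x)) in Hd2.
  - replace (_ - _) with (- (cauchy_transform (phi r) q r 1 q - (2 * PI)%R * f q)) in Hd2 by ring.
    rewrite Cmod_opp in Hd2. lra.
  - rewrite Em. lra.
  - intros K. rewrite K in Em. replace (q - q) with (RtoC 0) in Em by ring. rewrite Cmod_0 in Em. lra.
Qed.

Lemma RtoC_2PI_ne : RtoC (2 * PI)%R <> 0.
Proof. pose proof PI_RGT_0. intros E. apply RtoC_inj in E. lra. Qed.

Lemma is_cderive_cauchy (a : C) (r : R) : (Cmod (a - q) < r < R0)%R ->
  is_cderive f a (cauchy_transform (phi r) q r 2 a / (2 * PI)%R)%C.
Proof.
  intros Ha.
  apply is_cderive_local with (f := fun z => / (2 * PI)%R * cauchy_transform (phi r) q r 1 z)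
    (d := (r - Cmod (a - q))%R); [lra | |].
  - intros w Hw. rewrite cauchy_formula; [field; apply RtoC_2PI_ne|].
    replace (w - q) with ((w - a) + (a - q)) by ring. split; [|lra].
    apply Rle_lt_trans with (1 := Cmod_triangle _ _). lra.
  - eapply is_cderive_val.
    + apply is_cderive_mult; [apply is_cderive_const|].
      apply is_cderive_cauchy_transform; [left; reflexivity | apply rcont_phi | lra].
      pose proof (Cmod_ge_0 (a - q)). lra.
    + simpl. field. apply RtoC_2PI_ne.
Qed.

Lemma cauchy_estimate (a : C) (r M : R) : (Cmod (a - q) < r < R0)%R ->
  (forall t, (- PI <= t <= PI)%R -> (Cmod (f (q + polar r t)) <= M)%R) ->
  (Cmod (f a) <= M * (r / (r - Cmod (a - q))))%R.
Proof.
  intros Ha HM. pose proof PI_RGT_0 as HPI. pose proof (Cmod_ge_0 (a - q)) as Ha0.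
  assert (B : (Cmod (cauchy_transform (phi r) q r 1 a) <= (PI - - PI) * (M * (r / (r - Cmod (a - q)))))%R).
  { eapply is_CInt_bound; [apply neg_pi_le_pi | |
      apply is_CInt_cauchy_transform; [apply rcont_phi; lra | lra]].
    intros t Ht. cbv beta. unfold phi. rewrite Cpow_1_r.
    assert (Hp : Cmod (polar r t) = r) by (apply Cmod_polar; lra).
    assert (Hlow : (r - Cmod (a - q) <= Cmod (q + polar r t - a))%R).
    { replace (q + polar r t - a) with (polar r t - (a - q)) by ring.
      apply Rle_trans with (2 := Cmod_triangle_rev _ _). lra. }
    rewrite Cmod_div by (apply Cmod_pos_ne; lra). rewrite Cmod_mult, Hp.
    unfold Rdiv. rewrite Rmult_assoc. apply Rmult_le_compat; try apply Cmod_ge_0.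
    - apply Rmult_le_pos; [lra|]. left. apply Rinv_0_lt_compat. lra.
    - apply HM, Ht.
    - apply Rmult_le_compat_l; [lra|]. apply Rinv_le_contravar; lra. }
  rewrite cauchy_formula, Cmod_mult, Cmod_R, Rabs_pos_eq in B by lra.
  apply Rmult_le_reg_l with (2 * PI)%R; [lra|].
  replace (PI - - PI)%R with (2 * PI)%R in B by ring. exact B.
Qed.

End CauchyFormula.

(** Cauchy's formula holds at the centre too and represents f near q by a Cauchy transform, which is
    differentiable. *)
Lemma removable_singularity (f : C -> C) (q : C) (d : R) : (0 < d)%R -> ccont f q ->
  (forall z, (Cmod (z - q) < d)%R -> z <> q -> ex_cderive f z) -> ex_cderive f q.
Proof.
  intros Hd Hc Hf. eexists. apply (is_cderive_cauchy f q d) with (r := (d / 2)%R).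
  - intros z Hz. destruct (excluded_middle_informative (z = q)) as [->|]; [exact Hc|].
    apply ex_cderive_ccont, Hf; assumption.
  - exact Hf.
  - replace (q - q) with (RtoC 0) by ring. rewrite Cmod_0. lra.
Qed.

Lemma holomorphic_at_C_derive (f : C -> C) (z : C) :
  holomorphic_at f z -> holomorphic_at (C_derive f) z.
Proof.
  rewrite !holomorphic_at_Cmod. intros [d [Hd Hf]].
  set (phi := fun t => f (z + polar (d / 2) t) * polar (d / 2) t).
  assert (Hphi : forall t, rcont phi t).
  { apply (rcont_phi f z d); [|lra]. intros w Hw. apply ex_cderive_ccont, Hf, Hw. }
  assert (Hder : forall a, (Cmod (a - z) < d / 2)%R ->
     C_derive f a = cauchy_transform phi z (d / 2) 2 a / (2 * PI)%R).
  { intros a Ha. apply is_C_derive_unique, (is_cderive_cauchy f z d); [| |lra].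
    - intros w Hw. apply ex_cderive_ccont, Hf, Hw.
    - intros w Hw _. apply Hf, Hw. }
  exists (d / 2)%R. split; [lra|]. intros a Ha.
  apply ex_cderive_local with (f := fun a => cauchy_transform phi z (d / 2) 2 a / (2 * PI)%R)
    (d := (d / 2 - Cmod (a - z))%R); [lra| |].
  - intros w Hw. symmetry. apply Hder. replace (w - z) with ((w - a) + (a - z)) by ring.
    apply Rle_lt_trans with (1 := Cmod_triangle _ _). lra.
  - apply ex_cderive_div; [apply RtoC_2PI_ne | | apply ex_cderive_const].
    eexists. apply is_cderive_cauchy_transform; [right; reflexivity | exact Hphi | exact Ha].
Qed.

(** * Identity theorem and meromorphic functions *)

Lemma circle_bounded (f : C -> C) (q : C) (r : R) : (0 <= r)%R ->
  (forall z, Cmod (z - q) = r -> ccont f z) ->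
  exists M : R, forall t, (- PI <= t <= PI)%R -> (Cmod (f (q + polar r t)%C) <= M)%R.
Proof.
  intros Hr Hf.
  destruct (continuity_ab_maj (fun t => Cmod (f (q + polar r t)%C)) (- PI) PI) as [x [Hx _]].
  - apply neg_pi_le_pi.
  - intros t _. apply continuity_pt_filterlim. apply rcont_Cmod, rcont_circle, Hf.
    replace (q + polar r t - q) with (polar r t) by ring. apply Cmod_polar, Hr.
  - exists (Cmod (f (q + polar r x)%C)). exact Hx.
Qed.

Lemma pow_small (x M e : R) : (0 <= x < 1)%R -> (0 < e)%R -> exists k, (M * x ^ k < e)%R.
Proof.
  intros Hx He.
  assert (Hlim : is_lim_seq (fun n => M * x ^ n)%R 0).
  { replace (Finite 0) with (Rbar_mult M 0) by (simpl; f_equal; ring).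
    apply is_lim_seq_scal_l. apply is_lim_seq_geom. rewrite Rabs_pos_eq; lra. }
  apply is_lim_seq_spec in Hlim. destruct (Hlim (mkposreal e He)) as [n Hn].
  exists n. specialize (Hn n (le_n n)). simpl in Hn. rewrite Rminus_0_r in Hn.
  apply Rle_lt_trans with (2 := Hn), Rle_abs.
Qed.

(* Cauchy's estimate for f / (z - q)^k, which is holomorphic for every k. *)
Lemma identity_disc (f : C -> C) (q : C) (R0 d : R) : (0 < d)%R ->
  (forall z, (Cmod (z - q) < R0)%R -> ex_cderive f z) ->
  (forall z, (Cmod (z - q) < d)%R -> f z = 0) ->
  forall a, (Cmod (a - q) < R0)%R -> f a = 0.
Proof.
  intros Hd Hf H0 a Ha. pose proof (Cmod_ge_0 (a - q)) as Ha0.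
  set (r := ((Cmod (a - q) + R0) / 2)%R). assert (Hr : (Cmod (a - q) < r < R0)%R) by (unfold r; lra).
  destruct (circle_bounded f q r) as [M HM]; [lra | intros z Hz; apply ex_cderive_ccont, Hf; lra |].
  apply Cmod_small_eq. intros e He. replace (f a - 0) with (f a) by ring.
  destruct (pow_small (Cmod (a - q) / r) (M * (r / (r - Cmod (a - q)))) e) as [k Hk]; [|exact He|].
  { split; [apply Rdiv_le_0_compat; lra|]. apply Rmult_lt_reg_r with r; [lra|].
    unfold Rdiv. rewrite Rmult_assoc, Rinv_l; lra. }
  set (g := fun z => f z / (z - q) ^ k).
  assert (Hg : forall z, (Cmod (z - q) < R0)%R -> ex_cderive g z).
  { intros z Hz. destruct (excluded_middle_informative (z = q)) as [->|Hzq].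
    - apply ex_cderive_local with (f := fun _ => RtoC 0) (d := d); [exact Hd| |apply ex_cderive_const].
      intros w Hw. unfold g. rewrite H0 by exact Hw. unfold Cdiv. ring.
    - apply ex_cderive_div; [apply Cpow_nz, Cminus_ne, Hzq | apply Hf, Hz |].
      apply ex_cderive_pow, ex_cderive_shift. }
  destruct (excluded_middle_informative (a = q)) as [->|Haq].
  { rewrite H0, Cmod_0; [lra | apply Cmod_self_lt, Hd]. }
  assert (E := cauchy_estimate g q R0 (fun z Hz => ex_cderive_ccont _ _ (Hg z Hz)) (fun z Hz _ => Hg z Hz)
     a r (M / r ^ k) Hr).
  assert (Haq' : a - q <> 0) by (apply Cminus_ne, Haq).
  assert (Hrk : (0 < r ^ k)%R) by (apply pow_lt; lra).
  replace (f a) with (g a * (a - q) ^ k) by (unfold g; field; apply Cpow_nz, Haq').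
  rewrite Cmod_mult, Cmod_pow.
  left. apply Rle_lt_trans with (2 := Hk). unfold Rdiv at 2. rewrite Rpow_mult_distr, pow_inv.
  replace (M * (r / (r - Cmod (a - q))) * (Cmod (a - q) ^ k * / r ^ k))%R
    with (M / r ^ k * (r / (r - Cmod (a - q))) * Cmod (a - q) ^ k)%R by (unfold Rdiv; ring).
  apply Rmult_le_compat_r; [apply pow_le; lra|]. apply E.
  intros t Ht. unfold g.
  assert (Hp : Cmod (q + polar r t - q) = r).
  { replace (q + polar r t - q) with (polar r t) by ring. apply Cmod_polar; lra. }
  rewrite Cmod_div, Cmod_pow, Hp by (apply Cpow_nz, Cmod_pos_ne; lra).
  apply Rmult_le_compat_r; [left; apply Rinv_0_lt_compat, Hrk | apply HM, Ht].
Qed.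

(** Identities between meromorphic functions are obtained off a point; this is the tool that
    recovers the value at the point itself. *)
Lemma punctured_value (f g : C -> C) (p : C) : ccont f p -> ccont g p ->
  punctured p (fun z => f z = g z) -> f p = g p.
Proof.
  intros Hf Hg H. apply locally'_Cmod in H. destruct H as [d [Hd H]].
  apply Cmod_small_eq. intros e He. assert (He2 : (0 < e / 2)%R) by lra.
  destruct (Hf _ He2) as [d1 [Hd1 H1]]. destruct (Hg _ He2) as [d2 [Hd2 H2]].
  set (x := (Rmin d (Rmin d1 d2) / 2)%R).
  assert (Hx : (0 < x)%R).
  { unfold x. assert (0 < Rmin d (Rmin d1 d2))%R by (repeat apply Rmin_pos; assumption). lra. }
  assert (Hxd : (x < Rmin d (Rmin d1 d2))%R) by (unfold x in *; lra).
  assert (Em : Cmod (p + x - p) = x).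
  { replace (p + x - p) with (RtoC x) by ring. rewrite Cmod_R, Rabs_pos_eq; lra. }
  assert (Hxp : p + x <> p).
  { intros E. rewrite E in Em. replace (p - p) with (RtoC 0) in Em by ring. rewrite Cmod_0 in Em. lra. }
  specialize (H (p + x)). specialize (H1 (p + x)). specialize (H2 (p + x)). rewrite Em in *.
  assert (K := Rmin_l d (Rmin d1 d2)). assert (K' := Rmin_r d (Rmin d1 d2)).
  assert (K1 := Rmin_l d1 d2). assert (K2 := Rmin_r d1 d2).
  specialize (H ltac:(lra) Hxp). specialize (H1 ltac:(lra)). specialize (H2 ltac:(lra)).
  replace (f p - g p) with ((g (p + x) - g p) - (f (p + x) - f p)) by (rewrite H; ring).
  apply Rle_trans with (1 := Cmod_triangle_minus _ _). lra.
Qed.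

(** Differentiability of h at p is exactly continuity of the quotient there, and its singularity is
    then removable. This replaces power series: orders of zeros and poles are lowered one factor at
    a time. *)
Lemma divide_zero (h : C -> C) (p : C) (R0 : R) : (0 < R0)%R ->
  (forall z, (Cmod (z - p) < R0)%R -> ex_cderive h z) -> h p = 0 ->
  exists k : C -> C, (forall z, (Cmod (z - p) < R0)%R -> ex_cderive k z) /\ forall z, h z = (z - p) * k z.
Proof.
  intros HR Hh H0.
  destruct (Hh p (Cmod_self_lt p R0 HR)) as [l Hl].
  set (k := fun z => if excluded_middle_informative (z = p) then (l : C) else h z / (z - p)).
  assert (Hk : forall z, h z = (z - p) * k z).
  { intros z. unfold k. destruct excluded_middle_informative as [->|E]; [rewrite H0; ring|].
    field. apply Cminus_ne, E. }
  assert (D : forall z, (Cmod (z - p) < R0)%R -> z <> p -> ex_cderive k z).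
  { intros z Hz Hzp. apply ex_cderive_local with (f := fun z => h z / (z - p)) (d := Cmod (z - p)).
    - apply Cmod_gt_0, Cminus_ne, Hzp.
    - intros w Hw. unfold k. destruct excluded_middle_informative as [->|E]; [|reflexivity].
      exfalso. rewrite Cmod_minus_sym in Hw. lra.
    - apply ex_cderive_div; [apply Cminus_ne, Hzp | apply Hh, Hz |].
      apply ex_cderive_shift. }
  exists k. split; [|exact Hk]. intros z Hz.
  destruct (excluded_middle_informative (z = p)) as [->|Hzp]; [|apply D; assumption].
  apply removable_singularity with (d := R0); [exact HR | | exact D].
  intros e He. rewrite is_cderive_eps in Hl. destruct (Hl (e / 2)%R) as [d [Hd1 Hd2]]; [lra|].
  exists d. split; [exact Hd1|]. intros w Hw. unfold k.
  destruct (excluded_middle_informative (p = p)) as [_|]; [|congruence].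
  destruct excluded_middle_informative as [E|E]; [apply Cmod_self_lt, He|].
  assert (Hwa : w - p <> 0) by (apply Cminus_ne, E).
  replace (h w / (w - p) - l) with ((h w - h p - l * (w - p)) / (w - p)) by (rewrite H0; field; exact Hwa).
  rewrite Cmod_div by exact Hwa. assert (0 < Cmod (w - p))%R by (apply Cmod_gt_0, Hwa).
  apply Rmult_lt_reg_r with (Cmod (w - p)); [assumption|].
  unfold Rdiv. rewrite Rmult_assoc, Rinv_l by lra. specialize (Hd2 w Hw). nra.
Qed.

(** Cauchy's estimate for the entire function (f z - f 0) / z, which is at most 2 M / r on the
    circle of radius r. *)
Lemma liouville (f : C -> C) (M : R) : (forall z, ex_cderive f z) ->
  (forall z, (Cmod (f z) <= M)%R) -> forall a, f a = f 0.
Proof.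
  intros Hf HM a.
  apply Cmod_small_eq. intros e He.
  assert (HM0 : (0 <= M)%R) by (apply Rle_trans with (2 := HM 0), Cmod_ge_0).
  pose proof (Cmod_ge_0 a) as Ha.
  (* Chosen so that 2 M |a| / (r - |a|) <= e. *)
  set (r := (Cmod a + 1 + 2 * M * Cmod a / e)%R).
  assert (0 <= 2 * M * Cmod a / e)%R by (apply Rdiv_le_0_compat; [apply Rmult_le_pos; lra|exact He]).
  destruct (divide_zero (fun z => f z - f 0) 0 (r + 1)) as [k [Hk Ek]].
  { unfold r. lra. }
  { intros z _. apply ex_cderive_minus; [apply Hf | apply ex_cderive_const]. }
  { ring. }
  assert (E0 : forall z, z - 0 = z) by (intros; ring).
  rewrite Ek, E0, Cmod_mult.
  assert (B := cauchy_estimate k 0 (r + 1) (fun z Hz => ex_cderive_ccont _ _ (Hk z Hz)) (fun z Hz _ => Hk z Hz)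
    a r (2 * M / r)).
  rewrite E0 in B. specialize (B ltac:(unfold r; lra)).
  assert (Hr : (0 < r)%R) by (unfold r; lra).
  apply Rle_trans with (Cmod a * (2 * M / r * (r / (r - Cmod a))))%R.
  - apply Rmult_le_compat_l; [exact Ha|]. apply B. intros t _.
    assert (Hp : Cmod (0 + polar r t) = r) by (rewrite Cplus_0_l; apply Cmod_polar; lra).
    apply Rmult_le_reg_r with r; [lra|].
    replace (Cmod (k (0 + polar r t)%C) * r)%R with (Cmod (f (0 + polar r t) - f 0)).
    + apply Rle_trans with (1 := Cmod_triangle_minus _ _).
      replace (2 * M / r * r)%R with (2 * M)%R by (field; lra).
      pose proof (HM (0 + polar r t)). pose proof (HM 0). lra.
    + rewrite Ek, E0, Cmod_mult, Hp. ring.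
  - replace (Cmod a * (2 * M / r * (r / (r - Cmod a))))%R with (2 * M * Cmod a / (r - Cmod a))%R
      by (field; unfold r; lra).
    apply Rmult_le_reg_r with (r - Cmod a)%R; [unfold r; lra|].
    unfold Rdiv at 1. rewrite Rmult_assoc, Rinv_l by (unfold r; lra).
    replace (r - Cmod a)%R with (1 + 2 * M * Cmod a / e)%R by (unfold r; ring).
    rewrite Rmult_plus_distr_l. replace (e * (2 * M * Cmod a / e))%R with (2 * M * Cmod a)%R by (field; lra).
    lra.
Qed.

(* Unlike [meromorphic], this does not constrain the value at [p], and [h] may
   vanish at [p]. *)
Definition mero_at (f : C -> C) (p : C) : Prop :=
  exists (m : nat) (h : C -> C), holomorphic_at h p /\
    punctured p (fun z => f z = h z / (z - p) ^ m).

Lemma mero_at_form (f : C -> C) (p : C) : mero_at f p <->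
  exists (m : nat) (h : C -> C) (d : R), (0 < d)%R /\
    (forall z, (Cmod (z - p) < d)%R -> ex_cderive h z) /\
    forall z, (Cmod (z - p) < d)%R -> z <> p -> f z = h z / (z - p) ^ m.
Proof.
  split.
  - intros (m & h & H1 & H2). apply holomorphic_at_Cmod in H1. apply locally'_Cmod in H2.
    destruct H1 as [d1 [Hd1 H1]]. destruct H2 as [d2 [Hd2 H2]].
    exists m, h, (Rmin d1 d2). split; [apply Rmin_pos; assumption|]. split; intros z Hz.
    + apply H1, (Rlt_Rmin_l Hz).
    + apply H2, (Rlt_Rmin_r Hz).
  - intros (m & h & d & Hd & H1 & H2). exists m, h. split.
    + apply holomorphic_at_Cmod. exists d. split; assumption.
    + apply locally'_Cmod. exists d. split; assumption.
Qed.

Lemma mero_at_ext (f g : C -> C) (p : C) :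
  punctured p (fun z => f z = g z) -> mero_at f p -> mero_at g p.
Proof.
  intros H. apply locally'_Cmod in H. destruct H as [d1 [Hd1 E]].
  rewrite !mero_at_form. intros (m & h & d & Hd & H1 & H2).
  exists m, h, (Rmin d1 d). split; [apply Rmin_pos; assumption|]. split; intros z Hz.
  - apply H1, (Rlt_Rmin_r Hz).
  - intros Hzp. rewrite <- E; [|apply (Rlt_Rmin_l Hz)|exact Hzp].
    apply H2; [apply (Rlt_Rmin_r Hz)|exact Hzp].
Qed.

Lemma holomorphic_mero_at (f : C -> C) (p : C) : holomorphic_at f p -> mero_at f p.
Proof.
  rewrite holomorphic_at_Cmod, mero_at_form. intros [d [Hd H]].
  exists O, f, d. split; [exact Hd|]. split; [exact H|]. intros z _ _. simpl. field.
Qed.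

Lemma meromorphic_mero_at (f : C -> C) : meromorphic f -> forall p, mero_at f p.
Proof.
  intros H p. destruct (H p) as [K|(m & h & _ & K1 & _ & K2)].
  - apply holomorphic_mero_at, K.
  - exists m, h. split; assumption.
Qed.

Lemma mero_at_mult (f g : C -> C) (p : C) :
  mero_at f p -> mero_at g p -> mero_at (fun z => f z * g z) p.
Proof.
  rewrite !mero_at_form. intros (m & h & d & Hd & H1 & H2) (m' & h' & d' & Hd' & H1' & H2').
  exists (m + m')%nat, (fun z => h z * h' z), (Rmin d d'). split; [apply Rmin_pos; assumption|].
  split; intros z Hz; assert (K := Rlt_Rmin_l Hz); assert (K' := Rlt_Rmin_r Hz).
  - apply ex_cderive_mult; auto.
  - intros Hzp. rewrite H2, H2' by assumption. rewrite Cpow_add_r. field.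
    split; apply Cpow_nz, Cminus_ne, Hzp.
Qed.

Lemma mero_at_plus (f g : C -> C) (p : C) :
  mero_at f p -> mero_at g p -> mero_at (fun z => f z + g z) p.
Proof.
  rewrite !mero_at_form. intros (m & h & d & Hd & H1 & H2) (m' & h' & d' & Hd' & H1' & H2').
  assert (P : forall n z, ex_cderive (fun z => (z - p) ^ n) z).
  { intros n z. apply ex_cderive_pow, ex_cderive_shift. }
  exists (m + m')%nat, (fun z => h z * (z - p) ^ m' + h' z * (z - p) ^ m), (Rmin d d').
  split; [apply Rmin_pos; assumption|].
  split; intros z Hz; assert (K := Rlt_Rmin_l Hz); assert (K' := Rlt_Rmin_r Hz).
  - apply ex_cderive_plus; apply ex_cderive_mult; auto.
  - intros Hzp. rewrite H2, H2' by assumption. rewrite Cpow_add_r. field.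
    split; apply Cpow_nz, Cminus_ne, Hzp.
Qed.

Lemma mero_at_const (c p : C) : mero_at (fun _ => c) p.
Proof.
  apply holomorphic_mero_at, holomorphic_at_Cmod. exists 1%R. split; [lra|].
  intros; apply ex_cderive_const.
Qed.

Lemma mero_at_minus (f g : C -> C) (p : C) :
  mero_at f p -> mero_at g p -> mero_at (fun z => f z - g z) p.
Proof.
  intros Hf Hg. apply mero_at_ext with (fun z => f z + (- (1)) * g z).
  - apply locally'_Cmod. exists 1%R. split; [lra|]. intros; ring.
  - apply mero_at_plus; [exact Hf|]. apply mero_at_mult; [apply mero_at_const | exact Hg].
Qed.

(** A factor of modulus 1 keeps the radius d; the applications are the reflection 1 - z and the
    translation z + 1. *)
Lemma mero_at_affine (f : C -> C) (a b p : C) : Cmod a = 1%R ->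
  mero_at f (a * p + b) -> mero_at (fun z => f (a * z + b)) p.
Proof.
  intros Ha. assert (Ha0 : a <> 0) by (apply Cmod_pos_ne; lra).
  assert (E : forall z, a * z + b - (a * p + b) = a * (z - p)) by (intros; ring).
  rewrite !mero_at_form. intros (m & h & d & Hd & H1 & H2).
  exists m, (fun z => h (a * z + b) / a ^ m), d. split; [exact Hd|]. split; intros z Hz.
  - apply ex_cderive_div; [apply Cpow_nz, Ha0 | | apply ex_cderive_const].
    apply ex_cderive_comp.
    + apply H1. rewrite E, Cmod_mult, Ha. lra.
    + apply ex_cderive_plus; [|apply ex_cderive_const].
      apply ex_cderive_mult; [apply ex_cderive_const | apply ex_cderive_id].
  - intros Hzp. rewrite H2.
    + rewrite E, Cpow_mult_l. field. split; apply Cpow_nz; [exact Ha0 | apply Cminus_ne, Hzp].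
    + rewrite E, Cmod_mult, Ha. lra.
    + intros K. apply (Cmult_ne a (z - p)); [exact Ha0 | apply Cminus_ne, Hzp|].
      rewrite <- E, K. ring.
Qed.

Lemma is_cderive_inv_pow (p : C) (m : nat) (z : C) : z <> p ->
  is_cderive (fun z => / (z - p) ^ m) z (- INR m / (z - p) ^ S m)%C.
Proof.
  intros Hz. assert (Hzp : z - p <> 0) by (apply Cminus_ne, Hz).
  assert (L : is_cderive (fun z => z - p) z (RtoC 1 - RtoC 0)%C)
    by (apply is_cderive_minus; [apply is_cderive_id | apply is_cderive_const]).
  induction m as [|m IH].
  - eapply is_cderive_val; [apply is_cderive_inv; [apply Cpow_nz, Hzp | apply (is_cderive_const 1)]|].
    simpl. field. exact Hzp.
  - apply is_cderive_local with (f := fun z => / (z - p) * / (z - p) ^ m) (d := Cmod (z - p)).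
    + apply Cmod_gt_0, Hzp.
    + intros w Hw. assert (w - p <> 0).
      { apply Cminus_ne. intros ->. rewrite Cmod_minus_sym in Hw. lra. }
      simpl. field. split; [apply Cpow_nz|]; assumption.
    + eapply is_cderive_val; [apply is_cderive_mult; [apply is_cderive_inv; [exact Hzp | exact L] | exact IH]|].
      rewrite S_INR, RtoC_plus. simpl. field. split; [apply Cpow_nz|]; exact Hzp.
Qed.

Lemma punctured_ball (p z : C) (d : R) : (Cmod (z - p) < d)%R -> z <> p ->
  exists d', (0 < d')%R /\ forall w, (Cmod (w - z) < d')%R -> (Cmod (w - p) < d)%R /\ w <> p.
Proof.
  intros Hz Hzp. assert (0 < Cmod (z - p))%R by (apply Cmod_gt_0, Cminus_ne, Hzp).
  exists (Rmin (Cmod (z - p)) (d - Cmod (z - p))). split; [apply Rmin_pos; lra|].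
  intros w Hw.
  assert (K := Rlt_Rmin_l Hw). assert (K' := Rlt_Rmin_r Hw).
  split.
  - apply Rle_lt_trans with (1 := Cmod_triangle3 w z p). lra.
  - intros ->. rewrite Cmod_minus_sym in K. lra.
Qed.

Lemma mero_at_C_derive (f : C -> C) (p : C) : mero_at f p -> mero_at (C_derive f) p.
Proof.
  rewrite !mero_at_form. intros (m & h & d & Hd & H1 & H2).
  exists (S m), (fun z => C_derive h z * (z - p) - INR m * h z), d. split; [exact Hd|].
  split; intros z Hz.
  - apply ex_cderive_minus; apply ex_cderive_mult;
      [ | apply ex_cderive_shift | exact (ex_cderive_const (INR m) z) | apply H1, Hz].
    apply holomorphic_at_ex, holomorphic_at_C_derive, holomorphic_at_Cmod.
    exists (d - Cmod (z - p))%R. split; [lra|]. intros w Hw. apply H1.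
    apply Rle_lt_trans with (1 := Cmod_triangle3 w z p). lra.
  - intros Hzp. apply is_C_derive_unique.
    destruct (punctured_ball p z d Hz Hzp) as [d' [Hd' K]].
    apply is_cderive_local with (f := fun z => h z * / (z - p) ^ m) (d := d'); [exact Hd'| |].
    + intros w Hw. symmetry. apply H2; apply K, Hw.
    + eapply is_cderive_val.
      * apply is_cderive_mult; [apply C_derive_is, H1, Hz | apply is_cderive_inv_pow, Hzp].
      * simpl. field. split; [apply Cpow_nz|]; apply Cminus_ne, Hzp.
Qed.

Notation vanishes_near f := (fun p => punctured p (fun z => f z = RtoC 0)).

(* The supremum of the points on the horizontal line near which f is not zero
   would be an isolated singularity adjacent to a zero set. *)
Lemma identity_mero (f : C -> C) (sigma : R) : (forall p, mero_at f p) ->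
  (forall s, (sigma < Re s)%R -> vanishes_near f s) -> forall s, vanishes_near f s.
Proof.
  intros Hm H0 [x0 y0].
  destruct (excluded_middle_informative (vanishes_near f (x0, y0))) as [K|K]; [exact K|exfalso].
  set (N := fun x => ~ vanishes_near f (x, y0)).
  destruct (completeness N) as [x [Hub Hlub]].
  - exists sigma. intros u Hu. apply Rnot_lt_le. intros Hlt. apply Hu, H0. exact Hlt.
  - exists x0. exact K.
  - assert (Hright : forall u, (x < u)%R -> vanishes_near f (u, y0)).
    { intros u Hu. destruct (excluded_middle_informative (vanishes_near f (u, y0))) as [L|L]; [exact L|].
      specialize (Hub u L). lra. }
    assert (Hx : vanishes_near f (x, y0)).
    { destruct (proj1 (mero_at_form _ _) (Hm (x, y0))) as (m & h & d & Hd & H1 & H2).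
      (* The disc of radius 2d/3 around q lies in the disc of radius d around the supremum point and
         contains the one of radius d/3; f vanishes near q because q lies to the right of the
         supremum. *)
      set (q := ((x + d / 3)%R, y0) : C).
      assert (Hqp : q - (x, y0) = (d / 3)%R) by (apply C_ext; simpl; ring).
      assert (Hqp' : Cmod (q - (x, y0)) = (d / 3)%R) by (rewrite Hqp, Cmod_R, Rabs_pos_eq; lra).
      assert (Hqne : q <> (x, y0)).
      { intros E. rewrite E in Hqp'. replace ((x, y0) - (x, y0)) with (RtoC 0) in Hqp' by ring.
        rewrite Cmod_0 in Hqp'. lra. }
      assert (Hin : forall z, (Cmod (z - q) < 2 * d / 3)%R -> (Cmod (z - (x, y0)) < d)%R).
      { intros z Hz. apply Rle_lt_trans with (1 := Cmod_triangle3 z q (x, y0)). lra. }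
      assert (Hh0 : exists d1, (0 < d1)%R /\ forall z, (Cmod (z - q) < d1)%R -> z <> q -> h z = 0).
      { destruct (proj1 (locally'_Cmod _ _) (Hright (x + d / 3)%R ltac:(lra))) as [d0 [Hd0 Z]]. fold q in Z.
        destruct (punctured_ball (x, y0) q d ltac:(lra) Hqne) as [d2 [Hd2 P]].
        exists (Rmin d0 d2). split; [apply Rmin_pos; assumption|]. intros z Hz Hzq.
        destruct (P z (Rlt_Rmin_r Hz)) as [P1 P2].
        assert (Hzp : (z - (x, y0)) ^ m <> 0) by apply Cpow_nz, Cminus_ne, P2.
        replace (h z) with (h z / (z - (x, y0)) ^ m * (z - (x, y0)) ^ m) by (field; exact Hzp).
        rewrite <- H2 by assumption. rewrite Z; [ring | apply (Rlt_Rmin_l Hz) | exact Hzq]. }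
      destruct Hh0 as [d1 [Hd1 Hh0]].
      assert (Hhq : h q = 0).
      { apply (punctured_value h (fun _ => RtoC 0)).
        - apply ex_cderive_ccont, H1. lra.
        - apply ex_cderive_ccont, ex_cderive_const.
        - apply locally'_Cmod. exists d1. split; assumption. }
      assert (Hh : forall z, (Cmod (z - q) < 2 * d / 3)%R -> h z = 0).
      { apply (identity_disc h q (2 * d / 3) d1 Hd1).
        - intros z Hz. apply H1, Hin, Hz.
        - intros z Hz. destruct (excluded_middle_informative (z = q)) as [->|]; [exact Hhq | apply Hh0; assumption]. }
      apply locally'_Cmod. exists (d / 3)%R. split; [lra|]. intros z Hz Hzp.
      rewrite H2; [|lra|exact Hzp]. rewrite Hh; [unfold Cdiv; ring|].
      apply Rle_lt_trans with (1 := Cmod_triangle3 z (x, y0) q). rewrite (Cmod_minus_sym (x, y0) q). lra. }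
    apply locally'_Cmod in Hx. destruct Hx as [d [Hd Hx]].
    (* f also vanishes near the points just left of x, so x - d/2 would be a smaller upper bound. *)
    assert (x <= x - d / 2)%R; [|lra].
    apply Hlub. intros u Hu. apply Rnot_lt_le. intros Hlt.
    assert (Hux := Hub u Hu).
    apply Hu. destruct (Req_dec u x) as [->|Hne]; [apply locally'_Cmod; exists d; split; assumption|].
    assert (Em : Cmod ((u, y0) - (x, y0)) = (x - u)%R).
    { replace ((u, y0) - (x, y0)) with (RtoC (u - x)%R) by (apply C_ext; simpl; ring).
      rewrite Cmod_R, Rabs_minus_sym, Rabs_pos_eq; lra. }
    destruct (punctured_ball (x, y0) (u, y0) d) as [d' [Hd' P]]; [lra | intros E; injection E; lra |].
    apply locally'_Cmod. exists d'. split; [exact Hd'|]. intros w Hw _. apply Hx; apply P, Hw.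
Qed.

(** A factor z - p is cancelled as long as h vanishes at p. Either the exponent reaches 0 and h
    extends f, or h p <> 0 and the pole is genuine. *)
Lemma mero_normal_form (f : C -> C) (p : C) : mero_at f p ->
  (exists g, holomorphic_at g p /\ punctured p (fun z => f z = g z)) \/ pole_at f p.
Proof.
  intros H. apply mero_at_form in H. destruct H as (m & h & d & Hd & H1 & H2).
  revert h H1 H2. induction m as [|m IH]; intros h H1 H2.
  - left. exists h. split; [apply holomorphic_at_Cmod; exists d; split; assumption|].
    apply locally'_Cmod. exists d. split; [exact Hd|]. intros z Hz Hzp. rewrite H2 by assumption. simpl. field.
  - destruct (excluded_middle_informative (h p = 0)) as [E|E].
    + destruct (divide_zero h p d Hd H1 E) as [k [Hk Ek]].
      apply (IH k Hk). intros z Hz Hzp. rewrite H2 by assumption. rewrite Ek. simpl. field.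
      split; [apply Cpow_nz|]; apply Cminus_ne, Hzp.
    + right. exists (S m), h. split; [lia|]. split; [apply holomorphic_at_Cmod; exists d; split; assumption|].
      split; [exact E|]. apply locally'_Cmod. exists d. split; assumption.
Qed.

(** [meromorphic] prescribes the values at removable singularities, [mero_at] does not. F takes the
    limit along the punctured neighbourhood wherever there is one; this limit is unique, so F keeps
    the values of f at points of continuity. *)
Lemma meromorphic_regularization (f : C -> C) : (forall p, mero_at f p) ->
  exists F, meromorphic F /\ forall s, ccont f s -> F s = f s.
Proof.
  intros Hm.
  set (plim := fun s c => exists g, ccont g s /\ g s = c /\
      punctured s (fun z => f z = g z)).
  set (F := fun s => epsilon (inhabits (RtoC 0)) (plim s)).
  assert (HF : forall s g, ccont g s -> punctured s (fun z => f z = g z) -> F s = g s).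
  { intros s g Hg E.
    destruct (epsilon_spec (inhabits (RtoC 0)) (plim s)) as [g' (H1 & H2 & H3)].
    { exists (g s), g. repeat split; assumption. }
    unfold F. rewrite <- H2. apply punctured_value; try assumption.
    apply locally'_Cmod in E. apply locally'_Cmod in H3. apply locally'_Cmod.
    destruct E as [d [Hd E]]. destruct H3 as [d' [Hd' E']].
    exists (Rmin d d'). split; [apply Rmin_pos; assumption|]. intros w Hw Hws.
    rewrite <- E, <- E'; try assumption; try reflexivity.
    - apply (Rlt_Rmin_r Hw).
    - apply (Rlt_Rmin_l Hw). }
  assert (HFf : forall s, ccont f s -> F s = f s).
  { intros s Hs. apply HF; [exact Hs|]. apply locally'_Cmod. exists 1%R. split; [lra|reflexivity]. }
  exists F. split; [|exact HFf].
  intros p. destruct (mero_normal_form f p (Hm p)) as [[g [Hg E]]|(m & h & Hm0 & Hh & Hhp & E)].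
  - left. apply holomorphic_at_Cmod in Hg. apply locally'_Cmod in E.
    destruct Hg as [d [Hd Hg]]. destruct E as [d' [Hd' E]].
    assert (FG : forall z, (Cmod (z - p) < Rmin d d')%R -> F z = g z).
    { intros z Hz. assert (Hz1 := Rlt_Rmin_l Hz).
      assert (Hz2 := Rlt_Rmin_r Hz).
      apply HF; [apply ex_cderive_ccont, Hg, Hz1|].
      destruct (excluded_middle_informative (z = p)) as [->|Hzp].
      - apply locally'_Cmod. exists d'. split; assumption.
      - destruct (punctured_ball p z d' Hz2 Hzp) as [d2 [Hd2 P]].
        apply locally'_Cmod. exists d2. split; [exact Hd2|]. intros w Hw _. apply E; apply P, Hw. }
    apply holomorphic_at_Cmod. exists (Rmin d d'). split; [apply Rmin_pos; assumption|].
    intros z Hz. apply ex_cderive_local with (f := g) (d := (Rmin d d' - Cmod (z - p))%R); [lra| |].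
    + intros w Hw. symmetry. apply FG. apply Rle_lt_trans with (1 := Cmod_triangle3 w z p). lra.
    + apply Hg. apply (Rlt_Rmin_l Hz).
  - right. exists m, h. repeat split; try assumption.
    apply locally'_Cmod in E. apply holomorphic_at_Cmod in Hh. apply locally'_Cmod.
    destruct Hh as [d [Hd Hh]]. destruct E as [d' [Hd' E]].
    exists (Rmin d d'). split; [apply Rmin_pos; assumption|]. intros z Hz Hzp.
    assert (Hz1 := Rlt_Rmin_l Hz).
    assert (Hz2 := Rlt_Rmin_r Hz).
    rewrite <- E by assumption. apply HFf.
    destruct (punctured_ball p z d' Hz2 Hzp) as [d2 [Hd2 P]].
    apply ccont_local with (f := fun z => h z / (z - p) ^ m) (d := d2); [exact Hd2| |].
    + intros w Hw. symmetry. apply E; apply P, Hw.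
    + apply ex_cderive_ccont, ex_cderive_div; [apply Cpow_nz, Cminus_ne, Hzp | apply Hh, Hz1|].
      apply ex_cderive_pow, ex_cderive_shift.
Qed.

(** At a pole h would coincide off p with g (z - p)^m, where m > 0, and continuity would give h p =
    0. *)
Lemma meromorphic_no_pole (f g : C -> C) (p : C) : meromorphic f -> ccont g p ->
  punctured p (fun z => f z = g z) -> holomorphic_at f p.
Proof.
  intros Hf Hg E. destruct (Hf p) as [K|(m & h & Hm & Hh & Hhp & K)]; [exact K|exfalso].
  apply Hhp.
  assert (H : h p = (fun z => g z * (z - p) ^ m) p).
  { apply (punctured_value h (fun z => g z * (z - p) ^ m)).
    - apply ex_cderive_ccont, holomorphic_at_ex, Hh.
    - apply ccont_mult; [exact Hg|]. apply ex_cderive_ccont.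
      apply ex_cderive_pow, ex_cderive_shift.
    - apply locally'_Cmod in E. apply locally'_Cmod in K. apply locally'_Cmod.
      destruct E as [d [Hd E]]. destruct K as [d' [Hd' K]].
      exists (Rmin d d'). split; [apply Rmin_pos; assumption|]. intros w Hw Hwp.
      rewrite <- E, K; try assumption.
      + field. apply Cpow_nz, Cminus_ne, Hwp.
      + apply (Rlt_Rmin_r Hw).
      + apply (Rlt_Rmin_l Hw). }
  rewrite H. simpl. destruct m as [|m]; [lia|]. simpl. ring.
Qed.

(** * Improper integrals *)

Notation is_CInt_gen := (is_RInt_gen (V := C_R_NormedModule)).
Notation CInt_gen := (RInt_gen (V := C_R_CompleteNormedModule)).
Notation infty := (Rbar_locally p_infty).

Lemma is_CInt_gen_scal (Fa Fb : (R -> Prop) -> Prop) {FFa : Filter Fa} {FFb : Filter Fb}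
  (c : C) (f : R -> C) (l : C) :
  is_CInt_gen f Fa Fb l -> is_CInt_gen (fun t => c * f t) Fa Fb (c * l)%C.
Proof.
  intros H P HP. apply locally_Cmod in HP. destruct HP as [e [He HP]].
  assert (HQ : locally (T := C_UniformSpace) l (fun y => P (c * y))).
  { apply locally_Cmod. pose proof (Cmod_ge_0 c). exists (e / (Cmod c + 1))%R.
    split; [apply Rdiv_lt_0_compat; lra|]. intros w Hw. apply HP.
    replace (c * w - c * l) with (c * (w - l)) by ring. rewrite Cmod_mult.
    apply Rlt_div_mult in Hw; [|lra].
    pose proof (Cmod_ge_0 (w - l)). nra. }
  specialize (H _ HQ). unfold filtermapi in *.
  revert H. apply filter_imp. intros [a b] [y [H1 H2]]. exists (c * y).
  split; [apply is_CInt_scal, H1 | exact H2].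
Qed.

Lemma is_CInt_gen_ext (Fa Fb : (R -> Prop) -> Prop) {FFa : Filter Fa} {FFb : Filter Fb}
  (f g : R -> C) (l : C) :
  (forall t, (0 < t)%R -> f t = g t) -> Fa (fun a => 0 < a)%R -> Fb (fun b => 0 < b)%R ->
  is_CInt_gen f Fa Fb l -> is_CInt_gen g Fa Fb l.
Proof.
  intros E Ha Hb. apply (is_RInt_gen_ext (V := C_R_NormedModule)).
  apply (Filter_prod _ _ _ (fun a => 0 < a)%R (fun b => 0 < b)%R Ha Hb).
  intros a b H1 H2 t Ht. apply E. apply Rle_lt_trans with (2 := proj1 Ht). simpl.
  left. apply Rmin_pos; assumption.
Qed.

Lemma CInt_gen_unique (Fa Fb : (R -> Prop) -> Prop) {FFa : ProperFilter Fa} {FFb : ProperFilter Fb}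
  (f : R -> C) (l : C) : is_CInt_gen f Fa Fb l -> CInt_gen f Fa Fb = l.
Proof. apply (is_RInt_gen_unique (V := C_R_CompleteNormedModule)). Qed.

Lemma at_right_pos : at_right 0 (fun a => 0 < a)%R.
Proof. exists (mkposreal 1 Rlt_0_1). intros y _ Hy. exact Hy. Qed.

Lemma infty_gt (x : R) : infty (fun b => x < b)%R.
Proof. exists x. intros y Hy; exact Hy. Qed.

(* t^(g-1) (1+t)^(-g-1): an integrable majorant with the elementary primitive
   (t/(1+t))^g / g. *)
Definition dom (g t : R) : R := exp ((g - 1) * ln t - (g + 1) * ln (1 + t)).
Definition dom_prim (g t : R) : R := (/ g * exp (g * (ln t - ln (1 + t))))%R.

Lemma dom_pos (g t : R) : (0 < dom g t)%R.
Proof. apply exp_pos. Qed.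

Lemma is_derive_dom_prim (g t : R) : (0 < g)%R -> (0 < t)%R -> is_derive (dom_prim g) t (dom g t).
Proof.
  intros Hg Ht. unfold dom_prim. auto_derive; [repeat split; lra|].
  unfold dom. replace ((g - 1) * ln t - (g + 1) * ln (1 + t))%R
    with (g * (ln t + - ln (1 + t)) + (- ln t + - ln (1 + t)))%R by ring.
  rewrite (exp_plus (g * _)), (exp_plus (- ln t)), !exp_Ropp, !exp_ln by lra.
  field. repeat split; lra.
Qed.

Lemma continuous_dom (g t : R) : (0 < t)%R -> continuous (dom g) t.
Proof.
  intros Ht. apply ex_derive_Rcontinuous. unfold dom. auto_derive. lra.
Qed.

Lemma dom_prim_bounds (g t : R) : (0 < g)%R -> (0 < t)%R -> (0 < dom_prim g t <= / g)%R.
Proof.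
  intros Hg Ht. unfold dom_prim. assert (0 < / g)%R by (apply Rinv_0_lt_compat; lra).
  split; [apply Rmult_lt_0_compat; [assumption|apply exp_pos]|].
  rewrite <- (Rmult_1_r (/ g)) at 2. apply Rmult_le_compat_l; [lra|].
  apply Rle_trans with (exp 0); [apply exp_le_mono | rewrite exp_0; lra].
  assert (ln t <= ln (1 + t))%R by (apply ln_le_mono; lra). nra.
Qed.

Lemma is_RInt_dom (g a b : R) : (0 < g)%R -> (0 < a)%R -> (0 < b)%R ->
  is_RInt (dom g) a b (dom_prim g b - dom_prim g a)%R.
Proof.
  intros Hg Ha Hb.
  assert (P : forall x, (Rmin a b <= x <= Rmax a b)%R -> (0 < x)%R).
  { intros x Hx. apply Rlt_le_trans with (2 := proj1 Hx). apply Rmin_pos; assumption. }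
  apply (is_RInt_derive (V := R_CompleteNormedModule) (dom_prim g)).
  - intros x Hx. apply is_derive_dom_prim; auto.
  - intros x Hx. apply continuous_dom; auto.
Qed.

(* The two kinds of lower end of a Mellin integral: 0 and a positive cut-off. *)
Definition lower_end (a0 : R) (Fa : (R -> Prop) -> Prop) : Prop :=
  (0 <= a0)%R /\ ProperFilter Fa /\ Fa (fun a => a0 < a)%R /\
  forall g, (0 < g)%R -> exists A : R, forall e, (0 < e)%R -> Fa (fun a => Rabs (dom_prim g a - A) < e)%R.

Lemma lower_end_zero : lower_end 0 (at_right 0).
Proof.
  split; [lra|]. split; [apply at_right_proper_filter|]. split.
  - apply at_right_pos.
  - intros g Hg. exists 0%R. intros e He.
    (* The radius is (g e)^(1/g), because [dom_prim g y] is at most y^g / g. *)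
    assert (Hd : (0 < exp (ln (g * e) / g))%R) by apply exp_pos.
    exists (mkposreal _ Hd). intros y Hy Hy0.
    change (Rabs (y - 0) < exp (ln (g * e) / g))%R in Hy. rewrite Rminus_0_r, Rabs_pos_eq in Hy by lra.
    rewrite Rminus_0_r, Rabs_pos_eq by (left; apply dom_prim_bounds; assumption).
    unfold dom_prim. assert (0 < g * e)%R by nra.
    assert (L : (ln y < ln (g * e) / g)%R).
    { apply Rlt_le_trans with (ln (exp (ln (g * e) / g))); [apply ln_increasing; assumption | rewrite ln_exp; lra]. }
    assert (L2 : (0 <= ln (1 + y))%R) by (apply Rle_trans with (ln 1); [rewrite ln_1; lra | apply ln_le_mono; lra]).
    apply Rmult_lt_reg_l with g; [exact Hg|]. rewrite <- Rmult_assoc, Rinv_r, Rmult_1_l by lra.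
    rewrite <- (exp_ln (g * e)) by assumption. apply exp_increasing.
    apply (Rmult_lt_compat_l g) in L; [|exact Hg].
    replace (g * (ln (g * e) / g))%R with (ln (g * e)) in L by (field; lra). nra.
Qed.

Lemma lower_end_point (a0 e0 : R) : (0 <= a0 < e0)%R -> lower_end a0 (at_point e0).
Proof.
  intros H. split; [lra|]. split; [apply at_point_filter|]. split; [exact (proj2 H)|].
  intros g Hg. exists (dom_prim g e0). intros e He. unfold at_point.
  rewrite Rminus_diag, Rabs_R0. exact He.
Qed.

(** By exp u >= 1 + u the distance to the limit 1/g is at most ln (1 + 1/b) <= 1/b, so b > 1/e
    suffices. *)
Lemma dom_prim_infty (g e : R) : (0 < g)%R -> (0 < e)%R ->
  infty (fun b => Rabs (dom_prim g b - / g) < e)%R.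
Proof.
  intros Hg He. exists (/ e)%R. intros b Hb.
  assert (He' : (0 < / e)%R) by (apply Rinv_0_lt_compat, He).
  assert (Hb0 : (0 < b)%R) by lra.
  destruct (dom_prim_bounds g b Hg Hb0) as [_ H].
  rewrite Rabs_minus_sym, Rabs_pos_eq by lra.
  assert (Hbe : (/ b < e)%R).
  { rewrite <- (Rinv_inv e). apply Rinv_lt_contravar; [nra|exact Hb]. }
  apply Rle_lt_trans with (2 := Hbe).
  unfold dom_prim.
  assert (E := exp_ineq1_le (g * (ln b - ln (1 + b)))).
  assert (L : (ln (1 + b) - ln b <= / b)%R).
  { rewrite <- ln_div by lra. replace ((1 + b) / b)%R with (1 + / b)%R by (field; lra).
    assert (0 < / b)%R by (apply Rinv_0_lt_compat; lra).
    apply Rle_trans with (ln (exp (/ b))); [|rewrite ln_exp; lra].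
    apply ln_le_mono; [lra|]. apply exp_ineq1_le. }
  assert (0 < / g)%R by (apply Rinv_0_lt_compat, Hg).
  apply Rle_trans with (/ g - / g * (1 + g * (ln b - ln (1 + b))))%R.
  { apply (Rmult_le_compat_l (/ g)) in E; lra. }
  replace (/ g - / g * (1 + g * (ln b - ln (1 + b))))%R with (ln (1 + b) - ln b)%R by (field; lra).
  exact L.
Qed.

Lemma rcont_between (f : R -> C) (a0 a b : R) : (forall t, (a0 < t)%R -> rcont f t) ->
  (a0 < a)%R -> (a0 < b)%R -> ex_CInt f a b.
Proof.
  intros Hf Ha Hb. apply ex_CInt_cont. intros t Ht. apply Hf.
  apply Rlt_le_trans with (2 := proj1 Ht). apply Rmin_glb_lt; assumption.
Qed.

(** The absolute value admits both orders of a and b, as the Cauchy criterion compares two choices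
    of each end. *)
Lemma CInt_dom (f : R -> C) (a0 g K a b : R) : (0 <= a0)%R -> (0 < g)%R -> (0 <= K)%R ->
  (forall t, (a0 < t)%R -> rcont f t) -> (forall t, (a0 < t)%R -> (Cmod (f t) <= K * dom g t)%R) ->
  (a0 < a)%R -> (a0 < b)%R -> (Cmod (CInt f a b) <= K * Rabs (dom_prim g b - dom_prim g a))%R.
Proof.
  intros Ha0 Hg HK Hf Hd Ha Hb.
  assert (W : forall a b, (a0 < a)%R -> (a <= b)%R ->
     (Cmod (CInt f a b) <= K * (dom_prim g b - dom_prim g a))%R).
  { intros x y Hx Hxy.
    apply is_CInt_norm with (f := f) (g := fun t => (K * dom g t)%R) (a := x) (b := y); [exact Hxy| | |].
    - intros t Ht. apply Hd. lra.
    - apply CInt_correct, rcont_between with a0; try assumption. lra.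
    - apply (is_RInt_scal (V := R_NormedModule) (dom g) x y K). apply is_RInt_dom; lra. }
  destruct (Rle_lt_dec a b) as [L|L].
  - apply Rle_trans with (1 := W a b Ha L). apply Rmult_le_compat_l; [exact HK | apply Rle_abs].
  - replace (CInt f a b) with (- CInt f b a).
    + rewrite Cmod_opp, Rabs_minus_sym. apply Rle_trans with (1 := W b a Hb ltac:(lra)).
      apply Rmult_le_compat_l; [exact HK | apply Rle_abs].
    + exact (opp_RInt_swap (V := C_R_CompleteNormedModule) f b a (rcont_between f a0 b a Hf Hb Ha)).
Qed.

(** Convergence is the Cauchy criterion for the primitive of the majorant, and the bound K / g holds
    because [dom_prim g] takes values between 0 and 1/g. Applied to a difference of integrands, this
    bound plays the part of dominated convergence. *)
Lemma dominated_integral (Fa : (R -> Prop) -> Prop) (a0 g K : R) (f : R -> C) :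
  lower_end a0 Fa -> (0 < g)%R -> (0 <= K)%R ->
  (forall t, (a0 < t)%R -> rcont f t) -> (forall t, (a0 < t)%R -> (Cmod (f t) <= K * dom g t)%R) ->
  exists l, is_CInt_gen f Fa infty l /\ (Cmod l <= K / g)%R.
Proof.
  intros (Ha0 & FFa & Hgt & Hlim) Hg HK Hf Hd.
  set (I := fun ab : R * R => CInt f (fst ab) (snd ab) : C).
  destruct (Hlim g Hg) as [A HA].
  assert (HP : forall e, (0 < e)%R -> filter_prod Fa infty (fun ab =>
     (a0 < fst ab)%R /\ (a0 < snd ab)%R /\ (Rabs (dom_prim g (fst ab) - A) < e)%R /\
     (Rabs (dom_prim g (snd ab) - / g) < e)%R)).
  { intros e He. apply (Filter_prod _ _ _
      (fun a => (a0 < a)%R /\ (Rabs (dom_prim g a - A) < e)%R)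
      (fun b => (a0 < b)%R /\ (Rabs (dom_prim g b - / g) < e)%R)).
    - apply filter_and; [exact Hgt | apply HA, He].
    - apply filter_and; [apply infty_gt | apply dom_prim_infty; assumption].
    - simpl. tauto. }
  assert (FF : ProperFilter (filter_prod Fa infty)) by (apply filter_prod_proper).
  destruct (proj1 (@filterlim_locally_cauchy _ C_R_CompleteNormedModule (filter_prod Fa infty) FF I)) as [l Hl].
  - intros e. set (e1 := (e / (4 * (K + 1)))%R).
    assert (He1 : (0 < e1)%R) by (apply Rdiv_lt_0_compat; [apply cond_pos|lra]).
    exists (fun ab => (a0 < fst ab)%R /\ (a0 < snd ab)%R /\ (Rabs (dom_prim g (fst ab) - A) < e1)%R /\
     (Rabs (dom_prim g (snd ab) - / g) < e1)%R). split; [apply HP, He1|].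
    intros [a b] [a' b'] (Q1 & Q2 & Q3 & Q4) (R1 & R2 & R3 & R4). simpl in *.
    apply C_NormedModule_mixin_compat1. change (Cmod (I (a', b') - I (a, b)) < e)%R. unfold I. simpl.
    rewrite (CInt_Chasles f a' a b'), (CInt_Chasles f a b b'); try (apply rcont_between with a0; assumption).
    replace (CInt f a' a + (CInt f a b + CInt f b b') - CInt f a b) with (CInt f a' a + CInt f b b') by ring.
    apply Rle_lt_trans with (1 := Cmod_triangle _ _).
    assert (B1 := CInt_dom f a0 g K a' a Ha0 Hg HK Hf Hd R1 Q1).
    assert (B2 := CInt_dom f a0 g K b b' Ha0 Hg HK Hf Hd Q2 R2).
    assert (D1 : (Rabs (dom_prim g a - dom_prim g a') <= 2 * e1)%R).
    { apply Rabs_lt_between in Q3. apply Rabs_lt_between in R3. apply Rabs_le. lra. }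
    assert (D2 : (Rabs (dom_prim g b' - dom_prim g b) <= 2 * e1)%R).
    { apply Rabs_lt_between in Q4. apply Rabs_lt_between in R4. apply Rabs_le. lra. }
    apply (Rmult_le_compat_l K) in D1; [|exact HK]. apply (Rmult_le_compat_l K) in D2; [|exact HK].
    assert (E : (4 * (K + 1) * e1 = e)%R) by (unfold e1; field; lra). nra.
  - exists l. split.
    + intros P HPl. specialize (Hl P HPl). unfold filtermap in Hl. unfold filtermapi.
      assert (H := filter_and _ _ Hl (HP 1%R Rlt_0_1)). revert H. apply filter_imp.
      intros [a b] (H1 & H2 & H3 & _). exists (I (a, b)). split; [|exact H1].
      apply CInt_correct, rcont_between with a0; assumption.
    + apply Rnot_lt_le. intros Hlt.
      assert (HN : locally (T := C_UniformSpace) l (fun y => Cmod (y - l) < Cmod l - K / g)%R).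
      { apply locally_Cmod. exists (Cmod l - K / g)%R. split; [lra|tauto]. }
      specialize (Hl _ HN). unfold filtermap in Hl.
      destruct (filter_ex _ (filter_and _ _ Hl (HP 1%R Rlt_0_1))) as [[a b] (H1 & H2 & H3 & _)]. simpl in *.
      assert (B := CInt_dom f a0 g K a b Ha0 Hg HK Hf Hd H2 H3).
      assert (P1 := dom_prim_bounds g a Hg ltac:(lra)). assert (P2 := dom_prim_bounds g b Hg ltac:(lra)).
      assert (D : (Rabs (dom_prim g b - dom_prim g a) <= / g)%R) by (apply Rabs_le; lra).
      apply (Rmult_le_compat_l K) in D; [|exact HK]. unfold I in H1. simpl in H1.
      assert (T := Cmod_triangle_rev l (CInt f a b)). rewrite Cmod_minus_sym in T. unfold Rdiv in *. lra.
Qed.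

(** * Mellin transforms *)

(* (1 + 1/t)^a. *)
Definition weight (a t : R) : R := exp (a * (ln (1 + t) - ln t)).

(** [weight a] behaves like t^(-a) at 0 and tends to 1 at infinity, so the Mellin integral from 0
    converges for Re s > a. The rate 1/2 leaves room for polynomial factors in front of e^(-t). *)
Definition mellin_bounded (a0 a : R) (F : R -> C) : Prop :=
  (forall t, (a0 < t)%R -> rcont F t) /\
  exists K, (0 <= K)%R /\ forall t, (a0 < t)%R -> (Cmod (F t) <= K * (weight a t * exp (- t / 2)))%R.

Definition mterm (F : R -> C) (s : C) (t : R) : C := cpow t (s - 1) * F t.

Definition mellin (Fa : (R -> Prop) -> Prop) (F : R -> C) (s : C) : C :=
  CInt_gen (mterm F s) Fa infty.

Notation mellin0 := (mellin (at_right 0)).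

Lemma cpow_ln (t : R) (w : C) : cpow t w = cexp (w * ln t).
Proof. reflexivity. Qed.

Lemma Cmod_cpow (t : R) (w : C) : Cmod (cpow t w) = exp (Re w * ln t).
Proof. rewrite cpow_ln, Cmod_cexp. f_equal. destruct w. simpl. ring. Qed.

Lemma cpow_plus (t : R) (a b : C) : cpow t (a + b) = cpow t a * cpow t b.
Proof. rewrite !cpow_ln, <- cexp_plus. f_equal. ring. Qed.

Lemma cpow_1 (t : R) : (0 < t)%R -> cpow t 1 = t.
Proof. intros Ht. rewrite cpow_ln, Cmult_1_l, cexp_RtoC, exp_ln by exact Ht. reflexivity. Qed.

Lemma cpow_mult_base (c t : R) (w : C) : (0 < c)%R -> (0 < t)%R -> cpow (c * t) w = cpow c w * cpow t w.
Proof.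
  intros Hc Ht. rewrite !cpow_ln, ln_mult, RtoC_plus, <- cexp_plus by assumption. f_equal. ring.
Qed.

Lemma rcont_cpow (w : C) (t : R) : (0 < t)%R -> rcont (fun t => cpow t w) t.
Proof.
  intros Ht. apply rcont_cexp. apply rcont_mult; [apply rcont_const|].
  apply (rcont_RtoC ln), ex_derive_Rcontinuous. auto_derive. exact Ht.
Qed.

Lemma rcont_ln (t : R) : (0 < t)%R -> rcont (fun t => RtoC (ln t)) t.
Proof.
  intros Ht. apply (rcont_RtoC ln), ex_derive_Rcontinuous. auto_derive. exact Ht.
Qed.

(** For p > 0 apply ln x <= x to x = (1 + t) / (2 p), which makes the linear term exactly t/2. *)
Lemma exp_growth (p : R) : exists K, (0 <= K)%R /\
  forall t, (0 < t)%R -> (exp (p * ln (1 + t) - t / 2) <= K)%R.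
Proof.
  destruct (Rle_lt_dec p 0) as [Hp|Hp].
  - exists 1%R. split; [lra|]. intros t Ht. apply Rle_trans with (exp 0); [apply exp_le_mono | rewrite exp_0; lra].
    assert (0 <= ln (1 + t))%R by (apply Rle_trans with (ln 1); [rewrite ln_1; lra | apply ln_le_mono; lra]). nra.
  - exists (exp (1 / 2 + p * ln (2 * p))). split; [left; apply exp_pos|]. intros t Ht. apply exp_le_mono.
    assert (E : (ln (1 + t) <= (1 + t) / (2 * p) + ln (2 * p))%R).
    { replace (1 + t)%R with ((1 + t) / (2 * p) * (2 * p))%R at 1 by (field; lra).
      assert (0 < (1 + t) / (2 * p))%R by (apply Rdiv_lt_0_compat; lra).
      rewrite ln_mult by lra. apply Rplus_le_compat_r.
      apply Rle_trans with (ln (exp ((1 + t) / (2 * p)))); [|rewrite ln_exp; lra].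
      apply ln_le_mono; [assumption|]. assert (K := exp_ineq1_le ((1 + t) / (2 * p))). lra. }
    apply (Rmult_le_compat_l p) in E; [|lra].
    replace (p * ((1 + t) / (2 * p) + ln (2 * p)))%R with (1 / 2 + t / 2 + p * ln (2 * p))%R in E by (field; lra).
    lra.
Qed.

(** The factor t^(-x) (1 + t)^y makes room for powers of ln t and for a change of s. It costs x in
    the exponent at 0, while its growth at infinity is absorbed by e^(-t/2). *)
Lemma weight_dom (sg a x y : R) : exists K, (0 <= K)%R /\ forall t, (0 < t)%R ->
  (exp ((sg - 1) * ln t) * (weight a t * exp (- t / 2)) * exp (- x * ln t + y * ln (1 + t))
    <= K * dom (sg - a - x) t)%R.
Proof.
  set (g := (sg - a - x)%R).
  destruct (exp_growth (a + y + g + 1)) as [K [HK H]].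
  exists K. split; [exact HK|]. intros t Ht.
  apply Rle_trans with (exp ((a + y + g + 1) * ln (1 + t) - t / 2) * dom g t)%R.
  - unfold weight, dom. rewrite <- !exp_plus. right. f_equal. unfold g. field.
  - apply Rmult_le_compat_r; [left; apply dom_pos | apply H, Ht].
Qed.

Lemma abs_ln_le (t : R) : (0 < t)%R -> (Rabs (ln t) <= - ln t + 2 * ln (1 + t))%R.
Proof.
  intros Ht.
  assert (ln t <= ln (1 + t))%R by (apply ln_le_mono; lra).
  assert (0 <= ln (1 + t))%R by (apply Rle_trans with (ln 1); [rewrite ln_1; lra | apply ln_le_mono; lra]).
  apply Rabs_le. lra.
Qed.

(** With X = - ln t + 2 ln (1 + t) one has |ln t| <= X <= e^(d X) / d, a shape that [weight_dom]
    accepts. *)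
Lemma abs_ln_exp (d t : R) : (0 < d)%R -> (0 < t)%R ->
  (Rabs (ln t) <= / d * exp (- d * ln t + 2 * d * ln (1 + t)))%R.
Proof.
  intros Hd Ht. assert (H := abs_ln_le t Ht).
  assert (E := exp_ineq1_le (- d * ln t + 2 * d * ln (1 + t))).
  apply Rmult_le_reg_l with d; [exact Hd|]. rewrite <- Rmult_assoc, Rinv_r, Rmult_1_l by lra. nra.
Qed.

Section Mellin.

Variables (Fa : (R -> Prop) -> Prop) (a0 a : R) (F : R -> C).
Hypothesis HFa : lower_end a0 Fa.
Hypothesis HF : mellin_bounded a0 a F.

Lemma rcont_mterm (s : C) (t : R) : (a0 < t)%R -> rcont (mterm F s) t.
Proof.
  intros Ht. destruct HFa as [Ha0 _]. apply rcont_mult; [apply rcont_cpow; lra | apply HF, Ht].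
Qed.

Lemma mellin_exists (s : C) : (a < Re s)%R ->
  exists l, is_CInt_gen (mterm F s) Fa infty l.
Proof.
  intros Hs. destruct HFa as [Ha0 _]. destruct HF as [Hc [K [HK Hb]]].
  destruct (weight_dom (Re s) a 0 0) as [K' [HK' W]].
  destruct (dominated_integral Fa a0 (Re s - a - 0) (K * K') (mterm F s)) as [l [Hl _]]; try assumption.
  - lra.
  - apply Rmult_le_pos; assumption.
  - intros t Ht. apply rcont_mterm, Ht.
  - intros t Ht. unfold mterm. rewrite Cmod_mult, Cmod_cpow.
    assert (Ht0 : (0 < t)%R) by lra. specialize (W t Ht0).
    replace (- 0 * ln t + 0 * ln (1 + t))%R with 0%R in W by ring. rewrite exp_0, Rmult_1_r in W.
    replace (Re (s - 1)) with (Re s - 1)%R by (destruct s; simpl; ring).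
    apply Rle_trans with (exp ((Re s - 1) * ln t) * (K * (weight a t * exp (- t / 2))))%R.
    + apply Rmult_le_compat_l; [left; apply exp_pos | apply Hb, Ht].
    + rewrite (Rmult_assoc K). replace (exp ((Re s - 1) * ln t) * (K * (weight a t * exp (- t / 2))))%R with
        (K * (exp ((Re s - 1) * ln t) * (weight a t * exp (- t / 2))))%R by ring.
      apply Rmult_le_compat_l; assumption.
  - exists l. exact Hl.
Qed.

Lemma is_CInt_gen_mellin (s : C) : (a < Re s)%R ->
  is_CInt_gen (mterm F s) Fa infty (mellin Fa F s).
Proof.
  intros Hs. destruct (mellin_exists s Hs) as [l Hl].
  destruct HFa as (_ & FFa & _).
  unfold mellin. rewrite (CInt_gen_unique Fa infty _ l Hl). exact Hl.
Qed.

Lemma mellin_derive (s : C) : (a < Re s)%R ->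
  exists D, is_CInt_gen (fun t => ln t * mterm F s t) Fa infty D /\ is_cderive (mellin Fa F) s D.
Proof.
  intros Hs. assert (HFa' := HFa). destruct HFa' as (Ha0 & FFa & _). destruct HF as [Hc [K [HK Hb]]].
  (* The second order remainder contains |ln t|^2 e^(|h| |ln t|), and each of its three factors
     costs d in the exponent at 0. A quarter of the margin leaves Re s - a - 3 d = d > 0. *)
  set (d := ((Re s - a) / 4)%R). assert (Hd : (0 < d)%R) by (unfold d; lra).
  destruct (weight_dom (Re s) a d (2 * d)) as [K1 [HK1 W1]].
  destruct (weight_dom (Re s) a (3 * d) (6 * d)) as [K2 [HK2 W2]].
  assert (Hd' : (0 < / d)%R) by (apply Rinv_0_lt_compat, Hd).
  assert (Base : forall t, (a0 < t)%R ->
    (Cmod (mterm F s t) <= K * (exp ((Re s - 1) * ln t) * (weight a t * exp (- t / 2))))%R).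
  { intros t Ht. unfold mterm. rewrite Cmod_mult, Cmod_cpow.
    replace (Re (s - 1)) with (Re s - 1)%R by (destruct s; simpl; ring).
    apply Rle_trans with (exp ((Re s - 1) * ln t) * (K * (weight a t * exp (- t / 2))))%R; [|right; ring].
    apply Rmult_le_compat_l; [left; apply exp_pos | apply Hb, Ht]. }
  assert (BP : forall t, (0 <= K * (exp ((Re s - 1) * ln t) * (weight a t * exp (- t / 2))))%R).
  { intros t. apply Rmult_le_pos; [exact HK|]. unfold weight. left. repeat apply Rmult_lt_0_compat; apply exp_pos. }
  destruct (dominated_integral Fa a0 (Re s - a - d) (/ d * K * K1) (fun t => ln t * mterm F s t)) as [D [HD _]]; try assumption.
  - unfold d; lra.
  - repeat apply Rmult_le_pos; lra.
  - intros t Ht. apply rcont_mult; [apply rcont_ln; lra | apply rcont_mterm, Ht].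
  - intros t Ht. assert (Ht0 : (0 < t)%R) by lra. specialize (W1 t Ht0).
    rewrite Cmod_mult, Cmod_R.
    apply Rle_trans with ((/ d * exp (- d * ln t + 2 * d * ln (1 + t))) *
       (K * (exp ((Re s - 1) * ln t) * (weight a t * exp (- t / 2)))))%R.
    + apply Rmult_le_compat; [apply Rabs_pos | apply Cmod_ge_0 | apply abs_ln_exp; assumption | apply Base, Ht].
    + apply (Rmult_le_compat_l (/ d * K)) in W1; [|apply Rmult_le_pos; lra].
      apply Rle_trans with (2 := Rle_trans _ _ _ W1 (Req_le _ _ (eq_sym (Rmult_assoc _ _ _)))). right. ring.
  - exists D. split; [exact HD|]. apply is_cderive_eps. intros e He.
    set (B := (/ d * / d * K * K2 / (Re s - a - 3 * d))%R).
    assert (Hg3 : (0 < Re s - a - 3 * d)%R) by (unfold d; lra).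
    assert (HB : (0 <= B)%R).
    { apply Rdiv_le_0_compat; [|exact Hg3]. repeat apply Rmult_le_pos; lra. }
    exists (Rmin d (e / (B + 1))). split; [apply Rmin_pos; [exact Hd | apply Rdiv_lt_0_compat; lra]|].
    intros w Hw. set (h := w - s) in *.
    assert (Hh1 : (Cmod h < d)%R) by exact (Rlt_Rmin_l Hw).
    assert (Hh2 : (Cmod h < e / (B + 1))%R) by exact (Rlt_Rmin_r Hw).
    assert (Hws : (a < Re w)%R).
    { assert (T := Cmod_Re_le h). apply Rabs_le_between in T.
      replace (Re w) with (Re s + Re h)%R by (unfold h; destruct w, s; simpl; ring). unfold d in *. lra. }
    assert (I : is_CInt_gen (fun t => (mterm F w t - mterm F s t) - h * (ln t * mterm F s t)) Fa infty
       ((mellin Fa F w - mellin Fa F s) - h * D)%C).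
    { apply (is_RInt_gen_minus (V := C_R_NormedModule) (fun t => (mterm F w t - mterm F s t)) (fun t => h * (ln t * mterm F s t))).
      - apply (is_RInt_gen_minus (V := C_R_NormedModule) (mterm F w) (mterm F s)); apply is_CInt_gen_mellin; assumption.
      - apply is_CInt_gen_scal; [apply _ .. | exact HD]. }
    destruct (dominated_integral Fa a0 (Re s - a - 3 * d) (Cmod h * Cmod h * (/ d * / d * K * K2))
       (fun t => (mterm F w t - mterm F s t) - h * (ln t * mterm F s t))) as [l [Hl Hlb]]; try assumption.
    + pose proof (Cmod_ge_0 h). repeat apply Rmult_le_pos; lra.
    + intros t Ht. apply rcont_minus; [apply rcont_minus; apply rcont_mterm, Ht|].
      apply rcont_mult; [apply rcont_const|]. apply rcont_mult; [apply rcont_ln; lra | apply rcont_mterm, Ht].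
    + intros t Ht. assert (Ht0 : (0 < t)%R) by lra. specialize (W2 t Ht0).
      replace (mterm F w t - mterm F s t - h * (ln t * mterm F s t))
        with ((cexp (h * ln t) - 1 - h * ln t) * mterm F s t).
      2: { unfold mterm. replace (w - 1) with ((s - 1) + h) by (unfold h; ring).
           rewrite cpow_plus, (cpow_ln t h). ring. }
      rewrite Cmod_mult.
      assert (E2 := cexp_bound2 (h * ln t)). rewrite Cmod_mult, Cmod_R in E2.
      assert (EL := abs_ln_exp d t Hd Ht0).
      set (X := exp (- d * ln t + 2 * d * ln (1 + t))) in *.
      assert (EX : (exp (Cmod h * Rabs (ln t)) <= X)%R).
      { apply exp_le_mono. assert (T := abs_ln_le t Ht0). pose proof (Rabs_pos (ln t)).
        pose proof (Cmod_ge_0 h). apply Rle_trans with (d * Rabs (ln t))%R; nra. }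
      assert (HX : (0 < X)%R) by apply exp_pos.
      pose proof (Rabs_pos (ln t)) as Hl0. pose proof (Cmod_ge_0 h) as Hh0.
      assert (E3 : (Cmod (cexp (h * ln t) - 1 - h * ln t) <= Cmod h * Cmod h * (/ d * / d) * (X * X * X))%R).
      { apply Rle_trans with (1 := E2).
        apply Rle_trans with ((Cmod h * Cmod h) * ((/ d * X) * (/ d * X)) * X)%R; [|right; ring].
        apply Rmult_le_compat; [|left; apply exp_pos| |exact EX].
        - repeat apply Rmult_le_pos; assumption.
        - replace (Cmod h * Rabs (ln t) * (Cmod h * Rabs (ln t)))%R with
            ((Cmod h * Cmod h) * (Rabs (ln t) * Rabs (ln t)))%R by ring.
          apply Rmult_le_compat_l; [nra|]. apply Rmult_le_compat; assumption. }
      assert (EX3 : (X * X * X = exp (- (3 * d) * ln t + 6 * d * ln (1 + t)))%R).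
      { unfold X. rewrite <- !exp_plus. f_equal. ring. }
      rewrite EX3 in E3.
      apply Rle_trans with (1 := Rmult_le_compat _ _ _ _ (Cmod_ge_0 _) (Cmod_ge_0 _) E3 (Base t Ht)).
      apply (Rmult_le_compat_l (Cmod h * Cmod h * (/ d * / d) * K)) in W2.
      2: { repeat apply Rmult_le_pos; lra. }
      apply Rle_trans with (2 := Rle_trans _ _ _ W2 (Req_le _ _
        (eq_trans (eq_sym (Rmult_assoc _ _ _)) (f_equal (fun x => (x * dom (Re s - a - 3 * d) t)%R)
          (ltac:(ring) : (Cmod h * Cmod h * (/ d * / d) * K * K2 = Cmod h * Cmod h * (/ d * / d * K * K2))%R))))).
      right. ring.
    + assert (El : l = (mellin Fa F w - mellin Fa F s) - h * D).
      { rewrite <- (CInt_gen_unique Fa infty _ _ Hl). apply (CInt_gen_unique Fa infty), I. }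
      rewrite El in Hlb. rewrite (Cmult_comm D h). apply Rle_trans with (1 := Hlb).
      replace (Cmod h * Cmod h * (/ d * / d * K * K2) / (Re s - a - 3 * d))%R with (Cmod h * Cmod h * B)%R by (unfold B; field; split; lra).
      apply Rlt_div_mult in Hh2; [|lra].
      pose proof (Cmod_ge_0 h). nra.
Qed.

Lemma ex_cderive_mellin (s : C) : (a < Re s)%R -> ex_cderive (mellin Fa F) s.
Proof. intros Hs. destruct (mellin_derive s Hs) as [D [_ HD]]. exists D. exact HD. Qed.

End Mellin.

(* The exponent [a] may even be taken below Re s, which makes the tail integrals
   entire in s. *)
Lemma mellin_bounded_tail (a0 a b : R) (F : R -> C) : (0 < a0)%R -> (0 <= b)%R ->
  mellin_bounded 0 b F -> mellin_bounded a0 a F.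
Proof.
  intros Ha0 Hb [Hc [K [HK H]]]. split; [intros t Ht; apply Hc; lra|].
  set (L := (ln (1 + a0) - ln a0)%R).
  exists (K * exp ((Rabs b + Rabs a) * L))%R. split; [apply Rmult_le_pos; [exact HK|left; apply exp_pos]|].
  intros t Ht. apply Rle_trans with (1 := H t ltac:(lra)). rewrite Rmult_assoc.
  apply Rmult_le_compat_l; [exact HK|]. rewrite <- Rmult_assoc.
  apply Rmult_le_compat_r; [left; apply exp_pos|]. unfold weight. rewrite <- exp_plus. apply exp_le_mono.
  assert (L0 : (0 <= ln (1 + t) - ln t)%R).
  { assert (ln t <= ln (1 + t))%R by (apply ln_le_mono; lra). lra. }
  assert (L1 : (ln (1 + t) - ln t <= L)%R).
  { unfold L. rewrite <- !ln_div by lra. apply ln_le_mono; [apply Rdiv_lt_0_compat; lra|].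
    apply Rmult_le_reg_r with (t * a0)%R; [nra|].
    replace ((1 + t) / t * (t * a0))%R with ((1 + t) * a0)%R by (field; lra).
    replace ((1 + a0) / a0 * (t * a0))%R with ((1 + a0) * t)%R by (field; lra). nra. }
  assert (Hbb : (b <= Rabs b)%R) by apply Rle_abs.
  assert (Haa : (- a <= Rabs a)%R) by (rewrite <- Rabs_Ropp; apply Rle_abs).
  pose proof (Rabs_pos a). pose proof (Rabs_pos b).
  assert (0 <= L)%R by lra. nra.
Qed.

Lemma is_CInt_gen_dilate (g : R -> C) (c : R) (l : C) : (0 < c)%R ->
  is_CInt_gen g (at_right 0) infty l ->
  is_CInt_gen (fun t => c * g (c * t)%R) (at_right 0) infty l.
Proof.
  intros Hc H P HP. specialize (H P HP). unfold filtermapi in *.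
  destruct H as [Q1 Q2 HQ1 HQ2 HQ].
  apply (Filter_prod _ _ _ (fun a => Q1 (c * a)%R) (fun b => Q2 (c * b)%R)).
  - destruct HQ1 as [d Hd]. assert (Hdc : (0 < d / c)%R) by (apply Rdiv_lt_0_compat; [apply cond_pos|exact Hc]).
    exists (mkposreal _ Hdc). intros y Hy Hy0. apply Hd; [|nra].
    change (Rabs (y - 0) < d / c)%R in Hy. change (Rabs (c * y - 0) < d)%R.
    rewrite Rminus_0_r in *. rewrite Rabs_mult, (Rabs_pos_eq c) by lra.
    apply (Rmult_lt_compat_l c) in Hy; [|exact Hc].
    replace (c * (d / c))%R with (d : R) in Hy by (field; lra). exact Hy.
  - destruct HQ2 as [M HM]. exists (M / c)%R. intros y Hy. apply HM.
    apply (Rmult_lt_compat_l c) in Hy; [|exact Hc].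
    replace (c * (M / c))%R with M in Hy by (field; lra). exact Hy.
  - intros x y Hx Hy. destruct (HQ _ _ Hx Hy) as [z [Hz1 Hz2]]. simpl in *.
    exists z. split; [|exact Hz2].
    assert (K := is_RInt_comp_lin (V := C_R_NormedModule) g c 0 x y z).
    rewrite !Rplus_0_r in K. specialize (K Hz1).
    revert K. apply is_CInt_ext. intros t _. rewrite Rplus_0_r.
    apply C_ext; destruct (g (c * t)%R); simpl; unfold scal; simpl; unfold mult; simpl; ring.
Qed.

Lemma mterm_dilate (F : R -> C) (s : C) (c t : R) : (0 < c)%R -> (0 < t)%R ->
  mterm (fun t => F (c * t)%R) s t = cpow c (- s) * (c * mterm F s (c * t)%R).
Proof.
  intros Hc Ht. unfold mterm. rewrite cpow_mult_base by assumption.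
  rewrite <- (cpow_1 c Hc).
  replace (cpow c (- s) * (cpow c 1 * (cpow c (s - 1) * cpow t (s - 1) * F (c * t)%R)))
    with ((cpow c (- s) * cpow c 1 * cpow c (s - 1)) * (cpow t (s - 1) * F (c * t)%R)) by ring.
  rewrite <- !cpow_plus. replace (- s + 1 + (s - 1)) with (RtoC 0) by ring.
  replace (cpow c 0) with (RtoC 1) by (rewrite cpow_ln, Cmult_0_l; symmetry; apply cexp_0). ring.
Qed.

(** This produces the powers n^(-s) in Dirichlet series and the factor 2^(-s) in the relation
    between eta and zeta. *)
Lemma is_CInt_gen_mterm_dilate (F : R -> C) (s : C) (c : R) (l : C) : (0 < c)%R ->
  is_CInt_gen (mterm F s) (at_right 0) infty l ->
  is_CInt_gen (mterm (fun t => F (c * t)%R) s) (at_right 0) infty (cpow c (- s) * l)%C.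
Proof.
  intros Hc H.
  apply is_CInt_gen_ext with (fun t => cpow c (- s) * (c * mterm F s (c * t)%R)); [apply _ .. | | | |].
  - intros t Ht. symmetry. apply mterm_dilate; assumption.
  - apply at_right_pos.
  - apply infty_gt.
  - apply is_CInt_gen_scal; [apply _ .. |]. apply is_CInt_gen_dilate; assumption.
Qed.

(** * The Gamma function *)

Definition expo (t : R) : C := exp (- t).

Lemma Gamma_integral_mellin (s : C) : Gamma_integral s = mellin0 expo s.
Proof. reflexivity. Qed.

Lemma rcont_expo (c t : R) : rcont (fun t => RtoC (exp (- (c * t)))) t.
Proof. apply (rcont_RtoC (fun t => exp (- (c * t)))), ex_derive_Rcontinuous. auto_derive. trivial. Qed.

Lemma weight_ge_1 (a t : R) : (0 <= a)%R -> (0 < t)%R -> (1 <= weight a t)%R.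
Proof.
  intros Ha Ht. unfold weight. apply Rle_trans with (exp 0); [rewrite exp_0; lra|]. apply exp_le_mono.
  assert (ln t <= ln (1 + t))%R by (apply ln_le_mono; lra). nra.
Qed.

Lemma mellin_bounded_expo : mellin_bounded 0 0 expo.
Proof.
  split.
  - intros t _. unfold expo. replace (fun t => RtoC (exp (- t))) with (fun t => RtoC (exp (- (1 * t)))).
    + apply rcont_expo.
    + apply functional_extensionality. intros x. do 3 f_equal. ring.
  - exists 1%R. split; [lra|]. intros t Ht. unfold expo.
    rewrite Cmod_R, Rabs_pos_eq by (left; apply exp_pos). rewrite Rmult_1_l.
    rewrite <- (Rmult_1_l (exp (- t))). apply Rmult_le_compat; [lra | left; apply exp_pos | apply weight_ge_1; lra|].
    apply exp_le_mono. lra.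
Qed.

Lemma is_CInt_gen_primitive (P p : R -> C) (A B : C) :
  (forall t, (0 < t)%R -> is_rderive P t (p t)) -> (forall t, (0 < t)%R -> rcont p t) ->
  (forall e, (0 < e)%R -> at_right 0 (fun t => Cmod (P t - A) < e)%R) ->
  (forall e, (0 < e)%R -> infty (fun t => Cmod (P t - B) < e)%R) ->
  is_CInt_gen p (at_right 0) infty (B - A)%C.
Proof.
  intros HP Hp HA HB Q HQ. apply locally_Cmod in HQ. destruct HQ as [e [He HQ]].
  assert (He2 : (0 < e / 2)%R) by lra.
  assert (H0 : at_right 0 (fun a => 0 < a)%R) by apply at_right_pos.
  unfold filtermapi.
  apply (Filter_prod _ _ _ (fun a => (0 < a)%R /\ (Cmod (P a - A) < e / 2)%R)
                           (fun b => (0 < b)%R /\ (Cmod (P b - B) < e / 2)%R)).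
  - apply filter_and; [exact H0 | apply HA, He2].
  - apply filter_and; [apply infty_gt | apply HB, He2].
  - intros a b [Ha Ha'] [Hb Hb']. simpl. exists (P b - P a). split.
    + assert (Pos : forall x, (Rmin a b <= x <= Rmax a b)%R -> (0 < x)%R).
      { intros x Hx. apply Rlt_le_trans with (2 := proj1 Hx). apply Rmin_pos; assumption. }
      apply is_CInt_derive; auto.
    + apply HQ. replace (P b - P a - (B - A)) with ((P b - B) - (P a - A)) by ring.
      apply Rle_lt_trans with (1 := Cmod_triangle_minus _ _). lra.
Qed.

Lemma exp_half_small (K e : R) : (0 <= K)%R -> (0 < e)%R -> infty (fun t => K * exp (- (t / 2)) < e)%R.
Proof.
  intros HK He. exists (2 * K / e)%R. intros t Ht.
  assert (0 <= 2 * K / e)%R by (apply Rdiv_le_0_compat; lra).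
  rewrite exp_Ropp. assert (E := exp_ineq1_le (t / 2)). assert (Hp := exp_pos (t / 2)).
  apply Rmult_lt_reg_r with (exp (t / 2)); [exact Hp|].
  rewrite Rmult_assoc, Rinv_l by lra.
  apply (Rmult_lt_compat_l e) in Ht; [|exact He].
  replace (e * (2 * K / e))%R with (2 * K)%R in Ht by (field; lra). nra.
Qed.

Lemma Gamma_integral_succ (s : C) : (0 < Re s)%R -> Gamma_integral (s + 1) = s * Gamma_integral s.
Proof.
  intros Hs. rewrite (Gamma_integral_mellin s), (Gamma_integral_mellin (s + 1)).
  assert (Hs1 : (0 < Re (s + 1))%R) by (destruct s; simpl in *; lra).
  assert (I1 := is_CInt_gen_mellin _ _ _ _ lower_end_zero mellin_bounded_expo s Hs).
  assert (I2 := is_CInt_gen_mellin _ _ _ _ lower_end_zero mellin_bounded_expo (s + 1) Hs1).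
  (* Integration by parts: P is t^s e^(-t), which vanishes at both ends and has the derivative s
     t^(s-1) e^(-t) - t^s e^(-t). *)
  set (P := fun t => cexp (Re s * ln t - t, Im s * ln t)%R).
  assert (HPm : forall t, Cmod (P t - 0) = exp (Re s * ln t - t)).
  { intros t. replace (P t - 0) with (P t) by ring. unfold P. rewrite Cmod_cexp. reflexivity. }
  assert (I : is_CInt_gen (fun t => s * mterm expo s t - mterm expo (s + 1) t) (at_right 0) infty (0 - 0)%C).
  { apply is_CInt_gen_primitive with (P := P).
    - intros t Ht.
      replace (s * mterm expo s t - mterm expo (s + 1) t)
        with (P t * ((Re s / t - 1)%R, (Im s / t)%R)).
      + apply (is_rderive_comp cexp); [apply is_cderive_cexp|].
        apply is_rderive_pair; auto_derive; try exact Ht; field; lra.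
      + assert (HPt : P t = cpow t s * expo t).
        { unfold P, expo. rewrite cpow_ln, <- cexp_RtoC, <- cexp_plus. f_equal.
          destruct s; apply C_ext; simpl; ring. }
        rewrite HPt. unfold mterm. replace (s + 1 - 1) with s by ring.
        replace (cpow t s) with (cpow t (s - 1) * t).
        2: { rewrite <- (cpow_1 t Ht). rewrite <- cpow_plus. f_equal. ring. }
        replace ((Re s / t - 1)%R, (Im s / t)%R) with (s / t - 1).
        * field. intros E. apply RtoC_inj in E. lra.
        * unfold Cdiv. rewrite <- RtoC_inv by lra. destruct s; apply C_ext; simpl; field; lra.
    - intros t Ht. assert (R1 := rcont_mterm _ _ _ _ lower_end_zero mellin_bounded_expo s t Ht).
      assert (R2 := rcont_mterm _ _ _ _ lower_end_zero mellin_bounded_expo (s + 1) t Ht).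
      apply rcont_minus; [apply rcont_mult; [apply rcont_const | exact R1] | exact R2].
    - intros e He. assert (Hd : (0 < exp (ln e / Re s))%R) by apply exp_pos.
      exists (mkposreal _ Hd). intros y Hy Hy0. rewrite HPm.
      change (Rabs (y - 0) < exp (ln e / Re s))%R in Hy. rewrite Rminus_0_r, Rabs_pos_eq in Hy by lra.
      apply Rlt_le_trans with (exp (ln e)); [apply exp_increasing | rewrite exp_ln; lra].
      assert (L : (ln y < ln e / Re s)%R).
      { apply Rlt_le_trans with (ln (exp (ln e / Re s))); [apply ln_increasing; assumption | rewrite ln_exp; lra]. }
      apply (Rmult_lt_compat_l (Re s)) in L; [|exact Hs].
      replace (Re s * (ln e / Re s))%R with (ln e) in L by (field; lra). lra.
    - intros e He. destruct (exp_growth (Re s)) as [K [HK H]].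
      destruct (exp_half_small K e HK He) as [M HM].
      exists (Rmax M 0). intros t Ht. rewrite HPm.
      assert (Ht0 : (0 < t)%R) by (apply Rle_lt_trans with (2 := Ht), Rmax_r).
      apply Rle_lt_trans with (2 := HM t (Rle_lt_trans _ _ _ (Rmax_l _ _) Ht)).
      apply Rle_trans with (exp (Re s * ln (1 + t) - t / 2) * exp (- (t / 2)))%R.
      + rewrite <- exp_plus. apply exp_le_mono.
        assert (ln t <= ln (1 + t))%R by (apply ln_le_mono; lra). nra.
      + apply Rmult_le_compat_r; [left; apply exp_pos | apply H, Ht0]. }
  assert (I' : is_CInt_gen (fun t => s * mterm expo s t - mterm expo (s + 1) t) (at_right 0) infty
     (s * mellin0 expo s - mellin0 expo (s + 1))%C).
  { apply (is_RInt_gen_minus (V := C_R_NormedModule) (fun t => s * mterm expo s t)); [|exact I2].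
    apply is_CInt_gen_scal; [apply _ .. | exact I1]. }
  assert (E : s * mellin0 expo s - mellin0 expo (s + 1) = 0).
  { rewrite <- (CInt_gen_unique _ _ _ _ I'), (CInt_gen_unique _ _ _ _ I). ring. }
  replace (mellin0 expo (s + 1)) with
    (s * mellin0 expo s - (s * mellin0 expo s - mellin0 expo (s + 1))) by ring.
  rewrite E. ring.
Qed.

Lemma Gamma_integral_1 : Gamma_integral 1 = 1.
Proof.
  rewrite Gamma_integral_mellin. apply CInt_gen_unique; [apply _ .. |].
  apply is_CInt_gen_ext with (fun t => expo t); [apply _ .. | | | |].
  - intros t Ht. unfold mterm. replace (1 - 1) with (RtoC 0) by ring.
    rewrite cpow_ln, Cmult_0_l, cexp_0. symmetry. apply Cmult_1_l.
  - apply at_right_pos.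
  - apply infty_gt.
  - replace (RtoC 1) with (0 - (RtoC (-1))) by (apply C_ext; simpl; ring).
    apply is_CInt_gen_primitive with (P := fun t => RtoC (- exp (- t))%R).
    + intros t _. apply (is_rderive_pair (fun t => - exp (- t))%R (fun _ => 0%R)); auto_derive; trivial; ring.
    + intros t Ht. apply (proj1 mellin_bounded_expo), Ht.
    + intros e He. exists (mkposreal e He). intros y Hy Hy0.
      change (Rabs (y - 0) < e)%R in Hy. rewrite Rminus_0_r, Rabs_pos_eq in Hy by lra.
      replace (RtoC (- exp (- y))%R - RtoC (-1)) with (RtoC (1 - exp (- y))%R) by (apply C_ext; simpl; ring).
      assert (E := exp_ineq1_le (- y)).
      assert (exp (- y) < exp 0)%R by (apply exp_increasing; lra). rewrite exp_0 in *.
      rewrite Cmod_R, Rabs_pos_eq; lra.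
    + intros e He. destruct (exp_half_small 1 e Rle_0_1 He) as [M HM].
      exists (Rmax M 0). intros t Ht.
      assert (Ht0 : (0 < t)%R) by (apply Rle_lt_trans with (2 := Ht), Rmax_r).
      replace (RtoC (- exp (- t))%R - 0) with (RtoC (- exp (- t))%R) by (apply C_ext; simpl; ring).
      rewrite Cmod_R, Rabs_Ropp, Rabs_pos_eq by (left; apply exp_pos).
      apply Rle_lt_trans with (2 := HM t (Rle_lt_trans _ _ _ (Rmax_l _ _) Ht)).
      rewrite Rmult_1_l. apply exp_le_mono. lra.
Qed.

Lemma ex_cderive_Gamma_integral (s : C) : (0 < Re s)%R -> ex_cderive Gamma_integral s.
Proof. apply (ex_cderive_mellin _ _ _ _ lower_end_zero mellin_bounded_expo). Qed.

(** Here t^(Re s - 1) <= 1 + t, so one majorant serves all s of the strip. The strip 0 <= Re s <= 1,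
    where the reflection formula needs a bound, is reached by Gamma (s + 1) = s Gamma s. *)
Lemma Gamma_integral_strip : exists K, forall s, (1 <= Re s <= 2)%R -> (Cmod (Gamma_integral s) <= K)%R.
Proof.
  destruct (exp_growth 3) as [K [HK H]]. exists (K / 1)%R. intros s Hs.
  destruct (dominated_integral _ 0 1 K (mterm expo s) lower_end_zero) as [l [Hl Hb]]; [lra | exact HK | | |].
  - intros t Ht. apply (rcont_mterm _ _ _ _ lower_end_zero mellin_bounded_expo s t Ht).
  - intros t Ht. unfold mterm, expo. rewrite Cmod_mult, Cmod_cpow, Cmod_R, Rabs_pos_eq by (left; apply exp_pos).
    apply Rle_trans with (exp (3 * ln (1 + t) - t / 2) * dom 1 t)%R.
    + unfold dom. rewrite <- !exp_plus. apply exp_le_mono.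
      replace (Re (s - 1)) with (Re s - 1)%R by (destruct s; simpl; ring).
      assert (ln t <= ln (1 + t))%R by (apply ln_le_mono; lra).
      assert (0 <= ln (1 + t))%R by (apply Rle_trans with (ln 1); [rewrite ln_1; lra | apply ln_le_mono; lra]).
      nra.
    + apply Rmult_le_compat_r; [left; apply dom_pos | apply H, Ht].
  - rewrite Gamma_integral_mellin. unfold mellin. rewrite (CInt_gen_unique _ _ _ _ Hl). exact Hb.
Qed.

Lemma Re_plus_INR (s : C) (n : nat) : Re (s + INR n) = (Re s + INR n)%R.
Proof. destruct s; reflexivity. Qed.

Lemma Gamma_eq (N : nat) (z : C) : (0 < Re z + INR N)%R -> Gamma z = Gamma_integral (z + INR N) / rising z N.
Proof.
  intros HN. unfold Gamma. set (n := Z.to_nat (up (- Re z))).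
  destruct (archimed (- Re z)) as [A1 A2].
  assert (Hn : (0 < Re z + INR n)%R).
  { unfold n. rewrite INR_IZR_INZ. assert (K : (up (- Re z) <= Z.of_nat (Z.to_nat (up (- Re z))))%Z) by lia.
    apply IZR_le in K. lra. }
  assert (HnN : (n <= N)%nat).
  { unfold n. destruct (Z_le_gt_dec (up (- Re z)) 0) as [L|L]; [lia|].
    assert (K : (up (- Re z) < Z.of_nat N + 1)%Z).
    { apply lt_IZR. rewrite plus_IZR, <- INR_IZR_INZ. lra. }
    lia. }
  clear HN. induction HnN as [|m Hm IH]; [reflexivity|].
  rewrite IH. simpl rising.
  assert (Hm' : (0 < Re (z + INR m))%R).
  { rewrite Re_plus_INR. apply le_INR in Hm. lra. }
  assert (Hne : z + INR m <> 0).
  { intros E. rewrite E in Hm'. simpl in Hm'. lra. }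
  replace (z + INR (S m)) with (z + INR m + 1) by (rewrite S_INR, RtoC_plus; ring).
  rewrite Gamma_integral_succ by exact Hm'.
  destruct (excluded_middle_informative (rising z m = 0)) as [E|E].
  (* At a pole both denominators are 0, and the convention / 0 = 0 makes the two quotients equal. *)
  - rewrite E, Cmult_0_l. unfold Cdiv. replace (/ 0) with (RtoC 0); [ring|].
    unfold Cinv. apply C_ext; simpl; unfold Rdiv; ring.
  - field. split; assumption.
Qed.

Definition noninteger (s : C) : Prop := forall k : Z, s <> IZR k.

Lemma noninteger_shift (s : C) (j : Z) : noninteger s -> noninteger (s + IZR j).
Proof.
  intros H k E. apply (H (k - j)%Z). rewrite minus_IZR, RtoC_minus, <- E. ring.
Qed.

Lemma noninteger_1_minus (s : C) : noninteger s -> noninteger (1 - s).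
Proof.
  intros H k E. apply (H (1 - k)%Z). rewrite minus_IZR, RtoC_minus, <- E. ring.
Qed.

Lemma rising_front (z : C) (n : nat) : rising z (S n) = z * rising (z + 1) n.
Proof.
  induction n as [|n IH]; [simpl; ring|].
  change (rising z (S (S n))) with (rising z (S n) * (z + INR (S n))). rewrite IH.
  simpl rising. rewrite S_INR, RtoC_plus. ring.
Qed.

Lemma rising_ne (z : C) (n : nat) : (forall k : nat, z <> - INR k) -> rising z n <> 0.
Proof.
  intros H. induction n as [|n IH]; simpl.
  - intros E. apply RtoC_inj in E. lra.
  - apply Cmult_ne; [exact IH|]. intros E. apply (H n).
    replace z with (z + INR n - INR n) by ring. rewrite E. ring.
Qed.

Lemma exists_shift (z : C) (b : R) : exists N : nat, (b < Re z + INR N)%R.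
Proof.
  destruct (archimed (b - Re z)) as [A _]. exists (Z.to_nat (up (b - Re z))).
  rewrite INR_IZR_INZ. assert (K : (up (b - Re z) <= Z.of_nat (Z.to_nat (up (b - Re z))))%Z) by lia.
  apply IZR_le in K. lra.
Qed.

Lemma Gamma_succ (z : C) : (forall k : nat, z <> - INR k) -> Gamma (z + 1) = z * Gamma z.
Proof.
  intros H. destruct (exists_shift z 0) as [N HN].
  assert (Hz0 : z <> 0) by (intros E; apply (H O); rewrite E; simpl; ring).
  rewrite (Gamma_eq (S N) z) by (rewrite S_INR; lra).
  rewrite (Gamma_eq N (z + 1)) by (destruct z; simpl in *; lra).
  replace (z + 1 + INR N) with (z + INR (S N)) by (rewrite S_INR, RtoC_plus; ring).
  rewrite rising_front. field. split; [|exact Hz0].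
  intros E. apply (rising_ne z (S N) H). rewrite rising_front, E. ring.
Qed.

Lemma Gamma_Re_pos (z : C) : (0 < Re z)%R -> Gamma z = Gamma_integral z.
Proof.
  intros H. rewrite (Gamma_eq 0 z); simpl; [|lra]. rewrite Cplus_0_r. field.
Qed.

Lemma Gamma_1 : Gamma 1 = 1.
Proof. rewrite Gamma_Re_pos; [apply Gamma_integral_1 | simpl; lra]. Qed.

Lemma ex_cderive_rising (n : nat) (z : C) : ex_cderive (fun z => rising z n) z.
Proof.
  induction n as [|n IH]; [exact (ex_cderive_const 1 z)|].
  apply (ex_cderive_mult (fun z => rising z n) (fun z => z + INR n)); [exact IH|].
  apply ex_cderive_plus; [apply ex_cderive_id | apply ex_cderive_const].
Qed.

(** The n in the definition of [Gamma] jumps with Re w. A single larger N works on the whole unit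
    disc, so that differentiability and meromorphy can be read off one formula. *)
Lemma Gamma_local (z : C) : exists N : nat, forall w, (Cmod (w - z) < 1)%R ->
  Gamma w = Gamma_integral (w + INR N) / rising w N /\ ex_cderive (fun w => Gamma_integral (w + INR N)) w.
Proof.
  destruct (exists_shift z 1) as [N HN]. exists N. intros w Hw.
  assert (Hr : (0 < Re w + INR N)%R).
  { assert (K := Cmod_Re_le (w - z)). replace (Re (w - z)) with (Re w - Re z)%R in K by (destruct w, z; reflexivity).
    assert (K' : (Rabs (Re w - Re z) < 1)%R) by lra. apply Rabs_lt_between in K'. lra. }
  split; [apply Gamma_eq, Hr|].
  apply (ex_cderive_comp Gamma_integral (fun w => w + INR N)).
  - apply ex_cderive_Gamma_integral. rewrite Re_plus_INR. exact Hr.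
  - apply ex_cderive_plus; [apply ex_cderive_id | apply ex_cderive_const].
Qed.

Lemma ex_cderive_Gamma (z : C) : (forall k : nat, z <> - INR k) -> ex_cderive Gamma z.
Proof.
  intros H. destruct (Gamma_local z) as [N HN].
  apply ex_cderive_local with (f := fun w => Gamma_integral (w + INR N) / rising w N) (d := 1%R); [lra| |].
  - intros w Hw. symmetry. apply HN, Hw.
  - apply ex_cderive_div; [apply rising_ne, H | apply HN, Cmod_self_lt; lra | apply ex_cderive_rising].
Qed.

Lemma mero_at_inv_rising (n : nat) (p : C) : mero_at (fun z => / rising z n) p.
Proof.
  induction n as [|n IH].
  - apply mero_at_ext with (fun _ => RtoC 1); [|apply mero_at_const].
    apply locally'_Cmod. exists 1%R. split; [lra|]. intros. simpl. field.
  - apply mero_at_ext with (fun z => / rising z n * / (z + INR n)).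
    + apply locally'_Cmod. exists 1%R. split; [lra|]. intros w _ _. simpl rising.
      set (x := rising w n). set (y := w + INR n).
      (* By the convention / 0 = 0 the inverse of a product factors even at the zeros, so the
         identity holds on a full disc. *)
      assert (I0 : / RtoC 0 = 0) by (unfold Cinv; apply C_ext; simpl; unfold Rdiv; ring).
      destruct (excluded_middle_informative (x = 0)) as [->|Hx]; [rewrite Cmult_0_l, I0; ring|].
      destruct (excluded_middle_informative (y = 0)) as [->|Hy]; [rewrite Cmult_0_r, I0; ring|].
      field. split; assumption.
    + apply mero_at_mult; [exact IH|].
      destruct (excluded_middle_informative (p = - INR n)) as [->|Hp].
      * apply mero_at_form. exists 1%nat, (fun _ => RtoC 1), 1%R. split; [lra|]. split.
        -- intros; apply ex_cderive_const.
        -- intros z _ Hz. rewrite Cpow_1_r. replace (z - - INR n) with (z + INR n) by ring.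
           unfold Cdiv. ring.
      * apply holomorphic_mero_at, holomorphic_at_Cmod.
        assert (Hpn : p + INR n <> 0).
        { intros E. apply Hp. replace p with (p + INR n - INR n) by ring. rewrite E. ring. }
        exists (Cmod (p + INR n)). split; [apply Cmod_gt_0, Hpn|]. intros w Hw.
        apply ex_cderive_inv; [|apply ex_cderive_plus; [apply ex_cderive_id | apply ex_cderive_const]].
        intros E. replace (w - p) with ((w + INR n) - (p + INR n)) in Hw by ring.
        rewrite E in Hw. replace (0 - (p + INR n)) with (- (p + INR n)) in Hw by ring.
        rewrite Cmod_opp in Hw. lra.
Qed.

Lemma mero_at_Gamma (p : C) : mero_at Gamma p.
Proof.
  destruct (Gamma_local p) as [N HN].
  apply mero_at_ext with (fun w => Gamma_integral (w + INR N) * / rising w N).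
  - apply locally'_Cmod. exists 1%R. split; [lra|]. intros w Hw _. symmetry. apply HN, Hw.
  - apply mero_at_mult; [|apply mero_at_inv_rising].
    apply holomorphic_mero_at, holomorphic_at_Cmod. exists 1%R. split; [lra|].
    intros w Hw. apply HN, Hw.
Qed.

Lemma noninteger_near (p : C) : punctured p noninteger.
Proof.
  apply locally'_Cmod.
  (* If an integer j other than p lies within 1/2 of p, any integer still closer to p is within 1 of
     j, hence equal to j. *)
  destruct (excluded_middle_informative (exists j : Z, RtoC (IZR j) <> p /\ (Cmod (IZR j - p) < 1 / 2)%R)) as [[j [Hj Hjp]]|H].
  - exists (Cmod (IZR j - p)). split; [apply Cmod_gt_0, Cminus_ne, Hj|].
    intros w Hw _ k E. subst w.
    assert (D : (Cmod (IZR k - IZR j) < 1)%R).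
    { apply Rle_lt_trans with (1 := Cmod_triangle3 (IZR k) p (IZR j)). rewrite (Cmod_minus_sym p). lra. }
    rewrite <- RtoC_minus, Cmod_R, <- minus_IZR in D.
    apply Rabs_lt_between in D. destruct D as [D1 D2].
    apply lt_IZR in D2. rewrite <- opp_IZR in D1. apply lt_IZR in D1.
    assert (k = j) by lia. subst k. lra.
  - exists (1 / 2)%R. split; [lra|]. intros w Hw Hwp k E. apply H. exists k. subst w. split; assumption.
Qed.

Lemma noninteger_open (z : C) : noninteger z -> exists d, (0 < d)%R /\
  forall w, (Cmod (w - z) < d)%R -> noninteger w.
Proof.
  intros Hz. destruct (proj1 (locally'_Cmod _ _) (noninteger_near z)) as [d [Hd H]].
  exists d. split; [exact Hd|]. intros w Hw.
  destruct (excluded_middle_informative (w = z)) as [->|E]; [exact Hz | apply H; assumption].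
Qed.

Lemma noninteger_not_pole (z : C) : noninteger z -> forall k : nat, z <> - INR k.
Proof.
  intros H k E. apply (H (- Z.of_nat k)%Z). rewrite opp_IZR, RtoC_opp, <- INR_IZR_INZ. exact E.
Qed.

Lemma noninteger_holomorphic (f : C -> C) (z : C) :
  (forall w, noninteger w -> ex_cderive f w) -> noninteger z -> holomorphic_at f z.
Proof.
  intros Hf Hz. apply holomorphic_at_Cmod. destruct (noninteger_open z Hz) as [d [Hd H]].
  exists d. split; [exact Hd|]. intros w Hw. apply Hf, H, Hw.
Qed.

(** * The reflection formula *)

(* [csin2 s] is 2 i sin (pi s). *)
Definition csin2 (s : C) : C := cexp (PI * Ci * s) - cexp (- (PI * Ci * s)).

Lemma cexp_PI_Ci : cexp (PI * Ci) = - (1).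
Proof.
  replace (PI * Ci) with ((0, PI)%R : C) by (apply C_ext; simpl; ring).
  unfold cexp; simpl. rewrite exp_0, cos_PI, sin_PI. apply C_ext; simpl; ring.
Qed.

Lemma csin2_succ (s : C) : csin2 (s + 1) = - csin2 s.
Proof.
  unfold csin2. replace (PI * Ci * (s + 1)) with (PI * Ci * s + PI * Ci) by ring.
  replace (- (PI * Ci * s + PI * Ci)) with (- (PI * Ci * s) + - (PI * Ci)) by ring.
  rewrite !cexp_plus, (cexp_opp (PI * Ci)), cexp_PI_Ci. field.
Qed.

Lemma is_cderive_csin2 (s : C) :
  is_cderive csin2 s (PI * Ci * (cexp (PI * Ci * s) + cexp (- (PI * Ci * s))))%C.
Proof.
  assert (L : is_cderive (fun s => PI * Ci * s) s (PI * Ci)%C).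
  { eapply is_cderive_val; [apply is_cderive_mult; [apply is_cderive_const | apply is_cderive_id]|]. simpl. ring. }
  eapply is_cderive_val.
  - apply is_cderive_minus.
    + apply (is_cderive_comp cexp); [apply is_cderive_cexp | exact L].
    + apply (is_cderive_comp cexp); [apply is_cderive_cexp | apply is_cderive_opp, L].
  - simpl. ring.
Qed.

Lemma ex_cderive_csin2 (s : C) : ex_cderive csin2 s.
Proof. eexists. apply is_cderive_csin2. Qed.

Lemma csin2_ne (s : C) : noninteger s -> csin2 s <> 0.
Proof.
  intros Hs E. pose proof PI_RGT_0 as HPI.
  assert (E1 : cexp (2 * (PI * Ci * s)) = 1).
  { replace (2 * (PI * Ci * s)) with (PI * Ci * s + PI * Ci * s) by ring. rewrite cexp_plus.
    unfold csin2 in E. rewrite cexp_opp in E.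
    assert (K := cexp_ne (PI * Ci * s)).
    replace (cexp (PI * Ci * s) * cexp (PI * Ci * s)) with
      ((cexp (PI * Ci * s) - / cexp (PI * Ci * s)) * cexp (PI * Ci * s) + 1) by (field; exact K).
    rewrite E. ring. }
  destruct s as [x y].
  assert (E2 : (2 * (PI * Ci * (x, y))) = ((- 2 * PI * y)%R, (2 * (PI * x))%R)).
  { apply C_ext; simpl; ring. }
  rewrite E2 in E1.
  assert (Hy : y = 0%R).
  { assert (M := Cmod_cexp ((- 2 * PI * y)%R, (2 * (PI * x))%R)). rewrite E1, Cmod_1 in M. simpl in M.
    rewrite <- exp_0 in M. apply exp_inv in M. nra. }
  assert (Hc : cos (2 * (PI * x)) = 1%R).
  { apply (f_equal Re) in E1. unfold cexp in E1. simpl in E1. rewrite Hy in E1.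
    replace (- 2 * PI * 0)%R with 0%R in E1 by ring. rewrite exp_0 in E1. lra. }
  rewrite cos_2a_sin in Hc.
  assert (Hsin : sin (PI * x) = 0%R) by nra.
  destruct (sin_eq_0_0 _ Hsin) as [k Hk].
  apply (Hs k). apply C_ext; simpl; [nra | exact Hy].
Qed.

Lemma csin2_large (s : C) : (1 <= Rabs (Im s))%R -> (1 <= Cmod (csin2 s))%R.
Proof.
  intros H. pose proof PI_RGT_0 as HPI. pose proof PI2_1 as HPI2.
  unfold csin2. set (u := PI * Ci * s).
  assert (Hu : Re u = (- PI * Im s)%R) by (unfold u; destruct s; simpl; ring).
  assert (H1 := Cmod_triangle_rev (cexp u) (cexp (- u))).
  assert (H2 := Cmod_triangle_rev (cexp (- u)) (cexp u)). rewrite (Cmod_minus_sym (cexp (- u))) in H2.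
  rewrite !Cmod_cexp in *. replace (Re (- u)) with (- Re u)%R in * by (destruct u; reflexivity).
  assert (K : forall w, (1 <= w)%R -> (2 <= exp (PI * w) /\ exp (- (PI * w)) <= 1)%R).
  { intros w Hw. split.
    - apply Rle_trans with (2 := exp_ineq1_le _). nra.
    - apply Rle_trans with (exp 0); [apply exp_le_mono; nra | rewrite exp_0; lra]. }
  rewrite Hu in *. destruct (Rle_lt_dec 0 (Im s)) as [L|L].
  - rewrite Rabs_pos_eq in H by exact L. destruct (K _ H) as [K1 K2].
    replace (- (- PI * Im s))%R with (PI * Im s)%R in * by ring.
    replace (- PI * Im s)%R with (- (PI * Im s))%R in * by ring. lra.
  - rewrite Rabs_left in H by exact L. destruct (K _ H) as [K1 K2].
    replace (PI * - Im s)%R with (- PI * Im s)%R in * by ring. lra.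
Qed.

Definition refl_defect (s : C) : C := Gamma s * Gamma (1 - s) - 2 * PI * Ci / csin2 s.

Lemma ex_cderive_1_minus (f : C -> C) (z : C) : ex_cderive f (1 - z) -> ex_cderive (fun z => f (1 - z)) z.
Proof.
  intros H. apply (ex_cderive_comp f (fun z => 1 - z)); [exact H|].
  apply ex_cderive_minus; [apply ex_cderive_const | apply ex_cderive_id].
Qed.

Lemma ex_cderive_refl_defect (s : C) : noninteger s -> ex_cderive refl_defect s.
Proof.
  intros Hs. apply ex_cderive_minus.
  - apply ex_cderive_mult.
    + apply ex_cderive_Gamma, noninteger_not_pole, Hs.
    + apply ex_cderive_1_minus, ex_cderive_Gamma, noninteger_not_pole, noninteger_1_minus, Hs.
  - apply ex_cderive_div; [apply csin2_ne, Hs | apply ex_cderive_const | apply ex_cderive_csin2].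
Qed.

Lemma refl_defect_succ (s : C) : noninteger s -> refl_defect (s + 1) = - refl_defect s.
Proof.
  intros Hs. unfold refl_defect.
  rewrite Gamma_succ by apply noninteger_not_pole, Hs.
  replace (Gamma (1 - s)) with (- s * Gamma (1 - (s + 1))).
  - rewrite csin2_succ. field. apply csin2_ne, Hs.
  - replace (1 - (s + 1)) with (- s) by ring. replace (1 - s) with (- s + 1) by ring.
    rewrite Gamma_succ; [ring|]. apply noninteger_not_pole.
    intros k E. apply (Hs (- k)%Z). rewrite opp_IZR, RtoC_opp, <- E. ring.
Qed.

(* Both terms of the defect have residue 1 at 0. *)
Lemma refl_defect_0 : exists g, ccont g 0 /\
  punctured (RtoC 0) (fun z => refl_defect z = g z).
Proof.
  assert (E0 : forall z : C, z - 0 = z) by (intros; ring).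
  assert (S0 : csin2 0 = 0).
  { unfold csin2. rewrite Cmult_0_r. replace (- 0) with (RtoC 0) by ring. ring. }
  destruct (divide_zero csin2 0 1 Rlt_0_1 (fun z _ => ex_cderive_csin2 z) S0) as [k [Hk Ek]].
  assert (Hne : 2 * PI * Ci <> 0).
  { pose proof PI_RGT_0. intros E. apply (f_equal Im) in E. simpl in E. lra. }
  assert (k0 : k 0 = 2 * PI * Ci).
  { destruct (Hk 0 (Cmod_self_lt 0 1 Rlt_0_1)) as [l Hl].
    assert (D : is_cderive csin2 (RtoC 0) (k (RtoC 0))).
    { apply is_cderive_local with (f := fun z => (z - 0) * k z) (d := 1%R); [lra | intros w _; symmetry; apply Ek|].
      eapply is_cderive_val; [apply is_cderive_mult; [apply is_cderive_minus; [apply is_cderive_id | apply is_cderive_const] | exact Hl]|].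
      simpl. ring. }
    rewrite (is_cderive_unique _ _ _ _ D (is_cderive_csin2 (RtoC 0))).
    rewrite Cmult_0_r. replace (- 0) with (RtoC 0) by ring. rewrite cexp_0. ring. }
  assert (Ck := ex_cderive_ccont _ _ (Hk 0 (Cmod_self_lt 0 1 Rlt_0_1))).
  destruct (Ck (Cmod (k 0))) as [d [Hd Kne]].
  { apply Cmod_gt_0. rewrite k0. exact Hne. }
  assert (Kne' : forall z, (Cmod z < d)%R -> k z <> 0).
  { intros z Hz E. specialize (Kne z). rewrite E0 in Kne. specialize (Kne Hz).
    rewrite E in Kne. replace (0 - k 0) with (- k 0) in Kne by ring. rewrite Cmod_opp in Kne. lra. }
  set (r := Rmin d (1 / 2)). assert (Hr : (0 < r)%R) by (apply Rmin_pos; lra).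
  assert (Hr1 : (r <= d)%R) by apply Rmin_l. assert (Hr2 : (r <= 1 / 2)%R) by apply Rmin_r.
  assert (HG : forall z, (Cmod z < r)%R -> (0 < Re (z + 1) /\ 0 < Re (1 - z))%R).
  { intros z Hz. assert (K := Cmod_Re_le z). assert (K' : (Rabs (Re z) < 1 / 2)%R) by lra.
    apply Rabs_lt_between in K'. destruct z; simpl in *. lra. }
  assert (Pos : forall z : C, (0 < Re z)%R -> forall n : nat, z <> - INR n).
  { intros z Hz n E. rewrite E in Hz. simpl in Hz. pose proof (pos_INR n). lra. }
  (* Off 0 this is z times the defect, free of the pole; it vanishes at 0 because Gamma 1 = 1 and k
     0 = 2 pi i. *)
  set (u := fun z => Gamma (z + 1) * Gamma (1 - z) - 2 * PI * Ci / k z).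
  destruct (divide_zero u 0 r Hr) as [g [Hg Eg]].
  - intros z Hz. rewrite E0 in Hz. destruct (HG z Hz) as [G1 G2]. apply ex_cderive_minus.
    + apply ex_cderive_mult.
      * apply (ex_cderive_comp Gamma (fun z => z + 1)); [apply ex_cderive_Gamma, Pos, G1|].
        apply ex_cderive_plus; [apply ex_cderive_id | apply ex_cderive_const].
      * apply ex_cderive_1_minus, ex_cderive_Gamma, Pos, G2.
    + apply ex_cderive_div; [apply Kne'; lra | apply ex_cderive_const | apply Hk; rewrite E0; lra].
  - unfold u. rewrite k0, Cplus_0_l. replace (1 - 0) with (RtoC 1) by ring. rewrite Gamma_1.
    field. split; [intros E; apply (f_equal Im) in E; simpl in E; lra|].
    intros E. apply RtoC_inj in E. pose proof PI_RGT_0. lra.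
  - exists g. split; [apply ex_cderive_ccont, Hg; rewrite E0, Cmod_0; exact Hr|].
    apply locally'_Cmod. exists r. split; [exact Hr|]. intros z Hz Hz0. rewrite E0 in Hz.
    assert (Eu := Eg z). rewrite E0 in Eu. unfold refl_defect. rewrite Ek, E0.
    assert (HK : k z <> 0) by (apply Kne'; lra).
    assert (Gz : Gamma (z + 1) = z * Gamma z).
    { apply Gamma_succ. intros [|n] E; [apply Hz0; rewrite E; simpl; ring|].
      rewrite E in Hz. rewrite Cmod_opp, Cmod_R, Rabs_pos_eq, S_INR in Hz by apply pos_INR.
      pose proof (pos_INR n). lra. }
    unfold u in Eu. rewrite Gz in Eu.
    replace (g z) with (z * g z / z) by (field; exact Hz0). rewrite <- Eu. field.
    split; assumption.
Qed.

Lemma locally'_translate (P : C -> Prop) (p c : C) :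
  punctured (p + c) P -> punctured p (fun z => P (z + c)).
Proof.
  rewrite !locally'_Cmod. intros [d [Hd H]]. exists d. split; [exact Hd|]. intros w Hw Hwp.
  apply H; [replace (w + c - (p + c)) with (w - p) by ring; exact Hw|].
  intros E. apply Hwp. replace w with (w + c - c) by ring. rewrite E. ring.
Qed.

Lemma locally'_and (P Q : C -> Prop) (p : C) : punctured p P ->
  punctured p Q -> punctured p (fun z => P z /\ Q z).
Proof. apply filter_and. Qed.

Lemma locally'_imp (P Q : C -> Prop) (p : C) : (forall z, P z -> Q z) ->
  punctured p P -> punctured p Q.
Proof. intros H. apply filter_imp. exact H. Qed.

Lemma ccont_translate (g : C -> C) (p c : C) : ccont g (p + c) -> ccont (fun z => g (z + c)) p.
Proof.
  intros H. apply (ccont_comp g (fun z => z + c)); [exact H|].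
  apply ex_cderive_ccont, ex_cderive_plus; [apply ex_cderive_id | apply ex_cderive_const].
Qed.

Lemma ccont_opp (g : C -> C) (p : C) : ccont g p -> ccont (fun z => - g z) p.
Proof.
  intros H e He. destruct (H e He) as [d [Hd H']]. exists d. split; [exact Hd|]. intros w Hw.
  replace (- g w - - g p) with (- (g w - g p)) by ring. rewrite Cmod_opp. apply H', Hw.
Qed.

(** The singularity at 0 is removable, and the relation between s and s + 1 transports this to all
    integers in both directions. *)
Lemma refl_defect_integer (n : nat) :
  (exists g, ccont g (INR n) /\ punctured (RtoC (INR n)) (fun z => refl_defect z = g z)) /\
  (exists g, ccont g (- INR n) /\ punctured (- RtoC (INR n)) (fun z => refl_defect z = g z)).
Proof.
  induction n as [|n [[g [Hg Eg]] [g' [Hg' Eg']]]].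
  - split; [exact refl_defect_0|]. simpl. replace (- 0) with (RtoC 0) by ring. exact refl_defect_0.
  - split.
    + exists (fun z => - g (z + - (1))).
      assert (E : RtoC (INR (S n)) + - (1) = INR n) by (rewrite S_INR, RtoC_plus; ring).
      split; [apply ccont_opp, ccont_translate; rewrite E; exact Hg|].
      rewrite <- E in Eg. apply locally'_translate in Eg.
      assert (N := noninteger_near (INR (S n))).
      generalize (locally'_and _ _ _ Eg N). apply locally'_imp. intros z [H1 H2].
      assert (Hz : noninteger (z + - (1))).
      { replace (- (1)) with (RtoC (IZR (-1))) by (apply C_ext; simpl; ring). apply noninteger_shift, H2. }
      rewrite <- H1, <- refl_defect_succ by exact Hz. f_equal. ring.
    + exists (fun z => - g' (z + 1)).
      assert (E : - RtoC (INR (S n)) + 1 = - INR n) by (rewrite S_INR, RtoC_plus; ring).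
      split; [apply ccont_opp, ccont_translate; rewrite E; exact Hg'|].
      rewrite <- E in Eg'. apply locally'_translate in Eg'.
      assert (N := noninteger_near (- INR (S n))).
      generalize (locally'_and _ _ _ Eg' N). apply locally'_imp. intros z [H1 H2].
      rewrite <- H1, refl_defect_succ by exact H2. ring.
Qed.

Lemma mero_at_comp_1_minus (f : C -> C) (p : C) : mero_at f (1 - p) -> mero_at (fun z => f (1 - z)) p.
Proof.
  intros H. apply mero_at_ext with (fun z => f (- (1) * z + 1)).
  - apply locally'_Cmod. exists 1%R. split; [lra|]. intros w _ _. f_equal. ring.
  - apply mero_at_affine; [apply Cmod_m1|].
    replace (- (1) * p + 1) with (1 - p) by ring. exact H.
Qed.

(** F p is the value at p of some continuous extension chosen around p. Off the integers it has to
    be the defect itself; at an integer F is continuous, and the singularity is removable. *)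
Lemma ex_entire_refl_defect : exists F : C -> C,
  (forall z, ex_cderive F z) /\ (forall z, noninteger z -> F z = refl_defect z).
Proof.
  assert (M : forall p, exists g, ccont g p /\ punctured p (fun z => refl_defect z = g z)).
  { intros p. destruct (excluded_middle_informative (noninteger p)) as [Hp|Hp].
    - exists refl_defect. split; [apply ex_cderive_ccont, ex_cderive_refl_defect, Hp|].
      apply locally'_Cmod. exists 1%R. split; [lra|reflexivity].
    - apply not_all_ex_not in Hp. destruct Hp as [k Hk]. apply NNPP in Hk. subst p.
      destruct (refl_defect_integer (Z.to_nat k)) as [K _].
      destruct (refl_defect_integer (Z.to_nat (- k))) as [_ K'].
      destruct (Z_le_gt_dec 0 k) as [L|L].
      + replace (IZR k) with (INR (Z.to_nat k)); [exact K|]. rewrite INR_IZR_INZ, Z2Nat.id; [reflexivity | lia].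
      + replace (RtoC (IZR k)) with (- RtoC (INR (Z.to_nat (- k)))); [exact K'|].
        rewrite INR_IZR_INZ, Z2Nat.id by lia. rewrite opp_IZR, RtoC_opp. ring. }
  set (sel := fun p => constructive_indefinite_description _ (M p)).
  set (F := fun p => proj1_sig (sel p) p).
  assert (HF : forall z, noninteger z -> F z = refl_defect z).
  { intros z Hz. unfold F. destruct (sel z) as [g [Hg Eg]]. simpl. symmetry.
    apply (punctured_value refl_defect g); [apply ex_cderive_ccont, ex_cderive_refl_defect, Hz | exact Hg | exact Eg]. }
  assert (D : forall z, noninteger z -> ex_cderive F z).
  { intros z Hz. destruct (noninteger_open z Hz) as [d [Hd H]].
    apply ex_cderive_local with (f := refl_defect) (d := d); [exact Hd | | apply ex_cderive_refl_defect, Hz].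
    intros w Hw. symmetry. apply HF, H, Hw. }
  exists F. split; [|exact HF]. intros p.
  destruct (proj1 (locally'_Cmod _ _) (noninteger_near p)) as [d [Hd N]].
  apply removable_singularity with (d := d); [exact Hd | | intros z Hz Hzp; apply D, N; assumption].
  assert (Hsel : exists g, F p = g p /\ ccont g p /\
     punctured p (fun z => refl_defect z = g z)).
  { exists (proj1_sig (sel p)). split; [reflexivity|]. apply (proj2_sig (sel p)). }
  destruct Hsel as [g [E [Hg Eg]]].
  apply locally'_Cmod in Eg. destruct Eg as [d' [Hd' Eg]].
  apply ccont_local with (f := g) (d := Rmin d d'); [apply Rmin_pos; assumption | | exact Hg].
  intros w Hw. destruct (excluded_middle_informative (w = p)) as [->|Hwp]; [symmetry; exact E|].
  rewrite HF.
  - symmetry. apply Eg; [apply (Rlt_Rmin_r Hw) | exact Hwp].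
  - apply N; [apply (Rlt_Rmin_l Hw) | exact Hwp].
Qed.

Lemma refl_defect_bounded : exists M : R, forall s, (0 <= Re s <= 1)%R -> (1 <= Rabs (Im s))%R ->
  (Cmod (refl_defect s) <= M)%R.
Proof.
  destruct Gamma_integral_strip as [K HK]. pose proof PI_RGT_0 as HPI.
  exists (K * K + 2 * PI)%R. intros s Hs Hi.
  assert (Hns : noninteger s).
  { intros k E. rewrite E in Hi. simpl in Hi. rewrite Rabs_R0 in Hi. lra. }
  (* Gamma w = Gamma (w + 1) / w, where |w| >= |Im w| >= 1 and w + 1 lies in the strip already
     bounded. *)
  assert (B : forall w : C, (1 <= Rabs (Im w))%R -> (0 <= Re w <= 1)%R -> noninteger w -> (Cmod (Gamma w) <= K)%R).
  { intros w Hw Hw1 Hn.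
    assert (Hw0 : w <> 0) by (apply (Hn 0%Z)).
    assert (E : Gamma (w + 1) = w * Gamma w) by (apply Gamma_succ, noninteger_not_pole, Hn).
    assert (Hr : Re (w + 1) = (Re w + 1)%R) by (destruct w; reflexivity).
    rewrite Gamma_Re_pos in E by lra.
    assert (HB := HK (w + 1) ltac:(lra)). rewrite E, Cmod_mult in HB.
    assert (1 <= Cmod w)%R by (apply Rle_trans with (1 := Hw), Cmod_Im_le).
    pose proof (Cmod_ge_0 (Gamma w)). nra. }
  assert (B1 := B s Hi Hs Hns).
  assert (B2 : (Cmod (Gamma (1 - s)) <= K)%R).
  { apply B; [| |apply noninteger_1_minus, Hns].
    - replace (Im (1 - s)) with (- Im s)%R by (destruct s; simpl; ring). rewrite Rabs_Ropp. exact Hi.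
    - destruct s; simpl in *; lra. }
  unfold refl_defect. apply Rle_trans with (1 := Cmod_triangle_minus _ _).
  rewrite Cmod_mult, Cmod_div by (apply csin2_ne, Hns).
  rewrite !Cmod_mult, Cmod_Ci, !Cmod_R, !Rabs_pos_eq by lra.
  assert (HS := csin2_large s Hi).
  apply Rplus_le_compat.
  - apply Rmult_le_compat; try apply Cmod_ge_0; assumption.
  - apply Rmult_le_reg_r with (Cmod (csin2 s)); [lra|]. unfold Rdiv.
    rewrite Rmult_assoc, Rinv_l by lra. nra.
Qed.

(** Bisection again: an unbounded function is unbounded on some quarter, but continuity bounds it
    near the limit point. *)
Lemma bounded_on_rect (f : C -> C) (a b c d : R) : (a <= b)%R -> (c <= d)%R -> (forall z, ccont f z) ->
  exists M : R, on_rect (fun z => (Cmod (f z) <= M)%R) a b c d.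
Proof.
  intros Hab Hcd Hf.
  set (Bad := fun a b c d => ~ exists M : R, on_rect (fun z => (Cmod (f z) <= M)%R) a b c d).
  apply NNPP. intros HB.
  destruct (bisection Bad) with (a := a) (b := b) (c := c) (d := d) as (x & y & _ & _ & H); try assumption.
  - intros a' b' c' d' Ha' Hc' HB'. apply NNPP. intros N. apply HB'.
    assert (N1 : ~ ~ exists M : R, on_rect (fun z => (Cmod (f z) <= M)%R) a' ((a' + b') / 2) c' ((c' + d') / 2)) by (unfold Bad in N; tauto).
    assert (N2 : ~ ~ exists M : R, on_rect (fun z => (Cmod (f z) <= M)%R) ((a' + b') / 2) b' c' ((c' + d') / 2)) by (unfold Bad in N; tauto).
    assert (N3 : ~ ~ exists M : R, on_rect (fun z => (Cmod (f z) <= M)%R) a' ((a' + b') / 2) ((c' + d') / 2) d') by (unfold Bad in N; tauto).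
    assert (N4 : ~ ~ exists M : R, on_rect (fun z => (Cmod (f z) <= M)%R) ((a' + b') / 2) b' ((c' + d') / 2) d') by (unfold Bad in N; tauto).
    apply NNPP in N1, N2, N3, N4.
    destruct N1 as [M1 N1], N2 as [M2 N2], N3 as [M3 N3], N4 as [M4 N4].
    exists (Rmax (Rmax M1 M2) (Rmax M3 M4)). intros u v Hu Hv.
    assert (R1 := Rmax_l M1 M2). assert (R2 := Rmax_r M1 M2). assert (R3 := Rmax_l M3 M4). assert (R4 := Rmax_r M3 M4).
    assert (R5 := Rmax_l (Rmax M1 M2) (Rmax M3 M4)). assert (R6 := Rmax_r (Rmax M1 M2) (Rmax M3 M4)).
    destruct (Rle_lt_dec u ((a' + b') / 2)); destruct (Rle_lt_dec v ((c' + d') / 2)).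
    + assert (Q := N1 u v ltac:(lra) ltac:(lra)). simpl in Q. lra.
    + assert (Q := N3 u v ltac:(lra) ltac:(lra)). simpl in Q. lra.
    + assert (Q := N2 u v ltac:(lra) ltac:(lra)). simpl in Q. lra.
    + assert (Q := N4 u v ltac:(lra) ltac:(lra)). simpl in Q. lra.
  - destruct (Hf (x, y) 1%R Rlt_0_1) as [e [He Hfe]].
    destruct (H (e / 2)%R) as (a' & b' & c' & d' & Ha' & Hb' & Hc' & Hd' & Hw & Hh & HB'); [lra|].
    apply HB'. exists (Cmod (f (x, y)) + 1)%R. intros u v Hu Hv.
    assert (Q : (Cmod (f (u, v) - f (x, y)) < 1)%R).
    { apply Hfe. apply Rle_lt_trans with (1 := Cmod_le_Re_Im _). simpl.
      apply Rlt_le_trans with (e / 2 + e / 2)%R; [|lra].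
      apply Rplus_lt_compat; apply Rabs_lt_between; lra. }
    assert (T := Cmod_triangle_rev (f (u, v)) (f (x, y))). lra.
Qed.

Theorem Gamma_reflection (s : C) : noninteger s -> Gamma s * Gamma (1 - s) * csin2 s = 2 * PI * Ci.
Proof.
  destruct ex_entire_refl_defect as [F [HF EF]].
  assert (CF : forall z, ccont F z) by (intros z; apply ex_cderive_ccont, HF).
  assert (Anti : forall z, F (z + 1) = - F z).
  { intros z. apply (punctured_value (fun z => F (z + 1)) (fun z => - F z)).
    - apply ccont_translate, CF.
    - apply ccont_opp, CF.
    - generalize (noninteger_near z). apply locally'_imp. intros w Hw.
      rewrite (EF w Hw), EF, refl_defect_succ by (exact Hw || exact (noninteger_shift w 1 Hw)). reflexivity. }
  assert (Per : forall n z, Cmod (F (z + INR n)) = Cmod (F z)).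
  { induction n as [|n IH]; intros z; [simpl; rewrite Cplus_0_r; reflexivity|].
    replace (z + INR (S n)) with (z + INR n + 1) by (rewrite S_INR, RtoC_plus; ring).
    rewrite Anti, Cmod_opp. apply IH. }
  assert (PerZ : forall k z, Cmod (F (z + IZR k)) = Cmod (F z)).
  { intros k z. destruct (Z_le_gt_dec 0 k) as [L|L].
    - rewrite <- (Per (Z.to_nat k) z), INR_IZR_INZ, Z2Nat.id by lia. reflexivity.
    - rewrite <- (Per (Z.to_nat (- k)) (z + IZR k)), INR_IZR_INZ, Z2Nat.id by lia.
      f_equal. f_equal. rewrite opp_IZR, RtoC_opp. ring. }
  destruct (bounded_on_rect F 0 1 (- 1) 1) as [M1 H1]; [lra | lra | exact CF |].
  destruct refl_defect_bounded as [M2 H2].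
  assert (Strip : forall z, (0 <= Re z <= 1)%R -> (Cmod (F z) <= Rmax M1 M2)%R).
  { intros z Hz. destruct (Rle_lt_dec (Rabs (Im z)) 1) as [L|L].
    - apply Rle_trans with (2 := Rmax_l _ _). destruct z as [x y]. apply Rabs_le_between in L. apply H1; simpl in *; lra.
    - apply Rle_trans with (2 := Rmax_r _ _). rewrite EF; [apply H2; lra|].
      intros k E. rewrite E in L. simpl in L. rewrite Rabs_R0 in L. lra. }
  (* |F| has period 1, and translation by 1 - [up (Re z)] brings the real part into [0, 1). *)
  assert (Bd : forall z, (Cmod (F z) <= Rmax M1 M2)%R).
  { intros z. destruct (archimed (Re z)) as [A1 A2].
    rewrite <- (PerZ (1 - up (Re z))%Z). apply Strip.
    replace (Re (z + IZR (1 - up (Re z)))) with (Re z + IZR (1 - up (Re z)))%R by (destruct z; reflexivity).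
    rewrite minus_IZR. lra. }
  assert (Const := liouville F _ HF Bd).
  (* A constant that changes sign under z -> z + 1 is 0. *)
  assert (Z0 : F 0 = 0).
  { assert (E := Anti 0). rewrite (Const (0 + 1)) in E.
    replace (F 0) with ((F 0 + F 0) / 2) by field. rewrite E at 2.
    field. }
  intros Hs. assert (E := EF s Hs). rewrite Const, Z0 in E. unfold refl_defect in E.
  assert (Hc := csin2_ne s Hs).
  replace (Gamma s * Gamma (1 - s)) with (Gamma s * Gamma (1 - s) - 2 * PI * Ci / csin2 s + 2 * PI * Ci / csin2 s) by ring.
  rewrite <- E. field. exact Hc.
Qed.

(** * Dirichlet series as Mellin transforms *)

(** Off the integers the product in the reflection formula is not 0; at the positive integers the
    functional equation starts from Gamma 1 = 1. *)
Lemma Gamma_ne (s : C) : (forall k : nat, s <> - INR k) -> Gamma s <> 0.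
Proof.
  intros H. destruct (excluded_middle_informative (noninteger s)) as [Hn|Hn].
  - intros E. assert (K := Gamma_reflection s Hn). rewrite E in K.
    pose proof PI_RGT_0. apply (f_equal Im) in K. simpl in K. lra.
  - apply not_all_ex_not in Hn. destruct Hn as [k Hk]. apply NNPP in Hk. subst s.
    assert (P : forall n : nat, Gamma (INR (S n)) <> 0).
    { induction n as [|n IH].
      - replace (RtoC (INR 1)) with (RtoC 1) by reflexivity. rewrite Gamma_1. intros E. apply RtoC_inj in E. lra.
      - replace (RtoC (INR (S (S n)))) with (INR (S n) + 1) by (rewrite (S_INR (S n)), RtoC_plus; reflexivity).
        assert (Hp := pos_INR n).
        rewrite Gamma_succ.
        + apply Cmult_ne; [|exact IH]. rewrite S_INR. intros E. apply RtoC_inj in E. lra.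
        + intros j E. rewrite S_INR in E. rewrite <- RtoC_opp in E. apply RtoC_inj in E. pose proof (pos_INR j). lra. }
    destruct (Z_le_gt_dec k 0) as [L|L].
    + exfalso. apply (H (Z.to_nat (- k))). rewrite INR_IZR_INZ, Z2Nat.id by lia.
      rewrite opp_IZR, RtoC_opp. ring.
    + replace (IZR k) with (INR (S (Z.to_nat (k - 1)))); [apply P|].
      rewrite INR_IZR_INZ. f_equal. lia.
Qed.

Lemma Re_pos_not_pole (z : C) : (0 < Re z)%R -> forall n : nat, z <> - INR n.
Proof. intros Hz n E. rewrite E in Hz. simpl in Hz. pose proof (pos_INR n). lra. Qed.

Notation is_Cseries := (is_series (K := C_AbsRing) (V := C_NormedModule)).
Notation sumC := (sum_n (G := C_AbelianGroup)).
Notation sumR := (sum_n (G := R_AbelianGroup)).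

Lemma is_series_eps (u : nat -> C) (l : C) :
  (forall e : R, (0 < e)%R -> exists N, forall n, (N <= n)%nat ->
     (Cmod (sumC u n - l) < e)%R) ->
  is_Cseries u l.
Proof.
  intros H P HP. apply locally_Cmod in HP. destruct HP as [e [He HP]].
  destruct (H e He) as [N HN]. exists N. intros n Hn. apply HP, HN, Hn.
Qed.

(* The term (n+1)^(-s) of a Dirichlet series is the Mellin transform of
   e^(-(n+1)t) divided by Gamma(s); the bound on the remainder of the power
   series in e^(-t) is integrable even where the Dirichlet series converges
   only conditionally. *)
Lemma dirichlet_mellin (a : nat -> R) (F : R -> R) (al K : R) : (0 <= al)%R -> (0 <= K)%R ->
  (forall t, (0 < t)%R -> continuous F t) ->
  (forall n t, (0 < t)%R -> (Rabs (F t - sumR (fun k => a (S k) * exp (- (INR (S k) * t)))%R n)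
     <= K * (weight al t * exp (- (INR (S n) * t))))%R) ->
  mellin_bounded 0 al (fun t => RtoC (F t)) /\
  forall s, (al < Re s)%R ->
    is_Cseries (dirichlet_term a s)
      (mellin0 (fun t => RtoC (F t)) s / Gamma s)%C.
Proof.
  intros Hal HK HF HR.
  assert (MB : mellin_bounded 0 al (fun t => RtoC (F t))).
  { split; [intros t Ht; apply rcont_RtoC, HF, Ht|].
    exists (Rabs (a 1%nat) + K)%R. split; [pose proof (Rabs_pos (a 1%nat)); lra|]. intros t Ht.
    rewrite Cmod_R. assert (H := HR O t Ht). rewrite sum_O in H. simpl in H. rewrite Rmult_1_l in H.
    assert (W := weight_ge_1 al t Hal Ht).
    assert (E : (exp (- t) <= exp (- t / 2))%R) by (apply exp_le_mono; lra).
    assert (Ep := exp_pos (- t)).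
    replace (F t) with ((F t - a 1%nat * exp (- t)) + a 1%nat * exp (- t))%R by ring.
    apply Rle_trans with (1 := Rabs_triang _ _).
    rewrite Rabs_mult, (Rabs_pos_eq (exp (- t))) by lra.
    assert (Hwe : (exp (- t) <= weight al t * exp (- t / 2))%R) by nra.
    assert (Hwe2 : (weight al t * exp (- t) <= weight al t * exp (- t / 2))%R) by (apply Rmult_le_compat_l; lra).
    pose proof (Rabs_pos (a 1%nat)). nra. }
  split; [exact MB|]. intros s Hs.
  assert (Hs0 : (0 < Re s)%R) by lra.
  assert (HG : Gamma s <> 0) by (apply Gamma_ne, Re_pos_not_pole, Hs0).
  set (f := fun t => RtoC (F t)).
  set (S_ := fun (n : nat) (t : R) => RtoC (sumR (fun k => a (S k) * exp (- (INR (S k) * t)))%R n)).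
  assert (IS : forall n, is_CInt_gen (mterm (S_ n) s) (at_right 0) infty
     (Gamma s * sumC (dirichlet_term a s) n)%C).
  { assert (I1 : forall k : nat, is_CInt_gen (fun t => a (S k) * mterm (fun t => expo (INR (S k) * t)%R) s t) (at_right 0) infty
      (a (S k) * (cpow (INR (S k)) (- s) * Gamma s))%C).
    { intros k. apply is_CInt_gen_scal; [apply _ .. |].
      apply is_CInt_gen_mterm_dilate; [rewrite S_INR; pose proof (pos_INR k); lra|].
      rewrite Gamma_Re_pos, Gamma_integral_mellin by exact Hs0.
      apply (is_CInt_gen_mellin _ _ _ _ lower_end_zero mellin_bounded_expo s Hs0). }
    assert (PosL : at_right 0 (fun a => 0 < a)%R) by apply at_right_pos.
    induction n as [|n IH].
    - rewrite sum_O.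
      replace (Gamma s * dirichlet_term a s 0) with (a 1%nat * (cpow (INR 1) (- s) * Gamma s)) by (unfold dirichlet_term; ring).
      eapply is_CInt_gen_ext; [apply _ .. | | exact PosL | apply infty_gt | exact (I1 O)].
      intros t Ht. unfold S_, mterm, expo. rewrite sum_O, RtoC_mult. ring.
    - rewrite sum_Sn. change (plus ?x ?y) with (x + y).
      replace (Gamma s * (sumC (dirichlet_term a s) n + dirichlet_term a s (S n)))
        with (Gamma s * sumC (dirichlet_term a s) n + a (S (S n)) * (cpow (INR (S (S n))) (- s) * Gamma s))
        by (unfold dirichlet_term; ring).
      eapply is_CInt_gen_ext; [apply _ .. | | exact PosL | apply infty_gt |
        exact (is_RInt_gen_plus (V := C_R_NormedModule) _ _ _ _ IH (I1 (S n)))].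
      intros t Ht. change (plus ?x ?y) with (x + y). unfold S_, mterm, expo. rewrite sum_Sn. change (plus ?x ?y) with (x + y)%R.
      rewrite RtoC_plus, RtoC_mult. ring. }
  assert (Im := is_CInt_gen_mellin _ _ _ _ lower_end_zero MB s Hs). fold f in Im.
  (* Half of the margin buys decay in n: since (n t)^g e^(-n t / 2) is bounded, e^(-(n+1) t) is at
     most a constant times n^(-g) t^(-g) e^(-t/2). The other half keeps the integral convergent at
     0. *)
  set (g := ((Re s - al) / 2)%R). assert (Hg : (0 < g)%R) by (unfold g; lra).
  destruct (weight_dom (Re s) al g 0) as [K1 [HK1 W]].
  destruct (exp_growth g) as [K0 [HK0 G0]].
  set (B := (K * K0 * K1)%R). assert (HB : (0 <= B)%R) by (unfold B; repeat apply Rmult_le_pos; lra).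
  assert (Hgg : (Re s - al - g)%R = g) by (unfold g; field).
  assert (Diff : forall n, (1 <= n)%nat ->
    (Cmod (mellin0 f s - Gamma s * sumC (dirichlet_term a s) n)
      <= exp (- g * ln (INR n)) * B / g)%R).
  { intros n Hn. assert (Hn0 : (1 <= INR n)%R) by (apply (le_INR 1), Hn).
    assert (I : is_CInt_gen (fun t => mterm f s t - mterm (S_ n) s t) (at_right 0) infty
       (mellin0 f s - Gamma s * sumC (dirichlet_term a s) n)%C).
    { exact (is_RInt_gen_minus (V := C_R_NormedModule) _ _ _ _ Im (IS n)). }
    destruct (dominated_integral _ 0 g (exp (- g * ln (INR n)) * B)
      (fun t => mterm f s t - mterm (S_ n) s t) lower_end_zero Hg) as [l [Hl Hlb]].
    - apply Rmult_le_pos; [left; apply exp_pos | exact HB].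
    - intros t Ht. apply rcont_minus; [apply (rcont_mterm _ _ _ _ lower_end_zero MB s t Ht)|].
      apply rcont_mult; [apply rcont_cpow, Ht|]. unfold S_. clear - Ht.
      induction n as [|n IH].
      + apply (rcont_RtoC (fun t => sumR (fun k => a (S k) * exp (- (INR (S k) * t)))%R 0)).
        apply continuous_ext with (fun t => a 1%nat * exp (- (INR 1 * t)))%R; [intros; rewrite sum_O; reflexivity|].
        apply ex_derive_Rcontinuous. auto_derive. trivial.
      + replace (fun t => RtoC (sumR (fun k => a (S k) * exp (- (INR (S k) * t)))%R (S n)))
          with (fun t => RtoC (sumR (fun k => a (S k) * exp (- (INR (S k) * t)))%R n) + RtoC (a (S (S n)) * exp (- (INR (S (S n)) * t)))%R).
        2: { apply functional_extensionality. intros u. rewrite sum_Sn, <- RtoC_plus. reflexivity. }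
        apply rcont_plus; [exact IH|].
        apply (rcont_RtoC (fun t => a (S (S n)) * exp (- (INR (S (S n)) * t)))%R).
        apply ex_derive_Rcontinuous. auto_derive. trivial.
    - intros t Ht. replace (mterm f s t - mterm (S_ n) s t) with (cpow t (s - 1) * (f t - S_ n t)) by (unfold mterm; ring).
      rewrite Cmod_mult, Cmod_cpow. unfold f, S_. rewrite <- RtoC_minus, Cmod_R.
      replace (Re (s - 1)) with (Re s - 1)%R by (destruct s; simpl; ring).
      specialize (HR n t Ht). specialize (W t Ht). rewrite Hgg in W.
      apply Rle_trans with (1 := Rmult_le_compat_l _ _ _ (Rlt_le _ _ (exp_pos _)) HR).
      assert (Hnt : (0 < INR n * t)%R) by (apply Rmult_lt_0_compat; lra).
      assert (Q : (exp (- (INR (S n) * t)) <= exp (- t / 2) * exp (- g * ln t + 0 * ln (1 + t)) * (K0 * exp (- g * ln (INR n))))%R).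
      { apply Rle_trans with (exp (- t / 2) * exp (- g * ln t + 0 * ln (1 + t)) *
           (exp (g * ln (1 + INR n * t) - INR n * t / 2) * exp (- g * ln (INR n))))%R.
        - rewrite <- !exp_plus. apply exp_le_mono.
          assert (L : (ln t + ln (INR n) <= ln (1 + INR n * t))%R).
          { rewrite <- ln_mult by lra. apply ln_le_mono; [nra|lra]. }
          rewrite S_INR. nra.
        - apply Rmult_le_compat_l; [left; apply Rmult_lt_0_compat; apply exp_pos|].
          apply Rmult_le_compat_r; [left; apply exp_pos|]. apply G0, Hnt. }
      assert (Hpre : (0 <= exp ((Re s - 1) * ln t) * (K * weight al t))%R).
      { apply Rmult_le_pos; [left; apply exp_pos|]. apply Rmult_le_pos; [exact HK|left; apply exp_pos]. }
      apply Rle_trans with (exp ((Re s - 1) * ln t) * (K * weight al t) *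
        (exp (- t / 2) * exp (- g * ln t + 0 * ln (1 + t)) * (K0 * exp (- g * ln (INR n)))))%R.
      { apply (Rmult_le_compat_l _ _ _ Hpre) in Q. apply Rle_trans with (2 := Q). right. ring. }
      apply (Rmult_le_compat_l (K * K0 * exp (- g * ln (INR n)))) in W.
      2: { repeat apply Rmult_le_pos; try assumption. left; apply exp_pos. }
      eapply Rle_trans; [|eapply Rle_trans; [exact W|]]; right; [|unfold B]; ring.
    - assert (El : l = mellin0 f s - Gamma s * sumC (dirichlet_term a s) n).
      { rewrite <- (CInt_gen_unique _ _ _ _ Hl). exact (CInt_gen_unique _ _ _ _ I). }
      rewrite El in Hlb. exact Hlb. }
  apply is_series_eps. intros e He.
  set (m := Cmod (Gamma s)). assert (Hm : (0 < m)%R) by (apply Cmod_gt_0, HG).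
  set (q := (e * m * g / (B + 1))%R). assert (Hq : (0 < q)%R) by (apply Rdiv_lt_0_compat; [apply Rmult_lt_0_compat; [apply Rmult_lt_0_compat|]; assumption|lra]).
  (* The threshold is q^(-1/g), beyond which n^(-g) < q. *)
  destruct (archimed (exp (- ln q / g))) as [A1 _].
  exists (max 1 (Z.to_nat (up (exp (- ln q / g))))). intros n Hn.
  assert (Hn1 : (1 <= n)%nat) by lia.
  assert (Hn2 : (exp (- ln q / g) < INR n)%R).
  { apply Rlt_le_trans with (1 := A1). rewrite INR_IZR_INZ. apply IZR_le. lia. }
  assert (Hsmall : (exp (- g * ln (INR n)) < q)%R).
  { apply Rlt_le_trans with (exp (ln q)); [|rewrite exp_ln; lra]. apply exp_increasing.
    assert (L : (- ln q / g < ln (INR n))%R).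
    { apply Rle_lt_trans with (ln (exp (- ln q / g))); [rewrite ln_exp; lra|].
      apply ln_increasing; [apply exp_pos | exact Hn2]. }
    apply (Rmult_lt_compat_l g) in L; [|exact Hg].
    replace (g * (- ln q / g))%R with (- ln q)%R in L by (field; lra). lra. }
  specialize (Diff n Hn1).
  rewrite Cmod_minus_sym. fold f.
  replace (mellin0 f s / Gamma s - sumC (dirichlet_term a s) n)
    with ((mellin0 f s - Gamma s * sumC (dirichlet_term a s) n) / Gamma s)
    by (field; exact HG).
  rewrite Cmod_div by exact HG. fold m.
  apply Rmult_lt_reg_r with m; [exact Hm|]. unfold Rdiv at 1. rewrite Rmult_assoc, Rinv_l by lra. rewrite Rmult_1_r.
  apply Rle_lt_trans with (1 := Diff).
  apply Rmult_lt_reg_r with g; [exact Hg|]. unfold Rdiv. rewrite (Rmult_assoc _ (/ g)), Rinv_l, Rmult_1_r by lra.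
  apply Rle_lt_trans with (q * B)%R; [apply Rmult_le_compat_r; lra|].
  replace (e * m * g)%R with (q * (B + 1))%R by (unfold q; field; lra). nra.
Qed.

(** * Generating functions of the Dirichlet coefficients *)

Lemma exp_neg_pow (n : nat) (t : R) : exp (- (INR n * t)) = (exp (- t) ^ n)%R.
Proof.
  induction n as [|n IH]; [simpl; rewrite Rmult_0_l, Ropp_0, exp_0; reflexivity|].
  rewrite S_INR. simpl. rewrite <- IH, <- exp_plus. f_equal. ring.
Qed.

Lemma exp_neg_lt_1 (t : R) : (0 < t)%R -> (0 < exp (- t) < 1)%R.
Proof.
  intros Ht. split; [apply exp_pos|]. rewrite <- exp_0. apply exp_increasing. lra.
Qed.

Lemma sumR_ext_exp (a : nat -> R) (n : nat) (t : R) :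
  sumR (fun k => a (S k) * exp (- (INR (S k) * t)))%R n = sumR (fun k => a (S k) * exp (- t) ^ S k)%R n.
Proof. apply sum_n_ext. intros k. rewrite exp_neg_pow. reflexivity. Qed.

Lemma sumR_S (u : nat -> R) (n : nat) : sumR u (S n) = (sumR u n + u (S n))%R.
Proof. exact (sum_Sn (G := R_AbelianGroup) u n). Qed.

Lemma alt_sign_SS (n : nat) : alt_sign (S (S n)) = (- alt_sign (S n))%R.
Proof. unfold alt_sign. simpl. ring. Qed.

Lemma Rabs_alt_sign (n : nat) : Rabs (alt_sign n) = 1%R.
Proof. unfold alt_sign. rewrite <- RPow_abs.
  replace (Rabs (-1)) with 1%R by (rewrite Rabs_left; lra). apply pow1. Qed.

(** With x = e^(-t), the four kernels are the power series in x with the coefficients [alt_sign n],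
    1, 1/n and [alt_sign n * H_minus n], for n >= 1. *)
Definition eta_kernel (t : R) : R := exp (- t) / (1 + exp (- t)).
Definition zeta_kernel (t : R) : R := exp (- t) / (1 - exp (- t)).
Definition log_kernel (t : R) : R := - ln (1 - exp (- t)).
Definition v_kernel (t : R) : R := - ln (1 - exp (- t)) / (1 + exp (- t)).

Lemma continuous_kernels (t : R) : (0 < t)%R ->
  continuous eta_kernel t /\ continuous zeta_kernel t /\ continuous log_kernel t /\ continuous v_kernel t.
Proof.
  intros Ht. destruct (exp_neg_lt_1 t Ht).
  repeat split; apply ex_derive_Rcontinuous;
    unfold eta_kernel, zeta_kernel, log_kernel, v_kernel; auto_derive; repeat split; lra.
Qed.

Lemma eta_partial (x : R) (n : nat) :
  ((1 + x) * sumR (fun k => alt_sign (S k) * x ^ S k) n = x + alt_sign (S n) * x ^ S (S n))%R.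
Proof.
  induction n as [|n IH]; [rewrite sum_O; unfold alt_sign; simpl; ring|].
  rewrite sumR_S, Rmult_plus_distr_l, IH, alt_sign_SS. simpl. ring.
Qed.

Lemma Rabs_pow_pos (x : R) (n : nat) : (0 < x)%R -> Rabs (x ^ n) = (x ^ n)%R.
Proof. intros H. apply Rabs_pos_eq, pow_le. lra. Qed.

Lemma eta_mellin : mellin_bounded 0 0 (fun t => RtoC (eta_kernel t)) /\
  forall s, (0 < Re s)%R -> is_Cseries (dirichlet_term alt_sign s)
    (mellin0 (fun t => RtoC (eta_kernel t)) s / Gamma s)%C.
Proof.
  apply dirichlet_mellin with (K := 1%R); try lra.
  - intros t Ht. apply (continuous_kernels t Ht).
  - intros n t Ht. rewrite sumR_ext_exp, exp_neg_pow. destruct (exp_neg_lt_1 t Ht) as [H0 H1].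
    unfold eta_kernel. set (x := exp (- t)) in *.
    assert (E := eta_partial x n).
    replace (x / (1 + x) - sumR (fun k => alt_sign (S k) * x ^ S k) n)%R
      with ((- alt_sign (S n)) * x ^ S n * (x / (1 + x)))%R.
    2: { apply (Rmult_eq_reg_l (1 + x)); [|lra].
         rewrite Rmult_minus_distr_l, E. simpl. field. lra. }
    rewrite !Rabs_mult, Rabs_Ropp, Rabs_alt_sign, Rabs_pow_pos by exact H0. rewrite !Rmult_1_l.
    rewrite Rabs_pos_eq by (apply Rdiv_le_0_compat; lra).
    assert (W := weight_ge_1 0 t (Rle_refl 0) Ht). assert (P := pow_lt x (S n) H0).
    assert (x / (1 + x) <= 1)%R.
    { apply Rmult_le_reg_r with (1 + x)%R; [lra|]. unfold Rdiv. rewrite Rmult_assoc, Rinv_l; lra. }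
    apply Rle_trans with (x ^ S n * 1)%R; [apply Rmult_le_compat_l; lra | nra].
Qed.

Lemma geometric_partial (x : R) (n : nat) :
  ((1 - x) * sumR (fun k => x ^ k) n = 1 - x ^ S n)%R.
Proof.
  induction n as [|n IH]; [rewrite sum_O; simpl; ring|].
  rewrite sumR_S, Rmult_plus_distr_l, IH. simpl. ring.
Qed.

Lemma one_minus_exp_lower (t : R) : (0 < t)%R -> (t / (1 + t) <= 1 - exp (- t))%R.
Proof.
  intros Ht. rewrite exp_Ropp. assert (E := exp_ineq1_le t).
  assert (/ exp t <= / (1 + t))%R by (apply Rinv_le_contravar; lra).
  replace (t / (1 + t))%R with (1 - / (1 + t))%R by (field; lra). lra.
Qed.

Lemma weight_1 (t : R) : (0 < t)%R -> weight 1 t = ((1 + t) / t)%R.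
Proof.
  intros Ht. unfold weight. rewrite Rmult_1_l, <- ln_div by lra. apply exp_ln, Rdiv_lt_0_compat; lra.
Qed.

Lemma zeta_mellin : mellin_bounded 0 1 (fun t => RtoC (zeta_kernel t)) /\
  forall s, (1 < Re s)%R -> is_Cseries (dirichlet_term (fun _ => 1%R) s)
    (mellin0 (fun t => RtoC (zeta_kernel t)) s / Gamma s)%C.
Proof.
  apply dirichlet_mellin with (K := 1%R); try lra.
  - intros t Ht. apply (continuous_kernels t Ht).
  - intros n t Ht.
    rewrite (sumR_ext_exp (fun _ => 1%R)), exp_neg_pow. destruct (exp_neg_lt_1 t Ht) as [H0 H1].
    assert (L := one_minus_exp_lower t Ht).
    unfold zeta_kernel. rewrite weight_1 by exact Ht. set (x := exp (- t)) in *.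
    assert (E : ((1 - x) * sumR (fun k => 1 * x ^ S k)%R n = x - x ^ S (S n))%R).
    { clear. induction n as [|n IH]; [rewrite sum_O; simpl; ring|].
      rewrite sumR_S, Rmult_plus_distr_l, IH. simpl. ring. }
    replace (x / (1 - x) - sumR (fun k => 1 * x ^ S k) n)%R with (x ^ S n * (x * / (1 - x)))%R.
    2: { apply (Rmult_eq_reg_l (1 - x)); [|lra].
         rewrite Rmult_minus_distr_l, E. simpl. field. lra. }
    assert (P := pow_lt x (S n) H0).
    assert (Hi : (0 < / (1 - x) <= (1 + t) / t)%R).
    { split; [apply Rinv_0_lt_compat; lra|]. replace ((1 + t) / t)%R with (/ (t / (1 + t)))%R by (field; lra).
      apply Rinv_le_contravar; [apply Rdiv_lt_0_compat; lra | exact L]. }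
    rewrite Rabs_pos_eq by (apply Rmult_le_pos; [lra | apply Rmult_le_pos; lra]).
    assert (x * / (1 - x) <= (1 + t) / t)%R by nra.
    rewrite Rmult_1_l, (Rmult_comm ((1 + t) / t)). apply Rmult_le_compat_l; lra.
Qed.

Lemma log_partial_derive (n : nat) (y : R) :
  is_derive (fun y => sumR (fun k => / INR (S k) * y ^ S k)%R n) y (sumR (fun k => y ^ k)%R n).
Proof.
  assert (D : forall k, is_derive (fun y => / INR (S k) * y ^ S k)%R y (y ^ k)%R).
  { intros k. assert (H : INR (S k) <> 0%R) by (rewrite S_INR; pose proof (pos_INR k); lra).
    auto_derive; [trivial|]. change (match k with O => 1 | S _ => INR k + 1 end)%R with (INR (S k)). cbn [Nat.pred pred]. 
    field. exact H. }
  induction n as [|n IH].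
  - apply is_derive_ext with (fun y => (/ INR 1 * y ^ 1)%R); [intros; rewrite sum_O; reflexivity|].
    rewrite sum_O. apply D.
  - apply is_derive_ext with (fun y => (sumR (fun k => / INR (S k) * y ^ S k) n + / INR (S (S n)) * y ^ S (S n))%R);
      [intros; rewrite sumR_S; reflexivity|].
    rewrite sumR_S. apply (is_derive_plus (K := R_AbsRing) (V := R_NormedModule)); [exact IH | apply D].
Qed.

(* Both inequalities come from the sign of a derivative, since
   -ln(1-y) - sum_(k<=n) y^(k+1)/(k+1) has derivative y^(n+1)/(1-y). *)
Lemma log_remainder (x : R) (n : nat) : (0 < x < 1)%R ->
  (0 <= - ln (1 - x) - sumR (fun k => / INR (S k) * x ^ S k)%R n <= x ^ S n * - ln (1 - x))%R.
Proof.
  intros Hx.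
  set (D := fun y => (- ln (1 - y) - sumR (fun k => / INR (S k) * y ^ S k)%R n)%R).
  assert (dD : forall y, (y < 1)%R -> is_derive D y (y ^ S n / (1 - y))%R).
  { intros y Hy. unfold D.
    replace (y ^ S n / (1 - y))%R with (/ (1 - y) - sumR (fun k => y ^ k)%R n)%R.
    - apply (is_derive_minus (K := R_AbsRing) (V := R_NormedModule)); [|apply log_partial_derive].
      auto_derive; [lra|]. field. lra.
    - apply (Rmult_eq_reg_l (1 - y)); [|lra]. rewrite Rmult_minus_distr_l, geometric_partial. field. lra. }
  assert (S0 : sumR (fun k => / INR (S k) * 0 ^ S k)%R n = 0%R).
  { clear. induction n as [|n IH]; [rewrite sum_O; simpl; ring|]. rewrite sumR_S, IH. simpl. ring. }
  assert (D0 : D 0%R = 0%R) by (unfold D; rewrite Rminus_0_r, ln_1, S0; ring).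
  split.
  - destruct (MVT_gen D 0 x (fun y => y ^ S n / (1 - y))%R) as [c [Hc E]].
    + intros y Hy. rewrite Rmin_left, Rmax_right in Hy by lra. apply dD. lra.
    + intros y Hy. rewrite Rmin_left, Rmax_right in Hy by lra.
      apply continuity_pt_filterlim, (ex_derive_continuous (V := R_NormedModule)). eexists. apply dD. lra.
    + rewrite Rmin_left, Rmax_right in Hc by lra. rewrite D0, !Rminus_0_r in E. fold (D x). rewrite E.
      apply Rmult_le_pos; [|lra]. apply Rdiv_le_0_compat; [apply pow_le; lra | lra].
  - set (h := fun y => (x ^ S n * - ln (1 - y) - D y)%R).
    assert (dh : forall y, (y < 1)%R -> is_derive h y ((x ^ S n - y ^ S n) / (1 - y))%R).
    { intros y Hy. unfold h.
      replace ((x ^ S n - y ^ S n) / (1 - y))%R with (x ^ S n * / (1 - y) - y ^ S n / (1 - y))%R by (field; lra).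
      apply (is_derive_minus (K := R_AbsRing) (V := R_NormedModule)); [|apply dD, Hy].
      set (X := (x ^ S n)%R). auto_derive; [lra|]. field. lra. }
    destruct (MVT_gen h 0 x (fun y => (x ^ S n - y ^ S n) / (1 - y))%R) as [c [Hc E]].
    + intros y Hy. rewrite Rmin_left, Rmax_right in Hy by lra. apply dh. lra.
    + intros y Hy. rewrite Rmin_left, Rmax_right in Hy by lra.
      apply continuity_pt_filterlim, (ex_derive_continuous (V := R_NormedModule)). eexists. apply dh. lra.
    + rewrite Rmin_left, Rmax_right in Hc by lra.
      assert (h0 : h 0%R = 0%R) by (unfold h; cbv beta; rewrite D0, !Rminus_0_r, ln_1; ring).
      rewrite h0, !Rminus_0_r in E.
      assert (Hh : (0 <= h x)%R).
      { rewrite E. apply Rmult_le_pos; [|lra]. apply Rdiv_le_0_compat; [|lra].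
        assert (c ^ S n <= x ^ S n)%R by (apply pow_incr; lra). lra. }
      unfold h in Hh. fold (D x). lra.
Qed.

(** The kernel grows like - ln t at 0, hence more slowly than t^(-al) for every al > 0. The constant
    comes from X <= e^(al X) / al with X = ln (1 + 1/t). *)
Lemma log_kernel_bound (al t : R) : (0 < al)%R -> (0 < t)%R ->
  (0 <= log_kernel t <= / al * weight al t)%R.
Proof.
  intros Hal Ht. destruct (exp_neg_lt_1 t Ht) as [H0 H1]. unfold log_kernel. split.
  - assert (K : (ln (1 - exp (- t)) <= ln 1)%R) by (apply ln_le_mono; lra). rewrite ln_1 in K. lra.
  - assert (L := one_minus_exp_lower t Ht).
    assert (L2 : (ln t - ln (1 + t) <= ln (1 - exp (- t)))%R).
    { rewrite <- ln_div by lra. apply ln_le_mono; [apply Rdiv_lt_0_compat; lra | exact L]. }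
    unfold weight. assert (E := exp_ineq1_le (al * (ln (1 + t) - ln t))).
    apply Rmult_le_reg_l with al; [exact Hal|]. rewrite <- Rmult_assoc, Rinv_r, Rmult_1_l by lra. nra.
Qed.

Lemma log_mellin (al : R) : (0 < al)%R -> mellin_bounded 0 al (fun t => RtoC (log_kernel t)) /\
  forall s, (al < Re s)%R -> is_Cseries (dirichlet_term (fun n => / INR n)%R s)
    (mellin0 (fun t => RtoC (log_kernel t)) s / Gamma s)%C.
Proof.
  intros Hal. assert (Hal' : (0 < / al)%R) by (apply Rinv_0_lt_compat, Hal).
  apply dirichlet_mellin with (K := (/ al)%R); try lra.
  - intros t Ht. apply (continuous_kernels t Ht).
  - intros n t Ht. rewrite (sumR_ext_exp (fun n => / INR n)%R), exp_neg_pow.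
    assert (Hx := exp_neg_lt_1 t Ht). assert (R := log_remainder _ n Hx).
    assert (B := log_kernel_bound al t Hal Ht). unfold log_kernel in *. set (x := exp (- t)) in *.
    rewrite Rabs_pos_eq by apply R. apply Rle_trans with (1 := proj2 R).
    assert (P := pow_lt x (S n) (proj1 Hx)).
    rewrite <- Rmult_assoc, (Rmult_comm _ (x ^ S n)). apply Rmult_le_compat_l; lra.
Qed.

Lemma H_minus_S (n : nat) : H_minus (S n) = (H_minus n + alt_sign (S n) / INR (S n))%R.
Proof.
  unfold H_minus. destruct n as [|n].
  - rewrite sum_n_n, sum_n_m_zero by lia. change (zero : R_AbelianMonoid) with 0%R. symmetry. apply Rplus_0_l.
  - rewrite sum_n_Sm by lia. reflexivity.
Qed.

(** The alternating sums stay in [0, 1]. The two implications strengthen the induction: they reserve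
    room for the next term on the side to which its sign points. *)
Lemma H_minus_bounds (n : nat) : (0 <= H_minus (S n) <= 1 /\
  (alt_sign (S n) = 1 -> / INR (S (S n)) <= H_minus (S n)) /\
  (alt_sign (S n) = -1 -> H_minus (S n) + / INR (S (S n)) <= 1))%R.
Proof.
  assert (Inv : forall k, (0 < / INR (S k))%R).
  { intros k. apply Rinv_0_lt_compat. rewrite S_INR. pose proof (pos_INR k). lra. }
  assert (Dec : forall k, (/ INR (S (S k)) <= / INR (S k))%R).
  { intros k. apply Rinv_le_contravar; [rewrite S_INR; pose proof (pos_INR k); lra|].
    rewrite (S_INR (S k)). lra. }
  assert (Sgn : forall k, (alt_sign (S k) = 1 \/ alt_sign (S k) = -1)%R).
  { induction k as [|k IH]; [left; reflexivity|]. rewrite alt_sign_SS. destruct IH as [-> | ->]; [right|left]; ring. }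
  induction n as [|n (H1 & H2 & H3)].
  - rewrite H_minus_S. unfold H_minus. rewrite sum_n_m_zero by lia. change (zero : R_AbelianMonoid) with 0%R.
    unfold alt_sign. simpl. split; [lra|]. split; intros; lra.
  - rewrite H_minus_S. unfold Rdiv. rewrite alt_sign_SS. specialize (Dec (S n)). assert (I1 := Inv (S n)). assert (I2 := Inv (S (S n))).
    destruct (Sgn n) as [E|E]; rewrite E in *; (split; [|split]); try specialize (H2 eq_refl); try specialize (H3 eq_refl); intros; lra.
Qed.

(** Multiplication by 1 + x telescopes: two neighbouring coefficients combine to [alt_sign (S k) *
    (H_minus (S k) - H_minus k)], which is 1/(k+1). This is why the generating function of v is -ln
    (1 - x) / (1 + x). *)
Lemma v_partial (x : R) (n : nat) :
  ((1 + x) * sumR (fun k => alt_sign (S k) * H_minus (S k) * x ^ S k)%R n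
   = sumR (fun k => / INR (S k) * x ^ S k)%R n + alt_sign (S n) * H_minus (S n) * x ^ S (S n))%R.
Proof.
  induction n as [|n IH].
  - rewrite !sum_O. rewrite H_minus_S. unfold H_minus. rewrite sum_n_m_zero by lia.
    change (zero : R_AbelianMonoid) with 0%R. unfold alt_sign. simpl. field.
  - rewrite !sumR_S, Rmult_plus_distr_l, IH, alt_sign_SS, (H_minus_S (S n)), alt_sign_SS.
    assert (A : (alt_sign (S n) * alt_sign (S n) = 1)%R).
    { unfold alt_sign. simpl pred. rewrite <- Rpow_mult_distr. replace (-1 * -1)%R with 1%R by ring. apply pow1. }
    assert (HN : INR (S (S n)) <> 0%R) by (rewrite S_INR; pose proof (pos_INR (S n)); lra).
    set (N := INR (S (S n))) in *. set (H := H_minus (S n)) in *. set (b := alt_sign (S n)) in *. cbn [pow].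
    replace (- b * (H + - b / N))%R with (- b * H + / N)%R; [ring|].
    apply (Rmult_eq_reg_r N); [|exact HN]. unfold Rdiv.
    replace ((- b * H + / N) * N)%R with (- b * H * N + 1)%R by (field; exact HN).
    replace (- b * (H + - b * / N) * N)%R with (- b * H * N + b * b)%R by (field; exact HN).
    rewrite A. ring.
Qed.

Lemma v_mellin (al : R) : (0 < al)%R -> mellin_bounded 0 al (fun t => RtoC (v_kernel t)) /\
  forall s, (al < Re s)%R ->
    is_Cseries (dirichlet_term (fun n => alt_sign n * H_minus n)%R s)
    (mellin0 (fun t => RtoC (v_kernel t)) s / Gamma s)%C.
Proof.
  intros Hal. assert (Hal' : (0 < / al)%R) by (apply Rinv_0_lt_compat, Hal).
  apply dirichlet_mellin with (K := (/ al + 1)%R); try lra.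
  - intros t Ht. apply (continuous_kernels t Ht).
  - intros n t Ht. rewrite (sumR_ext_exp (fun n => alt_sign n * H_minus n)%R), exp_neg_pow.
    assert (Hx := exp_neg_lt_1 t Ht). assert (R := log_remainder _ n Hx).
    assert (B := log_kernel_bound al t Hal Ht). assert (W := weight_ge_1 al t (Rlt_le _ _ Hal) Ht).
    unfold log_kernel, v_kernel in *. set (x := exp (- t)) in *.
    assert (E := v_partial x n).
    set (a := (alt_sign (S n) * H_minus (S n))%R) in *.
    assert (Ha : (Rabs a <= 1)%R).
    { unfold a. rewrite Rabs_mult, Rabs_alt_sign, Rmult_1_l. destruct (H_minus_bounds n) as [Hb _].
      rewrite Rabs_pos_eq; lra. }
    set (L := (- ln (1 - x))%R) in *. set (SL := sumR (fun k => / INR (S k) * x ^ S k)%R n) in *.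
    set (SV := sumR (fun k => alt_sign (S k) * H_minus (S k) * x ^ S k)%R n) in *.
    assert (P := pow_lt x (S n) (proj1 Hx)).
    replace (L / (1 + x) - SV)%R with (((L - SL) - a * (x * x ^ S n)) * / (1 + x))%R.
    2: { apply (Rmult_eq_reg_l (1 + x)); [|lra]. rewrite Rmult_minus_distr_l, E.
         cbn [pow]. field. lra. }
    rewrite Rabs_mult, (Rabs_pos_eq (/ (1 + x))) by (left; apply Rinv_0_lt_compat; lra).
    assert (Hi : (0 < / (1 + x) <= 1)%R).
    { split; [apply Rinv_0_lt_compat; lra|]. rewrite <- Rinv_1. apply Rinv_le_contravar; lra. }
    assert (T : (Rabs ((L - SL) - a * (x * x ^ S n)) <= x ^ S n * (/ al * weight al t) + x ^ S n)%R).
    { apply Rle_trans with (1 := Rabs_triang _ _). rewrite Rabs_Ropp. apply Rplus_le_compat.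
      - rewrite Rabs_pos_eq by apply R. apply Rle_trans with (1 := proj2 R). apply Rmult_le_compat_l; lra.
      - rewrite Rabs_mult, (Rabs_pos_eq (x * x ^ S n)) by (apply Rmult_le_pos; lra).
        apply Rle_trans with (1 * (1 * x ^ S n))%R; [|lra].
        apply Rmult_le_compat; [apply Rabs_pos | apply Rmult_le_pos; lra | exact Ha | apply Rmult_le_compat_r; lra]. }
    pose proof (Rabs_pos ((L - SL) - a * (x * x ^ S n))).
    apply Rle_trans with (Rabs ((L - SL) - a * (x * x ^ S n)) * 1)%R; [apply Rmult_le_compat_l; lra|].
    rewrite Rmult_1_r. apply Rle_trans with (1 := T). nra.
Qed.

(** * Hankel integrals *)

Lemma is_CInt_gen_reflect (g : R -> C) (e : R) (l : C) :
  is_CInt_gen g (at_point e) infty l ->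
  is_CInt_gen (fun x => g (- x)%R) (Rbar_locally m_infty) (at_point (- e)%R) l.
Proof.
  intros H P HP. specialize (H P HP). unfold filtermapi in *.
  destruct H as [Q1 Q2 HQ1 [M HM] HQ].
  apply (Filter_prod _ _ _ (fun a => Q2 (- a)%R) (fun b => b = (- e)%R)).
  - exists (- M)%R. intros y Hy. apply HM. lra.
  - reflexivity.
  - intros x y Hx ->. simpl. unfold at_point in HQ1.
    destruct (HQ _ _ HQ1 Hx) as [z [Hz1 Hz2]]. simpl in *. exists z. split; [|exact Hz2].
    apply is_RInt_swap in Hz1.
    assert (K := is_RInt_comp_lin (V := C_R_NormedModule) g (-1) 0 x (- e) (opp z)).
    replace (-1 * x + 0)%R with (- x)%R in K by ring. replace (-1 * - e + 0)%R with e in K by ring.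
    specialize (K Hz1).
    assert (K' := is_RInt_opp (V := C_R_NormedModule) _ _ _ _ K).
    assert (K2 : is_CInt (fun y => - scal (V := C_R_NormedModule) (-1)%R (g (-1 * y + 0)%R)) x (- e)%R z).
    { replace z with (- - z) by ring. exact K'. }
    revert K2. apply is_CInt_ext. intros t _. replace (-1 * t + 0)%R with (- t)%R by ring.
    apply C_ext; destruct (g (- t)%R); simpl; unfold scal; simpl; unfold mult; simpl; ring.
Qed.

(** On the circle of the contour z^s is e^(s lam) with lam = log z bounded, so the quadratic bound
    on the exponential is uniform and allows differentiation under the integral. *)
Lemma exp_integral_holomorphic (phi lam : R -> C) (a b L : R) (s : C) : (a <= b)%R ->
  (forall t, rcont phi t) -> (forall t, rcont lam t) ->
  (forall t, (a <= t <= b)%R -> (Cmod (lam t) <= L)%R) ->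
  ex_cderive (fun s => CInt (fun t => phi t * cexp (s * lam t)) a b) s.
Proof.
  intros Hab Hphi Hlam HL.
  assert (Hc : forall s t, rcont (fun t => phi t * cexp (s * lam t)) t).
  { intros z t. apply rcont_mult; [apply Hphi|]. apply rcont_cexp, rcont_mult; [apply rcont_const | apply Hlam]. }
  assert (Hi : forall z, is_CInt (fun t => phi t * cexp (z * lam t)) a b (CInt (fun t => phi t * cexp (z * lam t)) a b)).
  { intros z. apply is_CInt_cont. intros; apply Hc. }
  assert (HL0 : (0 <= L)%R).
  { apply Rle_trans with (2 := HL a ltac:(lra)), Cmod_ge_0. }
  assert (Hint : ex_RInt (fun t => Cmod (phi t * cexp (s * lam t))) a b).
  { apply (ex_RInt_continuous (V := R_CompleteNormedModule)). intros t _. apply rcont_Cmod, Hc. }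
  set (A := RInt (fun t => Cmod (phi t * cexp (s * lam t))) a b).
  assert (HA : is_RInt (fun t => Cmod (phi t * cexp (s * lam t))) a b A) by (apply (RInt_correct (V := R_CompleteNormedModule)), Hint).
  assert (HA0 : (0 <= A)%R) by (apply RInt_ge_0; [exact Hab | exact Hint | intros; apply Cmod_ge_0]).
  set (D := CInt (fun t => lam t * (phi t * cexp (s * lam t))) a b).
  assert (HD : is_CInt (fun t => lam t * (phi t * cexp (s * lam t))) a b D).
  { apply is_CInt_cont. intros t _. apply rcont_mult; [apply Hlam | apply Hc]. }
  exists D. apply is_cderive_eps. intros e He.
  set (B := (L * L * exp L)%R). assert (HB : (0 <= B)%R) by (unfold B; apply Rmult_le_pos; [nra | left; apply exp_pos]).
  assert (HAB : (0 <= A * B)%R) by (apply Rmult_le_pos; assumption).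
  exists (Rmin 1 (e / (A * B + 1))). split; [apply Rmin_pos; [lra | apply Rdiv_lt_0_compat; lra]|].
  intros w Hw. set (h := w - s) in *.
  assert (Hh1 : (Cmod h < 1)%R) by exact (Rlt_Rmin_l Hw).
  assert (Hh2 : (Cmod h < e / (A * B + 1))%R) by exact (Rlt_Rmin_r Hw).
  pose proof (Cmod_ge_0 h) as Hh0.
  assert (I : is_CInt (fun t => (phi t * cexp (w * lam t) - phi t * cexp (s * lam t)) - h * (lam t * (phi t * cexp (s * lam t)))) a b
    ((CInt (fun t => phi t * cexp (w * lam t)) a b - CInt (fun t => phi t * cexp (s * lam t)) a b) - h * D)%C).
  { apply is_CInt_minus; [apply is_CInt_minus; apply Hi | apply is_CInt_scal, HD]. }
  assert (Bd : (Cmod ((CInt (fun t => phi t * cexp (w * lam t))%C a b - CInt (fun t => phi t * cexp (s * lam t))%C a b) - h * D)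
     <= Cmod h * Cmod h * B * A)%R).
  { eapply is_CInt_norm; [exact Hab | | exact I |
      apply (is_RInt_scal (V := R_NormedModule) (fun t => Cmod (phi t * cexp (s * lam t))) a b (Cmod h * Cmod h * B)%R), HA].
    intros t Ht. change (scal ?x ?y) with (x * y)%R. cbv beta.
    replace (w * lam t) with (s * lam t + h * lam t) by (unfold h; ring). rewrite cexp_plus.
    replace (phi t * (cexp (s * lam t) * cexp (h * lam t)) - phi t * cexp (s * lam t) - h * (lam t * (phi t * cexp (s * lam t))))
      with ((cexp (h * lam t) - 1 - h * lam t) * (phi t * cexp (s * lam t))) by ring.
    rewrite Cmod_mult. apply Rmult_le_compat_r; [apply Cmod_ge_0|].
    apply Rle_trans with (1 := cexp_bound2 _). rewrite Cmod_mult.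
    specialize (HL t Ht). pose proof (Cmod_ge_0 (lam t)) as Hl0.
    assert (E : (exp (Cmod h * Cmod (lam t)) <= exp L)%R) by (apply exp_le_mono; nra).
    unfold B. replace (Cmod h * Cmod h * (L * L * exp L))%R with ((Cmod h * Cmod h) * (L * L) * exp L)%R by ring.
    apply Rmult_le_compat; [|left; apply exp_pos| |exact E].
    - apply Rmult_le_pos; apply Rmult_le_pos; assumption.
    - replace (Cmod h * Cmod (lam t) * (Cmod h * Cmod (lam t)))%R with ((Cmod h * Cmod h) * (Cmod (lam t) * Cmod (lam t)))%R by ring.
      apply Rmult_le_compat_l; [nra|]. apply Rmult_le_compat; assumption. }
  rewrite (Cmult_comm D h). apply Rle_trans with (1 := Bd).
  apply Rlt_div_mult in Hh2; [|lra]. nra.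
Qed.

Section Hankel.

Variables (f : C -> C) (R0 M : R).
Hypothesis f_hol : forall z, (0 < Cmod z < R0)%R -> ex_cderive f z.
Hypothesis f_bound : forall z, (0 < Cmod z < R0)%R -> (Cmod (f z) <= M)%R.

Let F (t : R) : C := f (RtoC (- t)).
Hypothesis F_bounded : mellin_bounded 0 0 F.

Definition hankel_circle (e : R) (s : C) : C :=
  CInt (fun t => cpow_polar e t (s - 1) * f (polar e t) * (Ci * polar e t)) (- PI)%R PI.

(** On the two sides of the cut z^(s-1) carries the phases e^(-i pi (s-1)) and e^(i pi (s-1)). With
    the opposite orientations the rays add up to 2 i sin (pi s) times a Mellin integral truncated at
    e. *)
Definition hankel (e : R) (s : C) : C :=
  csin2 s * mellin (at_point e) (fun t => f (RtoC (- t))) s + hankel_circle e s.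

Lemma cpow_polar_step (e t : R) (s : C) : (0 < e)%R ->
  cpow_polar e t (s - 1) * polar e t = cexp (s * ((ln e, t) : C)).
Proof.
  intros He. unfold cpow_polar. rewrite polar_cexp by exact He. rewrite <- cexp_plus. f_equal. ring.
Qed.

Lemma hankel_circle_eq (e : R) (s : C) : (0 < e)%R ->
  hankel_circle e s = CInt (fun t => (Ci * f (polar e t)) * cexp (s * ((ln e, t) : C))) (- PI)%R PI.
Proof.
  intros He. unfold hankel_circle. f_equal. apply functional_extensionality. intros t.
  rewrite <- cpow_polar_step by exact He. ring.
Qed.

Lemma rcont_f_polar (e t : R) : (0 < e < R0)%R -> rcont (fun t => f (polar e t)) t.
Proof.
  intros He. apply (rcont_comp f); [|apply rcont_polar].
  apply ex_cderive_ccont, f_hol. rewrite Cmod_polar; lra.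
Qed.

Lemma rcont_log_circle (e t : R) : rcont (fun t => (ln e, t)) t.
Proof. apply rcont_pair; [apply continuous_const | apply continuous_id]. Qed.

Lemma lower_end_half (e : R) : (0 < e)%R -> lower_end (e / 2) (at_point e).
Proof. intros He. apply lower_end_point. lra. Qed.

Lemma F_bounded_tail (e : R) (s : C) : (0 < e)%R -> mellin_bounded (e / 2) (Re s - 1) F.
Proof. intros He. apply mellin_bounded_tail with 0%R; [lra | lra | exact F_bounded]. Qed.

Lemma is_CInt_gen_tail (e : R) (s : C) : (0 < e)%R ->
  is_CInt_gen (mterm F s) (at_point e) infty (mellin (at_point e) F s).
Proof.
  intros He. apply (is_CInt_gen_mellin _ _ _ _ (lower_end_half e He) (F_bounded_tail e s He)). lra.
Qed.

Lemma ex_cderive_hankel (e : R) (s : C) : (0 < e < R0)%R -> ex_cderive (hankel e) s.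
Proof.
  intros He. apply ex_cderive_plus.
  - apply ex_cderive_mult; [apply ex_cderive_csin2|].
    apply (ex_cderive_mellin _ _ _ _ (lower_end_half e (proj1 He)) (F_bounded_tail e s (proj1 He))). lra.
  - apply ex_cderive_local with (f := fun s => CInt (fun t => (Ci * f (polar e t)) * cexp (s * ((ln e, t) : C))) (- PI)%R PI)
      (d := 1%R); [lra | intros w _; symmetry; apply hankel_circle_eq; lra |].
    apply exp_integral_holomorphic with (L := (Rabs (ln e) + PI)%R).
    + apply neg_pi_le_pi.
    + intros t. apply rcont_mult; [apply rcont_const | apply rcont_f_polar, He].
    + intros t. apply rcont_log_circle.
    + intros t Ht. apply Rle_trans with (1 := Cmod_le_Re_Im _). simpl.
      apply Rplus_le_compat_l, Rabs_le, Ht.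
Qed.

Lemma is_hankel_integral_hankel (e : R) (s : C) : (0 < e < R0)%R ->
  is_hankel_integral s f e (hankel e s).
Proof.
  intros He. assert (T := is_CInt_gen_tail e s (proj1 He)).
  set (T0 := mellin (at_point e) F s) in *.
  assert (P1 : Rbar_locally m_infty (fun x => x < 0)%R) by (exists 0%R; intros y Hy; exact Hy).
  (* One side of the cut: for arg z = th the power differs from the real one by the constant phase
     e^(i th (s-1)), so the ray is a reflected truncated Mellin integral. *)
  assert (Edge : forall th c, c = cexp ((s - 1) * ((0, th)%R : C)) ->
    is_CInt_gen (fun x : R => cpow_polar (- x) th (s - 1) * f x) (Rbar_locally m_infty) (at_point (- e)%R) (c * T0)%C).
  { intros th c Hc.
    assert (I := is_CInt_gen_reflect _ _ _ (is_CInt_gen_scal _ _ c _ _ T)).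
    revert I. apply (is_RInt_gen_ext (V := C_R_NormedModule)).
    apply (Filter_prod (Rbar_locally m_infty) (at_point (- e)%R) _ (fun x => x < 0)%R (fun b => b = - e)%R P1); [reflexivity|].
    intros a b Ha -> x Hx. simpl in Hx.
    assert (Hx0 : (x < 0)%R) by (apply Rlt_le_trans with (1 := proj2 Hx), Rmax_lub; lra).
    unfold mterm, F. rewrite Ropp_involutive. subst c. rewrite cpow_ln. unfold cpow_polar.
    rewrite Cmult_assoc, <- cexp_plus. f_equal. f_equal.
    destruct s; apply C_ext; simpl; ring. }
  assert (E1 := Edge (- PI)%R _ eq_refl). assert (E3 := is_RInt_gen_swap _ _ (Edge PI _ eq_refl)).
  exists (cexp ((s - 1) * (0, (- PI)%R)) * T0), (hankel_circle e s), (opp (cexp ((s - 1) * (0%R, PI)) * T0)).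
  split; [exact E1|]. split; [|split; [exact E3|]].
  - apply is_CInt_cont. intros t _. apply rcont_mult; [apply rcont_mult|].
    + apply rcont_cexp, rcont_mult; [apply rcont_const | apply rcont_log_circle].
    + apply rcont_f_polar, He.
    + apply rcont_mult; [apply rcont_const | apply rcont_polar].
  - change (opp ?x) with (- x). unfold hankel. fold F. fold T0.
    assert (U1 : cexp ((s - 1) * (0, (- PI)%R)) = - cexp (- (PI * Ci * s))).
    { replace ((s - 1) * (0, (- PI)%R)) with (- (PI * Ci * s) + PI * Ci).
      - rewrite cexp_plus, cexp_PI_Ci. ring.
      - destruct s; apply C_ext; simpl; ring. }
    assert (U3 : cexp ((s - 1) * (0%R, PI)) = - cexp (PI * Ci * s)).
    { replace ((s - 1) * (0%R, PI)) with (PI * Ci * s - PI * Ci).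
      - rewrite cexp_minus, cexp_PI_Ci. field.
      - destruct s; apply C_ext; simpl; ring. }
    rewrite U1, U3. unfold csin2. ring.
Qed.

Lemma F_eq_exp (x : R) : f (cexp ((x, PI)%R : C)) = F (exp x) /\ f (cexp ((x, (- PI)%R) : C)) = F (exp x).
Proof.
  unfold F, cexp. simpl. rewrite cos_neg, sin_neg, cos_PI, sin_PI.
  split; f_equal; apply C_ext; simpl; ring.
Qed.

(** The substitution t = e^x turns the segment between the two radii into a horizontal side of the
    rectangle used by [hankel_radius]. *)
Lemma mellin_tail_step (e' e : R) (s : C) : (0 < e' <= e)%R ->
  is_CInt (fun x : R => F (exp x) * cexp (s * x)) (ln e') (ln e)
    (mellin (at_point e') F s - mellin (at_point e) F s)%C.
Proof.
  intros He.
  assert (Cm : forall t, (0 < t)%R -> rcont (mterm F s) t).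
  { intros t Ht. apply (rcont_mterm _ _ _ _ lower_end_zero F_bounded s t Ht). }
  assert (I : is_CInt (mterm F s) e' e (CInt (mterm F s) e' e)).
  { apply is_CInt_cont. rewrite Rmin_left by lra. intros t Ht. apply Cm. lra. }
  assert (E : mellin (at_point e') F s - mellin (at_point e) F s = CInt (mterm F s) e' e).
  { assert (T := is_CInt_gen_tail e s ltac:(lra)).
    assert (T' := is_RInt_gen_Chasles (V := C_R_NormedModule) _ e _ _ (proj2 (is_RInt_gen_at_point _ _ _ _) I) T).
    unfold mellin at 1. rewrite (CInt_gen_unique _ _ _ _ T'). change (plus ?x ?y) with (x + y). ring. }
  rewrite E.
  assert (K := is_RInt_comp (V := C_R_CompleteNormedModule) (mterm F s) exp exp (ln e') (ln e)).
  rewrite !exp_ln in K by lra.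
  assert (K' : is_CInt (fun y => scal (V := C_R_NormedModule) (exp y) (mterm F s (exp y))) (ln e') (ln e) (CInt (mterm F s) e' e)).
  { apply K.
    - intros x _. apply Cm, exp_pos.
    - intros x _. split; [apply is_derive_exp|].
      apply ex_derive_Rcontinuous. eexists; apply is_derive_exp. }
  revert K'. apply is_CInt_ext. intros x _.
  replace (scal (V := C_R_NormedModule) (exp x) (mterm F s (exp x))) with (exp x * mterm F s (exp x)).
  2: { apply C_ext; destruct (mterm F s (exp x)); simpl; unfold scal; simpl; unfold mult; simpl; ring. }
  unfold mterm. rewrite cpow_ln, ln_exp, <- cexp_RtoC.
  replace (cexp x * (cexp ((s - 1) * x) * F (exp x))) with ((cexp x * cexp ((s - 1) * x)) * F (exp x)) by ring.
  rewrite <- cexp_plus, Cmult_comm. do 2 f_equal. ring.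
Qed.

(* Cauchy's theorem on the slit annulus, a rectangle in the coordinate log z. *)
Lemma hankel_radius (e' e : R) (s : C) : (0 < e' <= e)%R -> (e < R0)%R -> hankel e s = hankel e' s.
Proof.
  intros He HR.
  set (H := fun w => f (cexp w) * cexp (s * w)).
  assert (Hln : (ln e' <= ln e)%R) by (apply ln_le_mono; lra).
  assert (G : rectint H (ln e') (ln e) (- PI) PI = 0).
  { apply goursat; [exact Hln | apply neg_pi_le_pi|]. intros x y Hx Hy. unfold H.
    apply ex_cderive_mult.
    - apply (ex_cderive_comp f cexp); [|eexists; apply is_cderive_cexp].
      apply f_hol. rewrite Cmod_cexp. simpl. split; [apply exp_pos|].
      apply Rle_lt_trans with (2 := HR). rewrite <- (exp_ln e) by lra. apply exp_le_mono. lra.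
    - apply ex_cderive_cexp. apply ex_cderive_mult; [apply ex_cderive_const | apply ex_cderive_id]. }
  unfold rectint in G.
  assert (St := mellin_tail_step e' e s He).
  set (A := mellin (at_point e') F s - mellin (at_point e) F s) in *.
  assert (L1 : CInt (fun x => H (x, (- PI)%R)) (ln e') (ln e) = cexp (- (PI * Ci * s)) * A).
  { apply CInt_unique. apply is_CInt_ext with (fun x : R => cexp (- (PI * Ci * s)) * (F (exp x) * cexp (s * x))); [|apply is_CInt_scal, St].
    intros x _. unfold H. rewrite (proj2 (F_eq_exp x)).
    replace (cexp (s * (x, (- PI)%R))) with (cexp (- (PI * Ci * s)) * cexp (s * x)); [ring|].
    rewrite <- cexp_plus. f_equal. destruct s; apply C_ext; simpl; ring. }
  assert (L2 : CInt (fun x => H (x, PI)) (ln e') (ln e) = cexp (PI * Ci * s) * A).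
  { apply CInt_unique. apply is_CInt_ext with (fun x : R => cexp (PI * Ci * s) * (F (exp x) * cexp (s * x))); [|apply is_CInt_scal, St].
    intros x _. unfold H. rewrite (proj1 (F_eq_exp x)).
    replace (cexp (s * (x, PI))) with (cexp (PI * Ci * s) * cexp (s * x)); [ring|].
    rewrite <- cexp_plus. f_equal. destruct s; apply C_ext; simpl; ring. }
  assert (L3 : forall r, (0 < r < R0)%R -> Ci * CInt (fun y => H (ln r, y)) (- PI)%R PI = hankel_circle r s).
  { intros r Hr. rewrite hankel_circle_eq by lra. symmetry. apply CInt_unique.
    apply is_CInt_ext with (fun t => Ci * H (ln r, t)).
    - intros t _. unfold H. rewrite polar_cexp by lra. ring.
    - apply is_CInt_scal, is_CInt_cont. intros t _. unfold H. apply rcont_mult.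
      + apply (rcont_comp f); [|apply rcont_cexp, rcont_log_circle].
        apply ex_cderive_ccont, f_hol. rewrite Cmod_cexp. simpl. rewrite exp_ln; lra.
      + apply rcont_cexp, rcont_mult; [apply rcont_const | apply rcont_log_circle]. }
  rewrite L1, L2 in G.
  replace (Ci * (CInt (fun y => H (ln e, y)) (- PI)%R PI - CInt (fun y => H (ln e', y)) (- PI)%R PI))
    with (hankel_circle e s - hankel_circle e' s) in G by (rewrite <- (L3 e), <- (L3 e') by lra; ring).
  unfold hankel. fold F.
  assert (E : csin2 s * mellin (at_point e) F s + hankel_circle e s - (csin2 s * mellin (at_point e') F s + hankel_circle e' s) = 0).
  { rewrite <- G. unfold csin2, A. ring. }
  replace (csin2 s * mellin (at_point e) F s + hankel_circle e s) with
    (csin2 s * mellin (at_point e) F s + hankel_circle e s - (csin2 s * mellin (at_point e') F s + hankel_circle e' s)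
      + (csin2 s * mellin (at_point e') F s + hankel_circle e' s)) by ring.
  rewrite E. ring.
Qed.

Lemma mellin_tail_limit (s : C) : (0 < Re s)%R -> forall q, (0 < q)%R -> exists d, (0 < d)%R /\
  forall e, (0 < e < d)%R -> (Cmod (mellin (at_point e) F s - mellin0 F s) <= q)%R.
Proof.
  intros Hs q Hq. assert (Hq2 : (0 < q / 2)%R) by lra.
  assert (I := is_CInt_gen_mellin _ _ _ _ lower_end_zero F_bounded s Hs).
  assert (Near : forall l, locally (T := C_UniformSpace) l (fun y => Cmod (y - l) < q / 2)%R).
  { intros l. apply locally_Cmod. exists (q / 2)%R. split; [exact Hq2 | tauto]. }
  destruct (I _ (Near _)) as [Q1 Q2 [d Hd] HQ2 HQ].
  exists d. split; [apply cond_pos|]. intros e He.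
  assert (T := is_CInt_gen_tail e s (proj1 He)).
  destruct (T _ (Near _)) as [Q1' Q2' HQ1' HQ2' HQ'].
  (* With a common upper end b both improper integrals are within q/2 of the same proper integral
     from e to b. *)
  destruct (filter_ex _ (filter_and _ _ HQ2 HQ2')) as [b [Hb Hb']].
  assert (Q1e : Q1 e).
  { apply Hd; [|lra]. change (Rabs (e - 0) < d)%R. rewrite Rminus_0_r, Rabs_pos_eq; lra. }
  destruct (HQ e b Q1e Hb) as [y [Hy1 Hy2]]. destruct (HQ' e b HQ1' Hb') as [y' [Hy1' Hy2']]. simpl in *.
  assert (E : y = y').
  { rewrite <- (CInt_unique _ _ _ _ Hy1). apply CInt_unique, Hy1'. }
  subst y'.
  replace (mellin (at_point e) F s - mellin0 F s)
    with ((y - mellin0 F s) - (y - mellin (at_point e) F s)) by ring.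
  apply Rle_trans with (1 := Cmod_triangle_minus _ _). lra.
Qed.

(** The radius may be shrunk without changing the integral. Since f is bounded near 0, the circle
    contributes O(e^(Re s)) in the radius e and disappears when Re s > 0. *)
Theorem hankel_mellin (e : R) (s : C) : (0 < e < R0)%R -> (0 < Re s)%R ->
  hankel e s = csin2 s * mellin0 (fun t => f (RtoC (- t))) s.
Proof.
  intros He Hs. fold F. pose proof PI_RGT_0 as HPI.
  apply Cmod_small_eq. intros q Hq.
  set (X := Cmod (csin2 s)). assert (HX : (0 <= X)%R) by apply Cmod_ge_0.
  destruct (mellin_tail_limit s Hs (q / (2 * (X + 1)))) as [d [Hd HT]].
  { apply Rdiv_lt_0_compat; lra. }
  assert (HM : (0 <= M)%R).
  { apply Rle_trans with (2 := f_bound (polar e 0) ltac:(rewrite Cmod_polar; lra)), Cmod_ge_0. }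
  (* On the circle of radius r, |z^s| = r^(Re s) e^(- t Im s) with |t| <= pi, so the circle integral
     is at most Y r^(Re s). *)
  set (Y := (2 * PI * (M * exp (PI * Rabs (Im s))))%R).
  assert (HY : (0 <= Y)%R).
  { unfold Y. apply Rmult_le_pos; [lra|]. apply Rmult_le_pos; [exact HM|left; apply exp_pos]. }
  (* The last bound makes e1^(Re s) <= q / (2 (Y + 1)). *)
  set (e1 := Rmin (Rmin (d / 2) e) (exp (ln (q / (2 * (Y + 1))) / Re s))).
  assert (Hq' : (0 < q / (2 * (Y + 1)))%R) by (apply Rdiv_lt_0_compat; lra).
  assert (H1 : (0 < e1)%R) by (repeat apply Rmin_pos; try lra; apply exp_pos).
  assert (H2 : (e1 <= d / 2)%R) by (eapply Rle_trans; [apply Rmin_l|apply Rmin_l]).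
  assert (H3 : (e1 <= e)%R) by (eapply Rle_trans; [apply Rmin_l|apply Rmin_r]).
  assert (H4 : (e1 <= exp (ln (q / (2 * (Y + 1))) / Re s))%R) by apply Rmin_r.
  rewrite (hankel_radius e1 e) by lra. unfold hankel. fold F.
  replace (csin2 s * mellin (at_point e1) F s + hankel_circle e1 s - csin2 s * mellin0 F s)
    with (csin2 s * (mellin (at_point e1) F s - mellin0 F s) + hankel_circle e1 s) by ring.
  apply Rle_trans with (1 := Cmod_triangle _ _). rewrite Cmod_mult. fold X.
  specialize (HT e1 ltac:(lra)).
  assert (B1 : (X * Cmod (mellin (at_point e1) F s - mellin0 F s) <= q / 2)%R).
  { apply Rle_trans with ((X + 1) * (q / (2 * (X + 1))))%R.
    - apply Rmult_le_compat; try lra. apply Cmod_ge_0.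
    - right. field. lra. }
  assert (B2 : (Cmod (hankel_circle e1 s) <= q / 2)%R).
  { rewrite hankel_circle_eq by exact H1.
    apply Rle_trans with ((PI - - PI) * (M * exp (PI * Rabs (Im s)) * exp (Re s * ln e1)))%R.
    - eapply is_CInt_bound; [apply neg_pi_le_pi | |
        apply is_CInt_cont; intros t _; apply rcont_mult;
          [apply rcont_mult; [apply rcont_const | apply rcont_f_polar; lra] |
           apply rcont_cexp, rcont_mult; [apply rcont_const | apply rcont_log_circle]]].
      intros t Ht. cbv beta. rewrite !Cmod_mult, Cmod_Ci, Rmult_1_l, Cmod_cexp, Rmult_assoc.
      apply Rmult_le_compat; [apply Cmod_ge_0 | left; apply exp_pos | apply f_bound; rewrite Cmod_polar; lra|].
      rewrite <- exp_plus. apply exp_le_mono.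
      replace (Re (s * (ln e1, t))) with (Re s * ln e1 + - Im s * t)%R by (destruct s; simpl; ring).
      assert (- Im s * t <= PI * Rabs (Im s))%R; [|lra].
      apply Rle_trans with (1 := Rle_abs _). rewrite Rabs_mult, Rabs_Ropp, Rmult_comm.
      apply Rmult_le_compat_r; [apply Rabs_pos | apply Rabs_le, Ht].
    - assert (E : (exp (Re s * ln e1) <= q / (2 * (Y + 1)))%R).
      { apply Rle_trans with (exp (ln (q / (2 * (Y + 1))))); [|rewrite exp_ln; lra]. apply exp_le_mono.
        assert (L : (ln e1 <= ln (q / (2 * (Y + 1))) / Re s)%R).
        { apply Rle_trans with (ln (exp (ln (q / (2 * (Y + 1))) / Re s))); [apply ln_le_mono; assumption | rewrite ln_exp; lra]. }
        apply (Rmult_le_compat_l (Re s)) in L; [|lra].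
        replace (Re s * (ln (q / (2 * (Y + 1))) / Re s))%R with (ln (q / (2 * (Y + 1)))) in L by (field; lra). exact L. }
      replace ((PI - - PI) * (M * exp (PI * Rabs (Im s)) * exp (Re s * ln e1)))%R with (Y * exp (Re s * ln e1))%R by (unfold Y; ring).
      apply Rle_trans with ((Y + 1) * (q / (2 * (Y + 1))))%R.
      + apply Rmult_le_compat; try lra. left; apply exp_pos.
      + right. field. lra. }
  lra.
Qed.

End Hankel.

(** * Continuation of eta, zeta and v *)

Definition f_eta (z : C) : C := cexp z / (1 + cexp z).

(** For |z| < 1 the imaginary part stays below pi/2, so cos is positive there and 1 + e^z keeps away
    from 0. *)
Lemma Re_cexp_pos (z : C) : (Cmod z < 1)%R -> (0 < Re (cexp z))%R.
Proof.
  intros H. unfold cexp. simpl. apply Rmult_lt_0_compat; [apply exp_pos|].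
  assert (K := Cmod_Im_le z). assert (K' : (Rabs (Im z) < 1)%R) by lra. apply Rabs_lt_between in K'.
  pose proof PI2_1. apply cos_gt_0; lra.
Qed.

Lemma one_plus_cexp (z : C) : (Cmod z < 1)%R -> (1 <= Cmod (1 + cexp z))%R.
Proof.
  intros H. apply Rle_trans with (2 := Cmod_Re_le _). apply Rle_trans with (2 := Rle_abs _).
  assert (K := Re_cexp_pos z H). destruct (cexp z). simpl in *. lra.
Qed.

Lemma Cmod_cexp_le_3 (z : C) : (Cmod z < 1)%R -> (Cmod (cexp z) <= 3)%R.
Proof.
  intros H. rewrite Cmod_cexp. apply Rle_trans with (2 := exp_le_3). apply exp_le_mono.
  assert (K := Cmod_Re_le z). assert (K2 := Rle_abs (Re z)). lra.
Qed.

Lemma f_eta_hol (z : C) : (0 < Cmod z < 1)%R -> ex_cderive f_eta z.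
Proof.
  intros H. apply ex_cderive_div.
  - apply Cmod_pos_ne. assert (K := one_plus_cexp z (proj2 H)). lra.
  - eexists; apply is_cderive_cexp.
  - apply ex_cderive_plus; [apply ex_cderive_const | eexists; apply is_cderive_cexp].
Qed.

Lemma f_eta_bound (z : C) : (0 < Cmod z < 1)%R -> (Cmod (f_eta z) <= 3)%R.
Proof.
  intros H. assert (K := one_plus_cexp z (proj2 H)). assert (K3 := Cmod_cexp_le_3 z (proj2 H)).
  unfold f_eta. rewrite Cmod_div by (apply Cmod_pos_ne; lra).
  apply Rmult_le_reg_r with (Cmod (1 + cexp z)); [lra|]. unfold Rdiv. rewrite Rmult_assoc, Rinv_l by lra. nra.
Qed.

Lemma f_eta_neg (t : R) : f_eta (RtoC (- t)) = eta_kernel t.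
Proof.
  unfold f_eta, eta_kernel. rewrite cexp_RtoC. pose proof (exp_pos (- t)).
  rewrite <- RtoC_plus, <- RtoC_div by lra. reflexivity.
Qed.

Lemma f_eta_kernel : (fun t => f_eta (RtoC (- t))) = (fun t => RtoC (eta_kernel t)).
Proof. apply functional_extensionality, f_eta_neg. Qed.

(* z e^z / (e^z - 1): the factor z turns the pole at 0 into a removable
   singularity and shifts the Mellin variable by 1. *)
Definition f_zeta (z : C) : C := z * cexp z / (cexp z - 1).

(** |e^z - 1 - z| <= 3 |z|^2, and this is at most |z|/2 for |z| < 1/6, which is the origin of the
    radius 1/6. *)
Lemma cexp_minus_1_lower (z : C) : (Cmod z < 1 / 6)%R -> (Cmod z / 2 <= Cmod (cexp z - 1))%R.
Proof.
  intros H. assert (B := cexp_bound2 z). pose proof (Cmod_ge_0 z).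
  assert (E : (exp (Cmod z) <= 3)%R) by (apply Rle_trans with (2 := exp_le_3); apply exp_le_mono; lra).
  assert (T := Cmod_triangle_rev z (z - (cexp z - 1))).
  replace (z - (z - (cexp z - 1))) with (cexp z - 1) in T by ring.
  replace (z - (cexp z - 1)) with (- (cexp z - 1 - z)) in T by ring. rewrite Cmod_opp in T.
  assert (Cmod z * Cmod z * exp (Cmod z) <= Cmod z * Cmod z * 3)%R by (apply Rmult_le_compat_l; nra). nra.
Qed.

Lemma f_zeta_hol (z : C) : (0 < Cmod z < 1 / 6)%R -> ex_cderive f_zeta z.
Proof.
  intros H. assert (K := cexp_minus_1_lower z (proj2 H)). apply ex_cderive_div.
  - apply Cmod_pos_ne. lra.
  - apply ex_cderive_mult; [apply ex_cderive_id | eexists; apply is_cderive_cexp].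
  - apply ex_cderive_minus; [eexists; apply is_cderive_cexp | apply ex_cderive_const].
Qed.

Lemma f_zeta_bound (z : C) : (0 < Cmod z < 1 / 6)%R -> (Cmod (f_zeta z) <= 6)%R.
Proof.
  intros H. assert (K := cexp_minus_1_lower z (proj2 H)). assert (K3 := Cmod_cexp_le_3 z ltac:(lra)).
  unfold f_zeta. rewrite Cmod_div, Cmod_mult by (apply Cmod_pos_ne; lra).
  apply Rmult_le_reg_r with (Cmod (cexp z - 1)); [lra|]. unfold Rdiv. rewrite Rmult_assoc, Rinv_l by lra. nra.
Qed.

Lemma f_zeta_neg (t : R) : (0 < t)%R -> f_zeta (RtoC (- t)) = t * zeta_kernel t.
Proof.
  intros Ht. destruct (exp_neg_lt_1 t Ht).
  unfold f_zeta, zeta_kernel. rewrite cexp_RtoC.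
  rewrite RtoC_div, RtoC_minus, RtoC_opp by lra. field.
  split; rewrite <- RtoC_minus; intros E; apply RtoC_inj in E; lra.
Qed.

Lemma exp_half_split (t : R) : exp (- t) = (exp (- t / 2) * exp (- (t / 2)))%R.
Proof. rewrite <- exp_plus. f_equal. field. Qed.

Lemma t_exp_half (t : R) : (0 < t)%R -> ((1 + t) * exp (- (t / 2)) <= 2)%R.
Proof.
  intros Ht. rewrite exp_Ropp. assert (E := exp_ineq1_le (t / 2)). assert (P := exp_pos (t / 2)).
  apply Rmult_le_reg_r with (exp (t / 2)); [exact P|]. rewrite Rmult_assoc, Rinv_l; lra.
Qed.

Lemma mellin_bounded_2 (F : R -> C) : (forall t, (0 < t)%R -> rcont F t) ->
  (forall t, (0 < t)%R -> (Cmod (F t) <= (1 + t) * exp (- t))%R) -> mellin_bounded 0 0 F.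
Proof.
  intros Hc Hb. split; [exact Hc|]. exists 2%R. split; [lra|]. intros t Ht.
  apply Rle_trans with (1 := Hb t Ht). rewrite exp_half_split.
  assert (W := weight_ge_1 0 t (Rle_refl 0) Ht). assert (P := exp_pos (- t / 2)).
  assert (K := t_exp_half t Ht). assert (P2 := exp_pos (- (t / 2))).
  apply Rle_trans with (2 * exp (- t / 2))%R; [nra|].
  apply Rmult_le_compat_l; [lra|]. nra.
Qed.

Lemma rcont_neg (f : C -> C) (t : R) : ex_cderive f (RtoC (- t)) -> rcont (fun t => f (RtoC (- t))) t.
Proof.
  intros H. apply (rcont_comp f); [apply ex_cderive_ccont, H|].
  apply (rcont_RtoC (fun t => - t)%R), ex_derive_Rcontinuous. auto_derive. trivial.
Qed.

Lemma f_zeta_bounded : mellin_bounded 0 0 (fun t => f_zeta (RtoC (- t))).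
Proof.
  apply mellin_bounded_2.
  - intros t Ht. apply (rcont_neg f_zeta). destruct (exp_neg_lt_1 t Ht). apply ex_cderive_div.
    + rewrite cexp_RtoC, <- RtoC_minus. intros E; apply RtoC_inj in E; lra.
    + apply ex_cderive_mult; [apply ex_cderive_id | eexists; apply is_cderive_cexp].
    + apply ex_cderive_minus; [eexists; apply is_cderive_cexp | apply ex_cderive_const].
  - intros t Ht. rewrite f_zeta_neg, <- RtoC_mult, Cmod_R by exact Ht. destruct (exp_neg_lt_1 t Ht) as [P Q].
    unfold zeta_kernel. assert (L := one_minus_exp_lower t Ht). set (x := exp (- t)) in *.
    rewrite Rabs_pos_eq.
    + apply Rmult_le_reg_r with (1 - x)%R; [lra|].
      replace (t * (x / (1 - x)) * (1 - x))%R with (t * x)%R by (field; lra).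
      apply (Rmult_le_compat_l (1 + t)) in L; [|lra].
      replace ((1 + t) * (t / (1 + t)))%R with t in L by (field; lra). nra.
    + apply Rmult_le_pos; [lra|]. apply Rdiv_le_0_compat; lra.
Qed.

Lemma mellin_f_zeta (s : C) : (1 < Re s)%R ->
  mellin0 (fun t => f_zeta (RtoC (- t))) (s - 1) = mellin0 (fun t => RtoC (zeta_kernel t)) s.
Proof.
  intros Hs. apply CInt_gen_unique; [apply _ .. |].
  eapply is_CInt_gen_ext; [apply _ .. | | | apply infty_gt |
    exact (is_CInt_gen_mellin _ _ _ _ lower_end_zero (proj1 zeta_mellin) s Hs)].
  - intros t Ht. unfold mterm. rewrite f_zeta_neg by exact Ht.
    replace (s - 1) with ((s - 1 - 1) + 1) at 1 by ring. rewrite cpow_plus, cpow_1 by exact Ht. ring.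
  - apply at_right_pos.
Qed.

Lemma two_PI_Ci_ne : 2 * PI * Ci <> 0.
Proof. pose proof PI_RGT_0. intros E. apply (f_equal Im) in E. simpl in E. lra. Qed.

Lemma inv_Gamma (s : C) : noninteger s -> / Gamma s = Gamma (1 - s) * csin2 s / (2 * PI * Ci).
Proof.
  intros Hs. assert (G := Gamma_ne s (noninteger_not_pole s Hs)).
  rewrite <- (Gamma_reflection s Hs).
  assert (G' := Gamma_ne (1 - s) (noninteger_not_pole _ (noninteger_1_minus s Hs))).
  assert (Hc := csin2_ne s Hs). field. repeat split; assumption.
Qed.

Definition hankel_Gamma (f : C -> C) (e : R) (s : C) : C := Gamma (1 - s) / (2 * PI * Ci) * hankel f e s.

Section HankelGamma.

Variables (f : C -> C) (R0 M : R).
Hypothesis f_hol : forall z, (0 < Cmod z < R0)%R -> ex_cderive f z.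
Hypothesis f_bound : forall z, (0 < Cmod z < R0)%R -> (Cmod (f z) <= M)%R.
Hypothesis F_bounded : mellin_bounded 0 0 (fun t => f (RtoC (- t))).

Lemma hankel_Gamma_mellin (e : R) (s : C) : (0 < e < R0)%R -> (0 < Re s)%R -> noninteger s ->
  hankel_Gamma f e s = mellin0 (fun t => f (RtoC (- t))) s / Gamma s.
Proof.
  intros He Hs Hn. unfold hankel_Gamma. rewrite (hankel_mellin f R0 M f_hol f_bound F_bounded e s He Hs).
  unfold Cdiv. rewrite (inv_Gamma s Hn). unfold Cdiv. ring.
Qed.

Lemma ex_cderive_hankel_Gamma (e : R) (s : C) : (0 < e < R0)%R -> noninteger s -> ex_cderive (hankel_Gamma f e) s.
Proof.
  intros He Hn. apply ex_cderive_mult; [|apply (ex_cderive_hankel f R0 f_hol F_bounded e s He)].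
  apply ex_cderive_div; [exact two_PI_Ci_ne | | apply ex_cderive_const].
  apply ex_cderive_1_minus, ex_cderive_Gamma, noninteger_not_pole, noninteger_1_minus, Hn.
Qed.

Lemma mero_at_hankel_Gamma (e : R) (p : C) : (0 < e < R0)%R -> mero_at (hankel_Gamma f e) p.
Proof.
  intros He. apply mero_at_mult.
  - apply mero_at_mult; [apply mero_at_comp_1_minus, mero_at_Gamma | apply mero_at_const].
  - apply holomorphic_mero_at, holomorphic_at_Cmod. exists 1%R. split; [lra|].
    intros w _. apply (ex_cderive_hankel f R0 f_hol F_bounded e w He).
Qed.

End HankelGamma.

Definition eta_hat (s : C) : C := hankel_Gamma f_eta (1 / 2) s.
(** The minus sign compensates 2 i sin (pi (s - 1)) = - 2 i sin (pi s). The radius 1/12 is an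
    arbitrary value below the 1/6 where [f_zeta] is controlled. *)
Definition zeta_hat (s : C) : C := - (Gamma (1 - s) / (2 * PI * Ci) * hankel f_zeta (1 / 12) (s - 1)).

Lemma f_eta_bounded : mellin_bounded 0 0 (fun t => f_eta (RtoC (- t))).
Proof. rewrite f_eta_kernel. apply eta_mellin. Qed.

Lemma eta_hat_mellin (s : C) : (0 < Re s)%R -> noninteger s ->
  eta_hat s = mellin0 (fun t => RtoC (eta_kernel t)) s / Gamma s.
Proof.
  intros Hs Hn. unfold eta_hat. rewrite <- f_eta_kernel.
  apply (hankel_Gamma_mellin f_eta 1 3 f_eta_hol f_eta_bound f_eta_bounded); [lra | exact Hs | exact Hn].
Qed.

Lemma ex_cderive_eta_hat (s : C) : noninteger s -> ex_cderive eta_hat s.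
Proof. apply (ex_cderive_hankel_Gamma f_eta 1 f_eta_hol f_eta_bounded). lra. Qed.

Lemma mero_at_eta_hat (p : C) : mero_at eta_hat p.
Proof. apply (mero_at_hankel_Gamma f_eta 1 f_eta_hol f_eta_bounded). lra. Qed.

Lemma Re_minus_1 (s : C) : Re (s - 1) = (Re s - 1)%R.
Proof. destruct s; simpl; ring. Qed.

Lemma zeta_hat_mellin (s : C) : (1 < Re s)%R -> noninteger s ->
  zeta_hat s = mellin0 (fun t => RtoC (zeta_kernel t)) s / Gamma s.
Proof.
  intros Hs Hn. unfold zeta_hat.
  rewrite (hankel_mellin f_zeta (1 / 6) 6 f_zeta_hol f_zeta_bound f_zeta_bounded (1 / 12) (s - 1)).
  - rewrite mellin_f_zeta by exact Hs.
    unfold Cdiv. rewrite (inv_Gamma s Hn). unfold Cdiv.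
    replace (csin2 s) with (- csin2 (s - 1)); [ring|].
    rewrite <- csin2_succ. f_equal. ring.
  - lra.
  - rewrite Re_minus_1. lra.
Qed.

Lemma ex_cderive_hankel_zeta (s : C) : ex_cderive (fun s => hankel f_zeta (1 / 12) (s - 1)) s.
Proof.
  apply (ex_cderive_comp (hankel f_zeta (1 / 12)) (fun s => s - 1)).
  - apply (ex_cderive_hankel f_zeta (1 / 6) f_zeta_hol f_zeta_bounded). lra.
  - apply ex_cderive_shift.
Qed.

Lemma ex_cderive_zeta_hat (s : C) : noninteger s -> ex_cderive zeta_hat s.
Proof.
  intros Hn. apply ex_cderive_opp, ex_cderive_mult; [|apply ex_cderive_hankel_zeta].
  apply ex_cderive_div; [exact two_PI_Ci_ne | | apply ex_cderive_const].
  apply ex_cderive_1_minus, ex_cderive_Gamma, noninteger_not_pole, noninteger_1_minus, Hn.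
Qed.

Lemma mero_at_zeta_hat (p : C) : mero_at zeta_hat p.
Proof.
  apply mero_at_ext with (fun s => - (1) * (Gamma (1 - s) * / (2 * PI * Ci) * hankel f_zeta (1 / 12) (s - 1))).
  - apply locally'_Cmod. exists 1%R. split; [lra|]. intros w _ _. unfold zeta_hat, Cdiv. ring.
  - apply mero_at_mult; [apply mero_at_const|]. apply mero_at_mult.
    + apply mero_at_mult; [apply mero_at_comp_1_minus, mero_at_Gamma | apply mero_at_const].
    + apply holomorphic_mero_at, holomorphic_at_Cmod. exists 1%R. split; [lra|].
      intros w _. apply ex_cderive_hankel_zeta.
Qed.

Lemma is_series_C_unique (u : nat -> C) (a b : C) :
  is_Cseries u a ->
  is_Cseries u b -> a = b.
Proof. apply filterlim_locally_unique. Qed.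

Lemma Re_near (s : C) (sigma : R) : (sigma < Re s)%R -> exists d, (0 < d)%R /\
  forall w, (Cmod (w - s) < d)%R -> (sigma < Re w)%R.
Proof.
  intros H. exists (Re s - sigma)%R. split; [lra|]. intros w Hw.
  assert (K := Cmod_Re_le (w - s)). replace (Re (w - s)) with (Re w - Re s)%R in K by (destruct w, s; reflexivity).
  assert (K' : (Rabs (Re w - Re s) < Re s - sigma)%R) by lra. apply Rabs_lt_between in K'. lra.
Qed.

(* If Phi is a meromorphic expression away from the integers and Psi sums the
   Dirichlet series, gluing them gives a continuation; by the identity theorem
   the continuation chosen by [dirichlet_continuation] agrees with Phi. *)
Lemma dirichlet_continuation_spec (a : nat -> R) (sigma : R) (Phi Psi : C -> C) :
  (forall p, mero_at Phi p) ->
  (forall s, (sigma < Re s)%R -> ex_cderive Psi s) ->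
  (forall s, (sigma < Re s)%R -> noninteger s -> Phi s = Psi s) ->
  (forall s, (sigma < Re s)%R -> is_Cseries (dirichlet_term a s) (Psi s)) ->
  meromorphic (dirichlet_continuation a sigma) /\
  forall p, punctured p (fun z => dirichlet_continuation a sigma z = Phi z).
Proof.
  intros HPhi HPsi E Hser.
  (* At integers of the half plane the formula Phi may have a wrong value, as it can contain Gamma
     (1 - s) at a pole, but the continuation must sum the series there; hence Psi is used on the
     whole half plane. *)
  set (g := fun s => if Rlt_dec sigma (Re s) then Psi s else Phi s).
  assert (Gg : forall s, noninteger s -> Phi s = g s).
  { intros s Hs. unfold g. destruct Rlt_dec as [L|L]; [apply E; assumption | reflexivity]. }
  assert (Mg : forall p, mero_at g p).
  { intros p. apply mero_at_ext with Phi; [|apply HPhi]. generalize (noninteger_near p). apply locally'_imp, Gg. }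
  destruct (meromorphic_regularization g Mg) as [F [HF1 HF2]].
  assert (CF : continues_dirichlet a sigma F).
  { split; [exact HF1|]. intros s Hs. rewrite HF2.
    - unfold g. destruct Rlt_dec as [L|L]; [apply Hser, Hs | contradiction].
    - destruct (Re_near s sigma Hs) as [d [Hd H]].
      apply ccont_local with (f := Psi) (d := d); [exact Hd | | apply ex_cderive_ccont, HPsi, Hs].
      intros w Hw. unfold g. destruct Rlt_dec as [L|L]; [reflexivity | exfalso; apply L, H, Hw]. }
  (* Only now that a continuation is exhibited does the [epsilon] term satisfy its specification. *)
  destruct (epsilon_spec (inhabits (fun _ : C => RtoC 0)) (continues_dirichlet a sigma) (ex_intro _ F CF)) as [M1 M2].
  fold (dirichlet_continuation a sigma) in M1, M2. split; [exact M1|].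
  set (V := dirichlet_continuation a sigma) in *.
  assert (I := identity_mero (fun z => V z - Phi z) sigma
    (fun p => mero_at_minus _ _ p (meromorphic_mero_at V M1 p) (HPhi p))).
  intros p. assert (Ip : vanishes_near (fun z => V z - Phi z) p).
  { apply I. intros s Hs. destruct (Re_near s sigma Hs) as [d [Hd H]].
    assert (N := noninteger_near s). apply locally'_Cmod in N. destruct N as [d' [Hd' N]].
    apply locally'_Cmod. exists (Rmin d d'). split; [apply Rmin_pos; assumption|]. intros w Hw Hws.
    assert (Hw1 := H w (Rlt_Rmin_l Hw)).
    rewrite E; [|exact Hw1 | apply N; [apply (Rlt_Rmin_r Hw) | exact Hws]].
    rewrite (is_series_C_unique _ _ _ (M2 w Hw1) (Hser w Hw1)). ring. }
  revert Ip. apply locally'_imp. intros z Hz.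
  replace (V z) with (V z - Phi z + Phi z) by ring. rewrite Hz. ring.
Qed.

Lemma ex_cderive_mellin_Gamma (al : R) (F : R -> C) (s : C) : mellin_bounded 0 al F -> (al < Re s)%R -> (0 < Re s)%R ->
  ex_cderive (fun s => mellin0 F s / Gamma s) s.
Proof.
  intros HF Hs Hs0. apply ex_cderive_div; [apply Gamma_ne, Re_pos_not_pole, Hs0 | |
    apply ex_cderive_Gamma, Re_pos_not_pole, Hs0].
  apply (ex_cderive_mellin _ _ _ _ lower_end_zero HF s Hs).
Qed.

Lemma zeta_spec : meromorphic zeta /\
  forall p, punctured p (fun z => zeta z = zeta_hat z).
Proof.
  apply dirichlet_continuation_spec with (Psi := fun s => mellin0 (fun t => RtoC (zeta_kernel t)) s / Gamma s).
  - apply mero_at_zeta_hat.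
  - intros s Hs. apply ex_cderive_mellin_Gamma with 1%R; [apply zeta_mellin | exact Hs | lra].
  - intros s Hs Hn. apply zeta_hat_mellin; assumption.
  - intros s Hs. apply (proj2 zeta_mellin s Hs).
Qed.

Lemma zeta_noninteger (s : C) : noninteger s -> zeta s = zeta_hat s.
Proof.
  intros Hn. destruct zeta_spec as [M E].
  assert (Cz : ccont zeta_hat s) by apply ex_cderive_ccont, ex_cderive_zeta_hat, Hn.
  apply punctured_value; [|exact Cz | apply E].
  apply ex_cderive_ccont, holomorphic_at_ex, (meromorphic_no_pole zeta zeta_hat s M Cz (E s)).
Qed.

(** For Re s <= 0 [eta] is defined through zeta, which has to match the Hankel formula. For Re s > 1
    the relation is the kernel identity x/(1+x) = x/(1-x) - 2 x^2/(1-x^2) with x = e^(-t), whose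
    last term is a dilation by 2; the identity theorem does the rest. *)
Lemma eta_zeta_hat (s : C) : noninteger s -> (1 - cpow 2 (1 - s)) * zeta_hat s = eta_hat s.
Proof.
  assert (Mult : forall s, (1 < Re s)%R -> noninteger s -> (1 - cpow 2 (1 - s)) * zeta_hat s = eta_hat s).
  { intros z Hz Hn. rewrite zeta_hat_mellin, eta_hat_mellin by (assumption || lra).
    set (Z := mellin0 (fun t => RtoC (zeta_kernel t)) z).
    assert (IZ := is_CInt_gen_mellin _ _ _ _ lower_end_zero (proj1 zeta_mellin) z Hz). fold Z in IZ.
    assert (I2 := is_CInt_gen_scal _ _ 2 _ _ (is_CInt_gen_mterm_dilate _ z 2 Z Rlt_0_2 IZ)).
    assert (I := is_RInt_gen_minus (V := C_R_NormedModule) _ _ _ _ IZ I2).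
    assert (E : mellin0 (fun t => RtoC (eta_kernel t)) z = Z - 2 * (cpow 2 (- z) * Z)).
    { apply CInt_gen_unique; [apply _ .. |].
      eapply is_CInt_gen_ext; [apply _ .. | | | apply infty_gt | exact I].
      - intros t Ht. change (minus ?x ?y) with (x - y). unfold mterm.
        destruct (exp_neg_lt_1 t Ht) as [P Q].
        assert (Ek : eta_kernel t = (zeta_kernel t - 2 * zeta_kernel (2 * t))%R).
        { unfold eta_kernel, zeta_kernel. replace (- (2 * t))%R with (- t + - t)%R by ring. rewrite exp_plus.
          field. split; [|split]; nra. }
        rewrite Ek, RtoC_minus, RtoC_mult. ring.
      - apply at_right_pos. }
    rewrite E. replace (1 - z) with (1 + - z) by ring. rewrite cpow_plus, cpow_1 by lra.
    unfold Cdiv. ring. }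
  intros Hn. apply (punctured_value (fun s => (1 - cpow 2 (1 - s)) * zeta_hat s) eta_hat).
  - apply ex_cderive_ccont, ex_cderive_mult; [|apply ex_cderive_zeta_hat, Hn].
    apply ex_cderive_minus; [apply ex_cderive_const|]. apply ex_cderive_cexp.
    apply ex_cderive_mult; [apply ex_cderive_minus; [apply ex_cderive_const | apply ex_cderive_id] | apply ex_cderive_const].
  - apply ex_cderive_ccont, ex_cderive_eta_hat, Hn.
  - assert (I : vanishes_near (fun s => (1 - cpow 2 (1 - s)) * zeta_hat s - eta_hat s) s).
    { apply (identity_mero _ 1).
      - intros p. apply mero_at_minus; [|apply mero_at_eta_hat]. apply mero_at_mult; [|apply mero_at_zeta_hat].
        apply holomorphic_mero_at, holomorphic_at_Cmod. exists 1%R. split; [lra|]. intros w _.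
        apply ex_cderive_minus; [apply ex_cderive_const|]. apply ex_cderive_cexp.
        apply ex_cderive_mult; [apply ex_cderive_minus; [apply ex_cderive_const | apply ex_cderive_id] | apply ex_cderive_const].
      - intros z Hz. destruct (Re_near z 1 Hz) as [d [Hd H]].
        assert (N := noninteger_near z). apply locally'_Cmod in N. destruct N as [d' [Hd' N]].
        apply locally'_Cmod. exists (Rmin d d'). split; [apply Rmin_pos; assumption|]. intros w Hw Hwz.
        rewrite Mult; [ring | |].
        + apply H, (Rlt_Rmin_l Hw).
        + apply N; [apply (Rlt_Rmin_r Hw) | exact Hwz]. }
    revert I. apply locally'_imp. intros z Hz.
    replace (eta_hat z) with ((1 - cpow 2 (1 - z)) * zeta_hat z - ((1 - cpow 2 (1 - z)) * zeta_hat z - eta_hat z)) by ring.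
    rewrite Hz. ring.
Qed.

Lemma CSeries_unique (u : nat -> C) (l : C) :
  is_Cseries u l -> CSeries u = l.
Proof.
  intros H.
  assert (Near : forall e, (0 < e)%R -> eventually (fun n => Cmod (sumC u n - l) < e)%R).
  { intros e He. apply (H (fun y => Cmod (y - l) < e)%R). apply locally_Cmod. exists e. split; [exact He|tauto]. }
  assert (SR : forall n, Re (sumC u n) = sumR (fun k => Re (u k)) n /\
                         Im (sumC u n) = sumR (fun k => Im (u k)) n).
  { induction n as [|n [I1 I2]]; [rewrite !sum_O; split; reflexivity|].
    rewrite !sum_Sn, <- I1, <- I2. split; reflexivity. }
  unfold CSeries. apply C_ext; simpl; apply is_series_unique; intros P [e HP];
    destruct (Near e (cond_pos e)) as [N HN]; exists N; intros n Hn; apply HP; specialize (HN n Hn).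
  - change (Rabs (sumR (fun k => Re (u k)) n - Re l) < e)%R. rewrite <- (proj1 (SR n)).
    apply Rle_lt_trans with (2 := HN), (Cmod_Re_le (sumC u n - l)).
  - change (Rabs (sumR (fun k => Im (u k)) n - Im l) < e)%R. rewrite <- (proj2 (SR n)).
    apply Rle_lt_trans with (2 := HN), (Cmod_Im_le (sumC u n - l)).
Qed.

Lemma eta_noninteger (s : C) : noninteger s -> eta s = eta_hat s.
Proof.
  intros Hn. unfold eta. destruct Rlt_dec as [L|L].
  - rewrite eta_hat_mellin by assumption. apply CSeries_unique, (proj2 eta_mellin s L).
  - rewrite zeta_noninteger by exact Hn. apply eta_zeta_hat, Hn.
Qed.

(** * The logarithm in the integrand of G, and the formula for G *)

Section LogBranch.

Variable l : C -> C.
Hypothesis l_branch : is_log_branch l.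

Definition f_G (z : C) : C := cexp z / (1 + cexp z) * l z.

(** On the negative axis the branch is real, so the modulus of its exponential determines it. *)
Lemma log_branch_neg (t : R) : (0 < t)%R -> l (RtoC (- t)) = RtoC (- log_kernel t - ln t)%R.
Proof.
  intros Ht. destruct l_branch as (_ & _ & H). destruct (H (- t)%R) as [H1 H2]; [lra|].
  destruct (exp_neg_lt_1 t Ht) as [P Q].
  rewrite cexp_RtoC, <- RtoC_minus, <- RtoC_div in H2 by lra.
  apply C_ext; [|exact H1]. simpl.
  apply (f_equal Cmod) in H2. rewrite Cmod_cexp, Cmod_R, Rabs_pos_eq in H2.
  2: { replace ((exp (- t) - 1) / - t)%R with ((1 - exp (- t)) / t)%R by (field; lra).
       apply Rdiv_le_0_compat; lra. }
  rewrite <- (ln_exp (Re _)), H2. unfold log_kernel.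
  replace ((exp (- t) - 1) / - t)%R with ((1 - exp (- t)) / t)%R by (field; lra).
  rewrite ln_div by lra. ring.
Qed.

Lemma f_G_neg (t : R) : (0 < t)%R -> f_G (RtoC (- t)) = RtoC (eta_kernel t * (- log_kernel t - ln t))%R.
Proof.
  intros Ht. unfold f_G. rewrite log_branch_neg by exact Ht. rewrite RtoC_mult. f_equal. apply f_eta_neg.
Qed.

Lemma f_G_bounded : mellin_bounded 0 0 (fun t => f_G (RtoC (- t))).
Proof.
  apply mellin_bounded_2.
  - intros t Ht. apply rcont_eps. intros e He.
    assert (Hc : rcont (fun t => RtoC (eta_kernel t * (- log_kernel t - ln t))%R) t).
    { apply (rcont_RtoC (fun t => (eta_kernel t * (- log_kernel t - ln t))%R)), ex_derive_Rcontinuous.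
      destruct (exp_neg_lt_1 t Ht). unfold eta_kernel, log_kernel. auto_derive. repeat split; lra. }
    destruct (proj1 (rcont_eps _ _) Hc e He) as [d [Hd H]].
    exists (Rmin d t). split; [apply Rmin_pos; assumption|]. intros u Hu.
    assert (Hu0 : (0 < u)%R).
    { assert (K := Rlt_Rmin_r Hu). apply Rabs_lt_between in K. lra. }
    rewrite !f_G_neg by assumption. apply H, (Rlt_Rmin_l Hu).
  - intros t Ht. rewrite f_G_neg, Cmod_R by exact Ht. destruct (exp_neg_lt_1 t Ht) as [P Q].
    assert (L := one_minus_exp_lower t Ht).
    rewrite Rabs_mult.
    assert (E1 : (0 <= eta_kernel t <= exp (- t))%R).
    { unfold eta_kernel. split; [apply Rdiv_le_0_compat; lra|].
      apply Rmult_le_reg_r with (1 + exp (- t))%R; [lra|]. unfold Rdiv. rewrite Rmult_assoc, Rinv_l by lra. nra. }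
    (* The logarithmic singularities at 0 cancel: ln (1 - e^(-t)) - ln t lies between - ln (1 + t)
       and 0. Hence the exponent 0 is admissible, although neither logarithm alone is bounded at
       0. *)
    assert (E2 : (Rabs (- log_kernel t - ln t) <= 1 + t)%R).
    { unfold log_kernel. rewrite Ropp_involutive.
      assert (U : (ln (1 - exp (- t)) <= ln t)%R).
      { apply ln_le_mono; [lra|]. assert (K := exp_ineq1_le (- t)). lra. }
      assert (Lo : (ln t - ln (1 + t) <= ln (1 - exp (- t)))%R).
      { rewrite <- ln_div by lra. apply ln_le_mono; [apply Rdiv_lt_0_compat; lra | exact L]. }
      assert (ln (1 + t) <= t)%R.
      { apply Rle_trans with (ln (exp t)); [|rewrite ln_exp; lra]. apply ln_le_mono; [lra | apply exp_ineq1_le]. }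
      apply Rabs_le. lra. }
    rewrite (Rabs_pos_eq (eta_kernel t)) by lra. rewrite Rmult_comm.
    apply Rmult_le_compat; try lra. apply Rabs_pos.
Qed.

(** The branch is holomorphic on some disc only, so the radius depends on l; it becomes the [eps0]
    of [is_G]. The bound 1 on the radius controls 1 + e^z. *)
Lemma f_G_local : exists R0 M, (0 < R0)%R /\
  (forall z, (0 < Cmod z < R0)%R -> ex_cderive f_G z) /\
  (forall z, (0 < Cmod z < R0)%R -> (Cmod (f_G z) <= M)%R).
Proof.
  destruct l_branch as (Hl & _). apply holomorphic_at_Cmod in Hl. destruct Hl as [d [Hd Hl]].
  assert (E0 : forall z : C, z - 0 = z) by (intros; ring).
  destruct (ex_cderive_ccont _ _ (Hl 0 (Cmod_self_lt 0 d Hd)) 1%R Rlt_0_1) as [d' [Hd' Cl]].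
  exists (Rmin 1 (Rmin d d')), (3 * (Cmod (l 0) + 1))%R. split; [repeat apply Rmin_pos; lra|].
  assert (K : forall z, (0 < Cmod z < Rmin 1 (Rmin d d'))%R -> (0 < Cmod z < 1)%R /\ (Cmod z < d)%R /\ (Cmod z < d')%R).
  { intros z Hz. assert (A := Rmin_l 1 (Rmin d d')). assert (B := Rmin_r 1 (Rmin d d')).
    assert (A' := Rmin_l d d'). assert (B' := Rmin_r d d'). lra. }
  split; intros z Hz; destruct (K z Hz) as (K1 & K2 & K3).
  - apply (ex_cderive_mult f_eta l); [apply f_eta_hol, K1 | apply Hl; rewrite E0; exact K2].
  - unfold f_G. rewrite Cmod_mult. apply Rmult_le_compat; try apply Cmod_ge_0; [apply (f_eta_bound z K1)|].
    specialize (Cl z). rewrite E0 in Cl. specialize (Cl K3).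
    assert (T := Cmod_triangle_rev (l z) (l 0)). lra.
Qed.

(* On the negative axis f_G is v_kernel - log_kernel - ln t * eta_kernel, and
   the factor ln t differentiates the Mellin transform. *)
Lemma mellin_f_G (s D : C) : (0 < Re s)%R ->
  is_cderive (mellin0 (fun t => RtoC (eta_kernel t))) s D ->
  mellin0 (fun t => f_G (RtoC (- t))) s
  = mellin0 (fun t => RtoC (v_kernel t)) s - mellin0 (fun t => RtoC (log_kernel t)) s - D.
Proof.
  (* The kernels with a logarithm need a positive exponent below Re s, and Re s / 2 is one. *)
  intros Hs HD. assert (Hs2 : (Re s / 2 < Re s)%R) by lra. assert (Hs3 : (0 < Re s / 2)%R) by lra.
  destruct (mellin_derive _ _ _ _ lower_end_zero (proj1 eta_mellin) s Hs) as [D' [ID HD']].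
  rewrite (is_cderive_unique _ _ _ _ HD HD').
  assert (IV := is_CInt_gen_mellin _ _ _ _ lower_end_zero (proj1 (v_mellin _ Hs3)) s Hs2).
  assert (IL := is_CInt_gen_mellin _ _ _ _ lower_end_zero (proj1 (log_mellin _ Hs3)) s Hs2).
  assert (I := is_RInt_gen_minus (V := C_R_NormedModule) _ _ _ _ (is_RInt_gen_minus (V := C_R_NormedModule) _ _ _ _ IV IL) ID).
  apply CInt_gen_unique; [apply _ .. |].
  eapply is_CInt_gen_ext; [apply _ .. | | | apply infty_gt | exact I].
  - intros t Ht. repeat change (minus ?x ?y) with (x - y). unfold mterm. rewrite f_G_neg by exact Ht.
    destruct (exp_neg_lt_1 t Ht) as [P Q].
    replace (eta_kernel t * (- log_kernel t - ln t))%R with (v_kernel t - log_kernel t - ln t * eta_kernel t)%R.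
    + rewrite !RtoC_minus, RtoC_mult. ring.
    + unfold eta_kernel, v_kernel, log_kernel. field. lra.
  - apply at_right_pos.
Qed.

End LogBranch.

(** Both sides sum the same Dirichlet series, since n^(-1) n^(-s) = n^(-(s+1)). *)
Lemma log_mellin_zeta (s : C) : (0 < Re s)%R ->
  mellin0 (fun t => RtoC (log_kernel t)) s / Gamma s
  = mellin0 (fun t => RtoC (zeta_kernel t)) (s + 1) / Gamma (s + 1).
Proof.
  intros Hs. assert (Hs3 : (0 < Re s / 2)%R) by lra.
  apply is_series_C_unique with (dirichlet_term (fun n => / INR n)%R s).
  - apply (proj2 (log_mellin _ Hs3)). lra.
  - assert (E : dirichlet_term (fun n => / INR n)%R s = dirichlet_term (fun _ => 1%R) (s + 1)).
    { apply functional_extensionality. intros n. unfold dirichlet_term.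
      assert (Hn : (0 < INR (S n))%R) by (rewrite S_INR; pose proof (pos_INR n); lra).
      assert (Hn' : RtoC (INR (S n)) <> 0) by (intros E; apply RtoC_inj in E; lra).
      replace (- s) with (- (s + 1) + 1) by ring. rewrite cpow_plus, cpow_1 by exact Hn.
      rewrite RtoC_inv by lra. field. exact Hn'. }
    rewrite E. apply (proj2 zeta_mellin). destruct s; simpl in *; lra.
Qed.

(** The right-hand side obtained by solving the asserted identity for v, with G, zeta and eta given
    by their Hankel formulas. *)
Definition v_hat (l : C -> C) (e : R) (s : C) : C :=
  hankel_Gamma (f_G l) e s + zeta_hat (s + 1) + digamma s * eta_hat s + C_derive eta_hat s.

(** By the reflection formula 1 / Gamma is, off the integers, a product of functions already known
    to be meromorphic. *)
Lemma mero_at_inv_Gamma (p : C) : mero_at (fun s => / Gamma s) p.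
Proof.
  apply mero_at_ext with (fun s => Gamma (1 - s) * csin2 s * / (2 * PI * Ci)).
  - generalize (noninteger_near p). apply locally'_imp. intros z Hz. symmetry. apply inv_Gamma, Hz.
  - apply mero_at_mult; [|apply mero_at_const]. apply mero_at_mult.
    + apply mero_at_comp_1_minus, mero_at_Gamma.
    + apply holomorphic_mero_at, holomorphic_at_Cmod. exists 1%R. split; [lra|]. intros w _. apply ex_cderive_csin2.
Qed.

Lemma noninteger_C_derive (f : C -> C) (s : C) : (forall w, noninteger w -> ex_cderive f w) ->
  noninteger s -> ex_cderive (C_derive f) s.
Proof.
  intros Hf Hs. apply holomorphic_at_ex, holomorphic_at_C_derive, noninteger_holomorphic; assumption.
Qed.

Lemma ex_cderive_Gamma_noninteger (s : C) : noninteger s -> ex_cderive Gamma s.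
Proof. intros H. apply ex_cderive_Gamma, noninteger_not_pole, H. Qed.

Lemma v_spec (l : C -> C) (R0 M e : R) : is_log_branch l ->
  (forall z, (0 < Cmod z < R0)%R -> ex_cderive (f_G l) z) ->
  (forall z, (0 < Cmod z < R0)%R -> (Cmod (f_G l z) <= M)%R) -> (0 < e < R0)%R ->
  (forall s, noninteger s -> ex_cderive (v_hat l e) s) /\
  forall p, punctured p (fun z => v z = v_hat l e z).
Proof.
  intros Hl Hhol Hbd He. assert (HB := f_G_bounded l Hl). split.
  { intros s Hs. unfold v_hat. apply ex_cderive_plus; [apply ex_cderive_plus; [apply ex_cderive_plus|]|].
    - apply (ex_cderive_hankel_Gamma (f_G l) R0 Hhol HB e s He Hs).
    - apply (ex_cderive_comp zeta_hat (fun s => s + 1)).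
      + apply ex_cderive_zeta_hat. exact (noninteger_shift s 1 Hs).
      + apply ex_cderive_plus; [apply ex_cderive_id | apply ex_cderive_const].
    - apply ex_cderive_mult; [|apply ex_cderive_eta_hat, Hs]. apply ex_cderive_div.
      + apply Gamma_ne, noninteger_not_pole, Hs.
      + apply noninteger_C_derive; [apply ex_cderive_Gamma_noninteger | exact Hs].
      + apply ex_cderive_Gamma_noninteger, Hs.
    - apply noninteger_C_derive; [apply ex_cderive_eta_hat | exact Hs]. }
  refine (proj2 (dirichlet_continuation_spec (fun n => alt_sign n * H_minus n)%R 0 (v_hat l e)
    (fun s => mellin0 (fun t => RtoC (v_kernel t)) s / Gamma s) _ _ _ _)).
  - intros p. apply mero_at_plus; [apply mero_at_plus; [apply mero_at_plus|]|].
    + apply (mero_at_hankel_Gamma (f_G l) R0 Hhol HB e p He).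
    + apply mero_at_ext with (fun s => zeta_hat (1 * s + 1)).
      * apply locally'_Cmod. exists 1%R. split; [lra|]. intros w _ _. f_equal. ring.
      * apply mero_at_affine; [apply Cmod_1 | apply mero_at_zeta_hat].
    + apply mero_at_mult; [|apply mero_at_eta_hat]. apply mero_at_mult; [|apply mero_at_inv_Gamma].
      apply mero_at_C_derive, mero_at_Gamma.
    + apply mero_at_C_derive, mero_at_eta_hat.
  - intros s Hs. assert (Hs3 : (0 < Re s / 2)%R) by lra.
    apply ex_cderive_mellin_Gamma with (Re s / 2)%R; [apply (v_mellin _ Hs3) | lra | exact Hs].
  - intros s Hs Hn. unfold v_hat, digamma.
    rewrite (hankel_Gamma_mellin (f_G l) R0 M Hhol Hbd HB e s He Hs Hn).
    assert (HG := Gamma_ne s (noninteger_not_pole s Hn)).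
    (* The Mellin transform of the eta kernel is Gamma times [eta_hat] near s; its derivative
       divided by Gamma gives the digamma term and the derivative term. *)
    assert (Dm : is_cderive (mellin0 (fun t => RtoC (eta_kernel t))) s
       (C_derive Gamma s * eta_hat s + Gamma s * C_derive eta_hat s)%C).
    { destruct (noninteger_open s Hn) as [d [Hd N]]. destruct (Re_near s 0 Hs) as [d' [Hd' N']].
      apply is_cderive_local with (f := fun z => Gamma z * eta_hat z) (d := Rmin d d'); [apply Rmin_pos; assumption| |].
      - intros w Hw. assert (Hw1 := N w (Rlt_Rmin_l Hw)).
        rewrite eta_hat_mellin; [|apply N', (Rlt_Rmin_r Hw) | exact Hw1].
        field. apply Gamma_ne, noninteger_not_pole, Hw1.
      - apply is_cderive_mult; apply C_derive_is; [apply ex_cderive_Gamma_noninteger, Hn | apply ex_cderive_eta_hat, Hn]. }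
    rewrite (mellin_f_G l Hl s _ Hs Dm).
    assert (Hs1 : (1 < Re (s + 1))%R) by (destruct s; simpl in *; lra).
    rewrite (zeta_hat_mellin (s + 1) Hs1 (noninteger_shift s 1 Hn)), <- log_mellin_zeta by exact Hs.
    field. exact HG.
  - intros s Hs. assert (Hs3 : (0 < Re s / 2)%R) by lra. apply (proj2 (v_mellin _ Hs3)). lra.
Qed.

Theorem theorem4 :
  forall (l : C -> C) (s : C),
    is_log_branch l ->
    (forall n : nat, s <> INR (S n)) ->
    (forall n : nat, s <> - INR n) ->
    holomorphic_at v s ->
    is_G l s (v s - zeta (s + 1) - digamma s * eta s - C_derive eta s).
Proof.
  intros l s Hl Hpos Hneg Hv.
  (* The two families of excluded values together are all the integers. *)
  assert (Hn : noninteger s).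
  { intros k E. destruct (Z_le_gt_dec k 0) as [L|L].
    - apply (Hneg (Z.to_nat (- k))). rewrite E, INR_IZR_INZ, Z2Nat.id by lia. rewrite opp_IZR, RtoC_opp. ring.
    - apply (Hpos (Z.to_nat (k - 1))). rewrite E, INR_IZR_INZ. do 2 f_equal. lia. }
  destruct (f_G_local l Hl) as (R0 & M & HR0 & Hhol & Hbd).
  exists R0. split; [exact HR0|]. intros e He.
  exists (hankel (f_G l) e s).
  split; [apply (is_hankel_integral_hankel (f_G l) R0 Hhol (f_G_bounded l Hl) e s He)|].
  destruct (v_spec l R0 M e Hl Hhol Hbd He) as [Cv Ev].
  (* [v_spec] identifies the two functions only near s, not at s; holomorphy of v at s supplies the
     continuity that fixes the value. *)
  assert (E : v s = v_hat l e s).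
  { apply punctured_value; [apply ex_cderive_ccont, holomorphic_at_ex, Hv | apply ex_cderive_ccont, Cv, Hn | apply Ev]. }
  (* Derivatives need equality on a full disc, which exists because the nonintegers form an open
     set. *)
  assert (De : C_derive eta s = C_derive eta_hat s).
  { apply is_C_derive_unique. destruct (noninteger_open s Hn) as [d [Hd N]].
    apply is_cderive_local with (f := eta_hat) (d := d); [exact Hd | | apply C_derive_is, ex_cderive_eta_hat, Hn].
    intros w Hw. symmetry. apply eta_noninteger, N, Hw. }
  rewrite E, De, (eta_noninteger s Hn), (zeta_noninteger (s + 1) (noninteger_shift s 1 Hn)).
  unfold v_hat, hankel_Gamma. ring.
Qed.
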